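(* Consider the HashGraph Protocol with $n$ parties and fix some round-$r$ witness $x$. There exists an adversarial strategy delaying a decision on $x$'s famousness for exponentially many rounds in expectation; that is, under this strategy the expected number of rounds until $x$'s fame is decided is at least exponential in $n$ (at least $e^{\alpha n}$ for some absolute constant $\alpha>0$ and all sufficiently large $n$).
   Context: **Model.** There are $n$ parties. A static adversary chooses at the start at most $t<n/3$ parties to corrupt; corrupted parties are coordinated and act arbitrarily, and the others are honest and follow the protocol. The network is asynchronous: the adversary controls the network and may delay and reorder messages arbitrarily, but every message is eventually delivered. There is a public key infrastructure with an unforgeable signature scheme and an agreed collision-resistant hash function. The signature scheme produces a unique signature for each input, and the coin flips below (middle bits of witnesses' signatures) are assumed uniform and independent. **Events and hashgraphs.** An event contains a set of transactions, a creator ID, a timestamp, a signature by the creator, and hashes of two earlier events: its self-parent (for an honest creator, the creator's previous event) and its other-parent (an event by a different creator). The exception is each party's first (genesis) event, which has no parents. An ancestor of $x$ is any event reachable from $x$ by following parent pointers ($x$ counts as an ancestor of itself); $x$ is a descendant of $y$ if $y$ is an ancestor of $x$. A hashgraph is a directed acyclic graph whose vertices are events and whose edges are the parent pointers; it contains all ancestors of each of its events. A fork is a pair of events $(x,y)$ by the same creator, neither an ancestor of the other; honest parties never fork. An event $x$ observes a fork $(z,z')$ if $x$ is a descendant of both $z$ and $z'$. In a hashgraph, $x$ sees $y$ if $y$ is an ancestor of $x$ and $x$ does not observe a fork by $y$'s creator; $x$ strongly sees $y$ if $x$ sees a set of more than $2n/3$ events with distinct creators each of which sees $y$. **Protocol.**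 Each party creates and multicasts a genesis event and then forever syncs with randomly chosen parties; in a sync an honest sender shares all events it has. The order in which syncs are delivered is chosen by the adversary. A received event is buffered until all its ancestors are in the receiver's hashgraph and is then added; incorrectly formatted or already held events are discarded. After a sync that delivers new events, the receiver creates exactly one new event, whose self-parent is its own previous event and whose other-parent is the latest event shared in the sync, and then processes its hashgraph locally as follows. *Rounds.* Genesis events get round 1. For any other event $x$ let $\rho$ be the maximum of its parents' rounds; $x$ has round $\rho+1$ if it strongly sees more than $2n/3$ round-$\rho$ witnesses from distinct parties, and round $\rho$ otherwise. $x$ is a witness if it has no self-parent or its self-parent has a smaller round. *Famousness* (coin-round parameter: an integer $c>1$). For each witness $x$, process the witnesses $y$ of later rounds in order of increasing round. Let $d=y.round-x.round$. If $d=1$, $y$ votes ''yes'' iff $y$ sees $x$. If $d\ge 2$, let $s$ be the set of round-$(y.round-1)$ witnesses that $y$ strongly sees, $v$ the majority of their votes (''yes'' on a tie), and $m$ the number of votes for $v$ in $s$. If $d\not\equiv 0 \pmod c$ (normal round), $y$ votes $v$, and if in addition $m>2n/3$ then $x$'s fame is decided to be $v$ and the election for $x$ stops. If $d\equiv 0\pmod c$ (coin round), $y$ votes $v$ if $m>2n/3$, and otherwise votes by coin flip, i.e. according to the middle bit of its signature (1 = ''yes''); no decision is made. If no decision is reached, $x$'s fame is undecided. *)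

(* Defs.v *)
From HB Require Import structures.
From mathcomp Require Import all_boot all_order all_algebra.
From mathcomp Require Import all_classical all_reals all_analysis.

Set Implicit Arguments.
Unset Strict Implicit.
Unset Printing Implicit Defensive.

Import Order.TTheory GRing.Theory Num.Theory.

Local Open Scope nat_scope.

(* A hash of a parent is represented by the parent itself (collision
   resistance), so an event is the tree of its ancestors.  The creator's
   signature is not stored, being determined by the rest of the event (unique
   signatures).  The payload [d : D] stands for the transaction set together
   with the timestamp; consensus on fame never reads it. *)
Inductive event (n : nat) (D : Type) : Type :=
| Genesis (p : 'I_n) (d : D)
| Child (p : 'I_n) (d : D) (self other : event n D).

Section EventChoice.
Variables (n : nat) (D : choiceType).

Fixpoint tree_of_event (x : event n D) : GenTree.tree ('I_n * D) :=
  match x with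
  | Genesis p d => GenTree.Leaf (p, d)
  | Child p d s o =>
    GenTree.Node 0 [:: GenTree.Leaf (p, d); tree_of_event s; tree_of_event o]
  end.

Fixpoint event_of_tree (t : GenTree.tree ('I_n * D)) : option (event n D) :=
  match t with
  | GenTree.Leaf (p, d) => Some (Genesis p d)
  | GenTree.Node _ [:: GenTree.Leaf (p, d); s; o] =>
    if event_of_tree s is Some s' then
      if event_of_tree o is Some o' then Some (Child p d s' o') else None
    else None
  | _ => None
  end.

Lemma tree_of_eventK : pcancel tree_of_event event_of_tree.
Proof. by elim=> //= p d s -> o ->. Qed.

End EventChoice.

HB.instance Definition _ (n : nat) (D : choiceType) :=
  Choice.copy (event n D) (pcan_type (@tree_of_eventK n D)).

(* [m] is more than two thirds of [n]. *)
Definition supermajority (n m : nat) : bool := 2 * n < 3 * m.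

Section Hashgraph.
Variables (n : nat) (D : choiceType).
Local Notation event := (event n D).

Definition creator (x : event) : 'I_n :=
  match x with Genesis p _ => p | Child p _ _ _ => p end.

Fixpoint well_formed (x : event) : bool :=
  if x is Child p _ s o then
    [&& creator s == p, creator o != p, well_formed s & well_formed o]
  else true.

Fixpoint ancestors (x : event) : seq event :=
  x :: (if x is Child _ _ s o then ancestors s ++ ancestors o else [::]).

Definition is_fork (z z' : event) : bool :=
  [&& creator z == creator z', z \notin ancestors z' & z' \notin ancestors z].

Definition observes_fork_by (x : event) (q : 'I_n) : bool :=
  has (fun z => has (fun z' => (creator z == q) && is_fork z z') (ancestors x))
      (ancestors x).

Definition sees (x y : event) : bool :=
  (y \in ancestors x) && ~~ observes_fork_by x (creator y).

Definition strongly_sees (x y : event) : bool :=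
  supermajority n
    #|[set q | has (fun z => [&& creator z == q, sees x z & sees z y])
                   (ancestors x)]|.

(* Witnesses with respect to a given assignment [rd] of rounds. *)
Definition is_witness (rd : event -> nat) (x : event) : bool :=
  if x is Child _ _ s _ then rd s < rd x else true.

(* The round of [x] depends on the rounds of all its proper ancestors, so the
   structural recursion returns the rounds of all ancestors of [x] at once
   (the value at a non-ancestor is irrelevant).  Lemma [roundE] below is the
   intended recursive equation. *)
Fixpoint rounds (x : event) : event -> nat :=
  match x with
  | Genesis _ _ => fun=> 1
  | Child _ _ s o =>
    let rd z := if z \in ancestors s then rounds s z else rounds o z in
    let rho := maxn (rd s) (rd o) in
    let W := [set q | has (fun w => [&& creator w == q, rd w == rho,
                                        is_witness rd w & strongly_sees x w])
                          (ancestors s ++ ancestors o)] in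
    fun z => if z == x then (if supermajority n #|W| then rho.+1 else rho)
             else rd z
  end.

Definition round (x : event) : nat := rounds x x.

Definition witness (x : event) : bool := is_witness round x.

Lemma ancestors_refl (x : event) : x \in ancestors x.
Proof. by case: x => *; rewrite inE eqxx. Qed.

Lemma ancestors_self (p : 'I_n) (d : D) (s o x : event) :
  Child p d s o \in ancestors x -> s \in ancestors x.
Proof.
elim: x => [q e|q e s' IHs o' IHo] /=; first by rewrite inE.
rewrite !inE !mem_cat => /orP[/eqP[_ _ -> _]|/orP[/IHs ->|/IHo ->]].
- by rewrite ancestors_refl orbT.
- by rewrite orbT.
- by rewrite !orbT.
Qed.

Lemma roundsE (x z : event) : z \in ancestors x -> rounds x z = round z.
Proof.
elim: x => [q e|q e s IHs o IHo]; first by rewrite inE => /eqP->.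
have [-> //|zx] := eqVneq z (Child q e s o).
rewrite [ancestors _]/= inE (negPf zx) /= (negPf zx) mem_cat.
by case: ifP => [/IHs|_ /= /IHo].
Qed.

Lemma roundE (p : 'I_n) (d : D) (s o : event) :
  let x := Child p d s o in
  let rho := maxn (round s) (round o) in
  round x =
    if supermajority n
         #|[set q | has (fun w => [&& creator w == q, round w == rho,
                                      witness w & strongly_sees x w])
                        (ancestors s ++ ancestors o)]|
    then rho.+1 else rho.
Proof.
move=> x rho; rewrite {1}/round /x.
set rd := fun z => if z \in ancestors s then rounds s z else rounds o z.
have rdE z : z \in ancestors s ++ ancestors o -> rd z = round z.
  by rewrite /rd mem_cat; case: ifP => [zs _|_ /=]; exact: roundsE.
have sso : s \in ancestors s ++ ancestors o by rewrite mem_cat ancestors_refl.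
have oso : o \in ancestors s ++ ancestors o.
  by rewrite mem_cat ancestors_refl orbT.
have wE w : w \in ancestors s ++ ancestors o -> is_witness rd w = witness w.
  case: w => // p' d' s' o' wso; rewrite /witness /= !rdE //; move: wso.
  by rewrite !mem_cat => /orP[]/ancestors_self->//; rewrite orbT.
rewrite [LHS]/= eqxx -!/(rd _) (rdE s sso) (rdE o oso) -/rho -/x.
congr (if supermajority n #|pred_of_set _| then _ else _).
apply/setP => q; rewrite !inE; apply: eq_in_has => w wso.
by rewrite -/(rd w) rdE // -(wE w wso).
Qed.

Section Fame.
(* [coin y] is the middle bit of the signature of [y]; [c] is the coin-round
   parameter. *)
Variables (coin : event -> bool) (c : nat).

Definition voters (y : event) : seq event :=
  undup [seq z <- ancestors y | [&& witness z, round z == (round y).-1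
                                  & strongly_sees y z]].

Definition majority (f : event -> bool) (s : seq event) : bool :=
  count (fun z => ~~ f z) s <= count f s.

Definition majority_size (f : event -> bool) (s : seq event) : nat :=
  count (fun z => f z == majority f s) s.

(* The vote on [x] of a witness [y] with [round y = round x + d]. *)
Fixpoint vote (x : event) (d : nat) (y : event) : bool :=
  match d with
  | 0 => false
  | 1 => sees y x
  | d'.+1 =>
    let f := vote x d' in
    if (c %| d) && ~~ supermajority n (majority_size f (voters y)) then coin y
    else majority f (voters y)
  end.

Definition decides (x y : event) : bool :=
  let d := round y - round x in
  [&& witness y, 1 < d, ~~ (c %| d)
    & supermajority n (majority_size (vote x d.-1) (voters y))].

End Fame.
End Hashgraph.

Section Execution.
Variables (n : nat) (D : choiceType).
Local Notation event := (event n D).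

(* A message is (sender, receiver, shared events, the latest one last). *)
Definition message : Type := ('I_n * 'I_n * seq event)%type.

(* The moves of the adversary, which does all the scheduling:
   - [Gossip p]: honest [p] starts its next sync, with a random partner;
   - [Deliver i]: the [i]-th message ever sent reaches its receiver;
   - [Sign e]: the corrupted creator of [e] signs [e];
   - [Send p q l]: corrupted [p] sends to [q] known signed events [l].
   A move which is not possible has no effect. *)
Inductive action : Type :=
| Gossip (p : 'I_n)
| Deliver (i : nat)
| Sign (e : event)
| Send (p q : 'I_n) (l : seq event).

(* [recv p] lists what an honest [p] has received or created, in order, [msgs]
   the messages ever sent, [signed] the events signed by corrupted parties,
   [gossips p] counts the syncs started by [p], [log] lists the past moves. *)
Record config : Type := Config {
  recv : 'I_n -> seq event;
  msgs : seq message;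
  signed : seq event;
  gossips : 'I_n -> nat;
  log : seq action }.

(* The received events all of whose ancestors have been received; the other
   received events are the buffered ones. *)
Definition hashgraph_of (l : seq event) : seq event :=
  [seq e <- l | all (fun z => z \in l) (ancestors e)].

Definition hashgraph (C : config) (p : 'I_n) : seq event :=
  hashgraph_of (recv C p).

(* The signed events known to the adversary, which reads the network. *)
Definition visible (C : config) : seq event :=
  flatten [seq m.2 | m <- msgs C] ++ signed C.

(* The adversary corrupts statically and then moves adaptively, knowing the
   configuration and the signatures of the visible events. *)
Record adversary : Type := Adversary {
  corrupted : {set 'I_n};
  strategy : config -> (event -> bool) -> action }.

Definition upd (T : Type) (f : 'I_n -> T) (p : 'I_n) (v : T) : 'I_n -> T :=
  fun q => if q == p then v else f q.

Definition latest (P : pred event) (l : seq event) : option event :=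
  ohead (rev [seq e <- l | P e]).

(* What the honest [q] holds after being sent [l]; [d] is the payload of the
   event that [q] creates if its hashgraph has grown.  Restricting the
   other-parent to events of [l] that are in the hashgraph and not created by
   [q] matters only when the sender is corrupted. *)
Definition receive (q : 'I_n) (d : D) (H l : seq event) : seq event :=
  let H' := H ++ [seq e <- undup l | well_formed e && (e \notin H)] in
  let G := hashgraph_of H' in
  if all (fun e => e \in hashgraph_of H) G then H' else
  match latest (fun e => creator e == q) H',
        latest (fun e => (creator e != q) && (e \in G)) l with
  | Some s, Some o => rcons H' (Child q d s o)
  | _, _ => H'
  end.

Section Run.
(* [env p k] is the payload of the event created by [p] at step [k] (step 0
   for the genesis event); [coin e] is the middle bit of the signature of [e];
   [partner (p, k)] is the partner of [p] in its [k]-th sync. *)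
Variables (env : 'I_n -> nat -> D) (A : adversary).
Variables (coin : event -> bool) (partner : 'I_n * nat -> 'I_n).

(* The multicast of the genesis events is subject to the same rules as syncs,
   so that its first deliveries make the receivers create events. *)
Definition init : config :=
  Config (fun p => if p \in corrupted A then [::] else [:: Genesis p (env p 0)])
         [seq (pq.1, pq.2, [:: Genesis pq.1 (env pq.1 0)])
            | pq <- enum [set pq : 'I_n * 'I_n
                            | (pq.1 \notin corrupted A) && (pq.1 != pq.2)]]
         [::] (fun=> 0) [::].

Definition effect (C : config) (a : action) : config :=
  match a with
  | Gossip p =>
    if p \in corrupted A then C else
    Config (recv C)
           (rcons (msgs C) (p, partner (p, gossips C p), hashgraph C p))
           (signed C) (upd (gossips C) p (gossips C p).+1) (log C)
  | Deliver i =>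
    if onth (msgs C) i is Some (_, q, l) then
      if q \in corrupted A then C else
      Config (upd (recv C) q
                  (receive q (env q (size (log C)).+1) (recv C q) l))
             (msgs C) (signed C) (gossips C) (log C)
    else C
  | Sign e =>
    if creator e \in corrupted A then
      Config (recv C) (msgs C) (rcons (signed C) e) (gossips C) (log C)
    else C
  | Send p q l =>
    if (p \in corrupted A) && all (fun e => e \in visible C) l then
      Config (recv C) (rcons (msgs C) (p, q, l)) (signed C) (gossips C) (log C)
    else C
  end.

Definition move (C : config) : action :=
  strategy A C (fun e => (e \in visible C) && coin e).

Definition step (C : config) : config :=
  let C' := effect C (move C) in
  Config (recv C') (msgs C') (signed C') (gossips C') (rcons (log C) (move C)).

Definition exec (k : nat) : config := iter k step init.

(* Honest parties sync forever and every message is eventually delivered. *)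
Definition fair_run : Prop :=
  (forall p, p \notin corrupted A ->
     forall k, exists2 j, k <= j & move (exec j) = Gossip p)
  /\ (forall k i, i < size (msgs (exec k)) ->
        exists2 j, k <= j & move (exec j) = Deliver i).

(* [x] is the round-[r] witness of the honest party [p]. *)
Definition is_round_witness_of (p : 'I_n) (r : nat) (x : event) : Prop :=
  [/\ exists k, x \in recv (exec k) p, creator x = p, witness x & round x = r].

(* [d] rounds after [x], some honest party holds a witness that decides the
   fame of [x]. *)
Definition decided_after (c : nat) (x : event) (d : nat) : Prop :=
  exists k q y,
    [/\ q \notin corrupted A, x \in hashgraph (exec k) q,
        y \in hashgraph (exec k) q, decides coin c x y & round y - round x = d].

End Run.
End Execution.

Local Open Scope classical_set_scope.
Local Open Scope ring_scope.
Local Open Scope ereal_scope.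

Section Probability.
Variables (R : realType) (n : nat) (D : choiceType).
Variables (disp : measure_display) (Omega : measurableType disp).
Variable P : probability Omega R.
Variable coin : event n D -> Omega -> bool.
Variable partner : 'I_n * nat -> Omega -> 'I_n.

(* The signature bits of all (potential) events and the sync partners are
   mutually independent, each bit being uniform, and each partner of [p] being
   uniform among the [n - 1] other parties. *)
Definition iid_uniform : Prop :=
  [/\ forall e, measurable [set w | coin e w],
      forall i q, measurable [set w | partner i w = q]
    & forall (E : seq (event n D)) (I : seq ('I_n * nat))
             (b : event n D -> bool) (q : 'I_n * nat -> 'I_n),
        uniq E -> uniq I -> {in I, forall i, q i != i.1} ->
        P [set w | (forall e, e \in E -> coin e w = b e) /\
                   (forall i, i \in I -> partner i w = q i)]
        = ((2%:R^-1 ^+ size E * (n.-1%:R)^-1 ^+ size I)%R)%:E].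

Variables (env : 'I_n -> nat -> D) (A : adversary n D).

Definition coin_at (w : Omega) : event n D -> bool := fun e => coin e w.
Definition partner_at (w : Omega) : 'I_n * nat -> 'I_n :=
  fun i => partner i w.

Definition almost_surely_fair : Prop :=
  {ae P, forall w, fair_run env A (coin_at w) (partner_at w)}.

Definition almost_surely_has_witness (p : 'I_n) (r : nat) : Prop :=
  {ae P, forall w, exists x : event n D,
     is_round_witness_of env A (coin_at w) (partner_at w) p r x}.

(* The number of rounds until the first decision, by any honest party, on the
   fame of the round-[r] witness of [p]; [+oo] if there is no decision. *)
Definition rounds_to_decision (c : nat) (p : 'I_n) (r : nat) (w : Omega) :
    \bar R :=
  ereal_inf [set (d%:R)%:E | d in [set d : nat | exists2 x : event n D,
    is_round_witness_of env A (coin_at w) (partner_at w) p r x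
    & decided_after env A (coin_at w) (partner_at w) c x d]].

Definition expected_rounds_to_decision (c : nat) (p : 'I_n) (r : nat) :
    \bar R :=
  \int[P]_w rounds_to_decision c p r w.

End Probability.

(* Main.v *)
Require Import Defs.
From HB Require Import structures.
From mathcomp Require Import all_boot all_order all_algebra.
From mathcomp Require Import zify.
From mathcomp Require boolp.

(* Nobody needs to be corrupted: scheduling the network suffices.

   Three parties [a], [b] and [p] play special roles, [p] being the creator of
   the witness under election.  In every round the hub [b] first collects the
   witnesses of a set [S] of more than two thirds of the parties, and the hub
   [a] those of all parties but [p]; through the hubs, in the next round the
   witnesses of one half [F] of the parties strongly see exactly the witnesses
   of [S], and those of the other half exactly the witnesses of all parties but
   [p] (the witnesses of the hubs themselves are left uncontrolled).  As long as the votes of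
   a round are split fairly evenly (between 3/8 and 5/8), no supermajority of
   equal votes exists, so nothing is decided and all votes in a coin round are
   coin flips; moreover [S] can be chosen such that its majority differs from
   the overall one, and then the votes of the next normal round are split
   between [F] and its complement.  The first votes are split because only the
   parties outside [F] learn about the witness of [p].

   Hence a decision requires an unbalanced coin round.  The witnesses of a
   round are determined by the sync partners and by the coins of earlier
   rounds, so the coins of a round are independent of everything which
   produced its witnesses, and a round is unbalanced with exponentially small
   probability.  A union bound over exponentially many rounds concludes. *)

Set Implicit Arguments.
Unset Strict Implicit.
Unset Printing Implicit Defensive.

(** * Events, rounds and witnesses *)

Section Events.
Local Open Scope nat_scope.
Variables (n : nat) (D : choiceType).
Local Notation event := (event n D).
Implicit Types x y z e s o : event.

(** The bounds 3/8 and 5/8 are tied to the threshold 2/3 twice. As 5/8 < 2/3, neither answer has a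
    supermajority. As 3/8 > 1/3, the minority still outnumbers the rest of a set of just over 2n/3
    parties that contains it, which is what produces [S]. Three obstacles shape the construction.
    [S] depends on votes, hence on coins, while only coins of published events can be read: each
    round therefore opens with syncs that are independent of [S] and publish every witness except
    that of [p], whose vote the choice ignores. Eventual delivery is compulsory, yet a delivery
    outside the schedule could create events: a message is delivered for the sake of fairness only
    when its receiver already holds all its contents, and every event does reach everybody. Finally
    the witnesses are themselves random, whereas independence is given for fixed events: all values
    of the earlier coins and of the partner draws up to a given step are enumerated, and each of
    these finitely many cases fixes the witnesses. *)

Fixpoint height (x : event) : nat :=
  if x is Child _ _ s o then (height s + height o).+1 else 0.

(** Unlike [ancestors], this line of self-parents is totally ordered by ancestry, so it contains at
    most one witness per round. *)
Fixpoint chain (x : event) : seq event :=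
  x :: (if x is Child _ _ s _ then chain s else [::]).

Lemma in_anc_child y p d s o :
  (y \in ancestors (Child p d s o)) =
  [|| y == Child p d s o, y \in ancestors s | y \in ancestors o].
Proof. by rewrite /= inE mem_cat. Qed.

Lemma anc_trans y x z :
  y \in ancestors x -> z \in ancestors y -> z \in ancestors x.
Proof.
elim: x => [q e|q e s IHs o IHo]; first by rewrite inE => /eqP ->.
rewrite in_anc_child => /or3P[/eqP -> //|/IHs h|/IHo h] zy.
- by rewrite in_anc_child h ?orbT.
- by rewrite in_anc_child h ?orbT.
Qed.

Lemma anc_height x y : y \in ancestors x -> y != x -> height y < height x.
Proof.
elim: x => [q e|q e s IHs o IHo]; first by rewrite inE => /eqP ->; rewrite eqxx.
rewrite in_anc_child => /or3P[/eqP ->|h|h]; first by rewrite eqxx.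
- have [-> _|ys _] := eqVneq y s; rewrite /=; first by lia.
  by have := IHs h ys; lia.
- have [-> _|ys _] := eqVneq y o; rewrite /=; first by lia.
  by have := IHo h ys; lia.
Qed.

Lemma anc_antisym x y : y \in ancestors x -> x \in ancestors y -> x = y.
Proof.
have [-> //|yx] := eqVneq x y => h1 h2.
have := anc_height h2 yx; rewrite eq_sym in yx; have := anc_height h1 yx; lia.
Qed.

Lemma well_formed_anc x y : y \in ancestors x -> well_formed x -> well_formed y.
Proof.
elim: x => [q e|q e s IHs o IHo]; first by rewrite inE => /eqP ->.
by rewrite in_anc_child => /or3P[/eqP -> //|/IHs h|/IHo h] /and4P[_ _ ? ?]; apply: h.
Qed.

Lemma chain_refl x : x \in chain x.
Proof. by case: x => *; rewrite inE eqxx. Qed.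

Lemma chain_anc x y : y \in chain x -> y \in ancestors x.
Proof.
elim: x => [q e|q e s IHs o _] //.
rewrite inE => /orP[/eqP ->|/IHs h]; first exact: ancestors_refl.
by rewrite in_anc_child h orbT.
Qed.

Lemma chain_trans y x z : y \in chain x -> z \in chain y -> z \in chain x.
Proof.
elim: x => [q e|q e s IHs o _]; first by rewrite inE => /eqP ->.
rewrite inE => /orP[/eqP -> //|/IHs h] /h; by rewrite inE orbC => ->.
Qed.

Lemma chain_total x y z :
  y \in chain x -> z \in chain x -> (y \in chain z) || (z \in chain y).
Proof.
elim: x => [q e|q e s IHs o _].
  by rewrite !inE => /eqP -> /eqP ->; rewrite chain_refl.
rewrite !inE => /orP[/eqP ->|hy] /orP[/eqP ->|hz].
- by rewrite chain_refl.
- by rewrite [z \in _]inE hz !orbT.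
- by rewrite [y \in _]inE hy !orbT.
- exact: IHs.
Qed.

Lemma chain_creator x y : well_formed x -> y \in chain x -> creator y = creator x.
Proof.
elim: x => [q e|q e s IHs o _]; first by rewrite inE => _ /eqP ->.
case/and4P=> /eqP sq _ ws _; rewrite inE => /orP[/eqP -> //|h].
by rewrite (IHs ws h).
Qed.

Lemma round_child p d (s o : event) :
  maxn (round s) (round o) <= round (Child p d s o)
  <= (maxn (round s) (round o)).+1.
Proof. by rewrite roundE; case: ifP => _; lia. Qed.

Lemma round_anc x y : y \in ancestors x -> round y <= round x.
Proof.
elim: x => [q e|q e s IHs o IHo]; first by rewrite inE => /eqP ->.
have := round_child q e s o.
by rewrite in_anc_child => ? /or3P[/eqP -> //|/IHs h|/IHo h]; lia.
Qed.

Lemma chain_witness x :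
  exists e, [/\ e \in chain x, witness e & round e = round x].
Proof.
elim: x => [q e|q e s [w [ws ww wr]] o _].
  by exists (Genesis q e); rewrite inE eqxx.
have [lt|ge] := ltnP (round s) (round (Child q e s o)).
  by exists (Child q e s o); rewrite chain_refl.
exists w; split=> //; first by rewrite inE ws orbT.
rewrite wr; have := @round_anc (Child q e s o) s.
by rewrite in_anc_child ancestors_refl orbT => /(_ isT); lia.
Qed.

Lemma witness_chain_lt x y :
  witness x -> y \in chain x -> y != x -> round y < round x.
Proof.
case: x => [q e|q e s o]; first by rewrite inE => _ ->.
rewrite inE /witness /= => lt /orP[->//|h] _.
by apply: leq_ltn_trans lt; apply: round_anc; apply: chain_anc.
Qed.

Lemma chain_witness_uniq x y z :
  y \in chain x -> z \in chain x -> witness y -> witness z ->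
  round y = round z -> y = z.
Proof.
move=> yx zx wy wz eqr; apply/eqP; apply: contraT => ne.
case/orP: (chain_total yx zx) => [h|h].
- by have := witness_chain_lt wz h ne; lia.
- by rewrite eq_sym in ne; have := witness_chain_lt wy h ne; lia.
Qed.

Lemma chain_round_lt x y z :
  y \in chain x -> z \in chain x -> round y < round z -> y \in chain z.
Proof.
move=> yx zx lt; case/orP: (chain_total yx zx) => // /chain_anc/round_anc; lia.
Qed.

(** The global state is summarised by one head per party. The last clause is stronger than the
    absence of forks in each single past: the events of a party form one line across all pasts, so
    witnesses known to different parties can be identified. *)
Definition fork_free (h : 'I_n -> event) : Prop :=
  [/\ forall q, creator (h q) = q, forall q, well_formed (h q)
    & forall q e, e \in ancestors (h q) -> e \in chain (h (creator e))].

Definition known (h : 'I_n -> event) (e : event) : Prop :=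
  exists q, e \in ancestors (h q).

Lemma known_anc h e z : known h e -> z \in ancestors e -> known h z.
Proof. by case=> q eq ze; exists q; apply: anc_trans ze. Qed.

Lemma known_head h q : known h (h q).
Proof. by exists q; apply: ancestors_refl. Qed.

Lemma sees_anc h x y : fork_free h -> known h x -> sees x y = (y \in ancestors x).
Proof.
case=> _ _ ff [q xq]; rewrite /sees.
suff -> : observes_fork_by x (creator y) = false by rewrite andbT.
apply/negbTE/hasPn => z zx; apply/hasPn => z' z'x.
rewrite /is_fork; have [|//] := eqVneq (creator z) (creator y).
have [e|//] := eqVneq (creator z) (creator z').
have hz := ff q z (anc_trans xq zx).
have hz' := ff q z' (anc_trans xq z'x).
rewrite e in hz; case/orP: (chain_total hz hz') => /chain_anc -> //=.
by rewrite andbF.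
Qed.

Lemma supermajority_le m m' : m <= m' -> supermajority n m -> supermajority n m'.
Proof. by rewrite /supermajority; lia. Qed.

Lemma supermajority0 : supermajority n 0 = false.
Proof. by rewrite /supermajority; lia. Qed.

(** Without forks these are the parties through which [x] sees [w], so that strongly seeing becomes
    a supermajority of carriers. Being defined by ancestry alone, the set only grows along
    descendants. *)
Definition carriers (x w : event) : {set 'I_n} :=
  [set q | has (fun z => (creator z == q) && (w \in ancestors z)) (ancestors x)].

Lemma carriersP x w q :
  reflect (exists z, [/\ z \in ancestors x, creator z = q & w \in ancestors z])
          (q \in carriers x w).
Proof.
rewrite inE; apply: (iffP hasP) => [[z zx /andP[/eqP zq wz]]|[z [zx zq wz]]].
  by exists z.
by exists z => //; rewrite zq eqxx.
Qed.

Lemma carriers_sub x y w : y \in ancestors x -> carriers y w \subset carriers x w.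
Proof.
move=> yx; apply/subsetP => q /carriersP[z [zy zq wz]].
by apply/carriersP; exists z; split=> //; apply: anc_trans zy.
Qed.

Lemma strongly_sees_carriers h x w : fork_free h -> known h x ->
  strongly_sees x w = supermajority n #|carriers x w|.
Proof.
move=> ff kx; rewrite /strongly_sees /carriers.
congr (supermajority n #|pred_of_set _|).
apply/setP => q; rewrite !inE; apply: eq_in_has => z zx.
by rewrite (sees_anc _ ff kx) zx (sees_anc _ ff (known_anc kx zx)).
Qed.

Lemma carriers_anc x w : 0 < #|carriers x w| -> w \in ancestors x.
Proof.
case/card_gt0P => q /carriersP[z [zx _ wz]]; exact: anc_trans wz.
Qed.

Lemma strongly_sees_anc x w : strongly_sees x w -> w \in ancestors x.
Proof.
rewrite /strongly_sees; set A := [set q | _] => sA.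
have : 0 < #|A| by case: #|A| sA => //; rewrite supermajority0.
case/card_gt0P => q; rewrite inE => /hasP[z zx /and3P[_ _ /andP[wz _]]].
exact: anc_trans wz.
Qed.

Definition witnesses (h : 'I_n -> event) (r : nat) (W : 'I_n -> event) : Prop :=
  forall j, [/\ W j \in chain (h j), witness (W j) & round (W j) = r].

Lemma witnesses_creator h r W j :
  fork_free h -> witnesses h r W -> creator (W j) = j.
Proof.
by case=> hc wf _ /(_ j)[+ _ _] => /(chain_creator (wf j)) ->.
Qed.

Lemma witnesses_uniq h r W e : fork_free h -> witnesses h r W ->
  known h e -> witness e -> round e = r -> e = W (creator e).
Proof.
move=> [_ _ ff] hW [q eq] we re; have [Wc wW rW] := hW (creator e).
by apply: (chain_witness_uniq (ff _ _ eq) Wc we wW); rewrite re rW.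
Qed.

Definition strong (W : 'I_n -> event) (x : event) : {set 'I_n} :=
  [set j | supermajority n #|carriers x (W j)|].

Lemma strong_sub W x y : y \in ancestors x -> strong W y \subset strong W x.
Proof.
move=> yx; apply/subsetP => j; rewrite !inE.
by apply: supermajority_le; apply/subset_leq_card/carriers_sub.
Qed.

Lemma carriers_self x : carriers x x \subset [set creator x].
Proof.
apply/subsetP => q /carriersP[z [zx <- xz]]; rewrite inE.
by rewrite (anc_antisym zx xz).
Qed.

Definition creators_from (r : nat) (x : event) : {set 'I_n} :=
  [set q | has (fun z => (creator z == q) && (r <= round z)) (ancestors x)].

Lemma creators_fromP r x q :
  reflect (exists z, [/\ z \in ancestors x, creator z = q & r <= round z])
          (q \in creators_from r x).
Proof.
rewrite inE; apply: (iffP hasP) => [[z zx /andP[/eqP zq wz]]|[z [zx zq wz]]].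
  by exists z.
by exists z => //; rewrite zq eqxx.
Qed.

Lemma creators_from_sub r x y : y \in ancestors x ->
  creators_from r y \subset creators_from r x.
Proof.
move=> yx; apply/subsetP => q /creators_fromP[z [zy zq rz]].
by apply/creators_fromP; exists z; split=> //; apply: anc_trans zy.
Qed.

(** Where a past first leaves round [r], some round-[r] witness is strongly seen, and each party
    through which it is seen has an event above it, hence of round at least [r]. This keeps the
    heads from getting two rounds ahead. *)
Lemma round_gt_creators r x : 0 < r -> r < round x ->
  supermajority n #|creators_from r x|.
Proof.
move=> r0; elim: x => [q e|q e s IHs o IHo]; first by rewrite /round /=; lia.
set x := Child q e s o.
have sx : s \in ancestors x by rewrite in_anc_child ancestors_refl orbT.
have ox : o \in ancestors x by rewrite in_anc_child ancestors_refl !orbT.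
have [lt _|le] := ltnP r (maxn (round s) (round o)).
  move: lt; rewrite leq_max => /orP[/IHs|/IHo]; apply: supermajority_le;
    exact/subset_leq_card/creators_from_sub.
rewrite [round x]roundE; case: ifP => [|_]; last by lia.
set B := [set _ | _] => sB rlt.
have eqr : maxn (round s) (round o) = r by lia.
have : 0 < #|B| by case: #|B| sB => //; rewrite supermajority0.
case/card_gt0P => q'; rewrite inE => /hasP[w _ /and4P[_ /eqP rw _]].
apply: supermajority_le; apply/subset_leq_card/subsetP => i.
rewrite inE => /hasP[z zx /and3P[/eqP zi _ /andP[wz _]]].
apply/creators_fromP; exists z; split=> //.
by rewrite -eqr -rw; apply: round_anc.
Qed.

Hypothesis n_gt2 : 2 < n.

Lemma card1_small (A : {set 'I_n}) i : A \subset [set i] -> ~~ supermajority n #|A|.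
Proof. by move=> /subset_leq_card; rewrite cards1 /supermajority; lia. Qed.

(* An event is beyond round [r] iff it strongly sees enough round-[r]
   witnesses: once this holds at an event it holds at its descendants. *)
Lemma round_gtE h r W x : fork_free h -> witnesses h r W -> known h x -> 0 < r ->
  (r < round x) = supermajority n #|strong W x|.
Proof.
move=> ff hW; elim: x => [q e|q e s IHs o IHo] kx r0.
  suff -> : strong W (Genesis q e) = set0 by rewrite cards0 supermajority0 ltnS leqNgt r0.
  apply/setP => j; rewrite !inE; apply/negbTE/(@card1_small _ q).
  by apply/subsetP => i /carriersP[z []]; rewrite !inE => /eqP -> /= ->.
set x := Child q e s o in kx *.
have sx : s \in ancestors x by rewrite in_anc_child ancestors_refl orbT.
have ox : o \in ancestors x by rewrite in_anc_child ancestors_refl !orbT.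
have {}IHs := IHs (known_anc kx sx) r0.
have {}IHo := IHo (known_anc kx ox) r0.
have /andP[rx1 rx2] := round_child q e s o.
have [lt|le] := ltnP r (maxn (round s) (round o)).
  rewrite (leq_trans lt rx1); symmetry.
  move: lt; rewrite leq_max IHs IHo => /orP[|]; apply: supermajority_le;
    exact/subset_leq_card/strong_sub.
(* With both parents below round [r], the only round-[r] witness that can lie below [x] is [x]
   itself, so at most its creator counts. *)
have [eqr|nr] := eqVneq (maxn (round s) (round o)) r; last first.
  rewrite ltnNge (leq_trans rx2) ?ltn_neqAle ?nr //=; symmetry.
  apply/negbTE/(@card1_small _ q)/subsetP => j; rewrite !inE => sj.
  have Wx : W j \in ancestors x.
    by apply: carriers_anc; case: #|_| sj => //; rewrite supermajority0.
  have [_ _ rj] := hW j.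
  move: Wx; rewrite in_anc_child => /or3P[/eqP E|/round_anc|/round_anc]; first last.
  - by rewrite rj; lia.
  - by rewrite rj; lia.
  by rewrite -(witnesses_creator j ff hW) E.
rewrite [round x]roundE eqr.
set B := [set _ | _].
suff -> : B = strong W x by case: ifP => _; rewrite ?ltnSn ?ltnn.
apply/setP => j; rewrite [in RHS]inE [in LHS]inE.
apply/hasP/idP => [[w wso /and4P[/eqP <- /eqP rw ww]]|sj].
  have kw : known h w.
    by apply: known_anc kx _; rewrite in_anc_child -mem_cat wso orbT.
  by rewrite (strongly_sees_carriers _ ff kx) {1}(witnesses_uniq ff hW kw ww rw).
have Wx : W j \in ancestors x.
  by apply: carriers_anc; case: #|_| sj => //; rewrite supermajority0.
have [_ wj rj] := hW j.
exists (W j); last first.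
  by rewrite (witnesses_creator j ff hW) eqxx rj eqxx wj (strongly_sees_carriers _ ff kx).
(* Within its own past an event is carried by its creator alone, so the strongly seen [W j] is a
   proper ancestor of [x]. *)
move: Wx; rewrite in_anc_child -mem_cat => /orP[/eqP E|//].
by move: sj; rewrite E (negbTE (card1_small (carriers_self x))).
Qed.

End Events.

(** * One scheduled round *)

Section RoundStep.
Local Open Scope nat_scope.
Variables (n : nat) (D : choiceType).
Local Notation event := (event n D).
Implicit Types (x y z e m : event) (h : 'I_n -> event).

(* [x'] is the head of [q], formerly [x], after syncs from the heads [m]. *)
Definition gathered (q : 'I_n) x (ms : event -> Prop) x' : Prop :=
  [/\ x \in chain x', forall m, ms m -> m \in ancestors x'
    & forall e, e \in ancestors x' ->
        [\/ e \in ancestors x, exists2 m, ms m & e \in ancestors m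
          | creator e = q]].

Definition joined (q : 'I_n) x m x' : Prop :=
  m \in ancestors x /\ x' = x \/ exists d, x' = Child q d x m.

Lemma joined_gathered q x m x' :
  joined q x m x' -> gathered q x (fun m' => m' = m) x'.
Proof.
case=> [[mx ->]|[d ->]].
  by split=> [|_ -> //|e ->]; [exact: chain_refl|constructor 1].
split=> [|_ ->|e].
- by rewrite inE chain_refl orbT.
- by rewrite in_anc_child ancestors_refl !orbT.
rewrite in_anc_child => /or3P[/eqP ->|ex|em].
- by constructor 3.
- by constructor 1.
- by constructor 2; exists m.
Qed.

Lemma gathered_anc q x ms x' : gathered q x ms x' -> x \in ancestors x'.
Proof. by case=> /chain_anc. Qed.

Lemma carriers_unknown x w : w \notin ancestors x -> carriers x w = set0.
Proof.
move=> wx; apply/setP => q; rewrite [RHS]inE; apply/negbTE/carriersP => -[z [zx _ wz]].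
by move: wx; rewrite (anc_trans zx wz).
Qed.

Lemma gathered_carriers q x ms x' w (Q : {set 'I_n}) :
  gathered q x ms x' -> q \in Q -> carriers x w \subset Q ->
  (forall m, ms m -> carriers m w \subset Q) -> carriers x' w \subset Q.
Proof.
move=> [_ _ up] qQ xQ mQ; apply/subsetP => i /carriersP[z [zx' <- wz]].
case: (up z zx') => [zx|[m mm zm]|-> //].
- by apply: (subsetP xQ); apply/carriersP; exists z.
- by apply: (subsetP (mQ m mm)); apply/carriersP; exists z.
Qed.

Lemma gathered_unknown q x ms x' w :
  gathered q x ms x' -> creator w != q -> w \notin ancestors x ->
  (forall m, ms m -> w \notin ancestors m) -> w \notin ancestors x'.
Proof.
move=> [_ _ up] wq wx wm; apply/negP => /up[|[m mm]|/eqP].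
- by rewrite (negbTE wx).
- by rewrite (negbTE (wm m mm)).
- by rewrite (negbTE wq).
Qed.

Lemma gathered_creators_from q x ms x' r (Q : {set 'I_n}) :
  gathered q x ms x' -> q \in Q -> creators_from r x \subset Q ->
  (forall m, ms m -> creators_from r m \subset Q) ->
  creators_from r x' \subset Q.
Proof.
move=> [_ _ up] qQ xQ mQ; apply/subsetP => i /creators_fromP[z [zx' <- rz]].
case: (up z zx') => [zx|[m mm zm]|-> //].
- by apply: (subsetP xQ); apply/creators_fromP; exists z.
- by apply: (subsetP (mQ m mm)); apply/creators_fromP; exists z.
Qed.

Lemma creators_from_low r x : round x < r -> creators_from r x = set0.
Proof.
move=> lt; apply/setP => q; rewrite [RHS]inE.
by apply/negbTE/creators_fromP => -[z [/round_anc + _]]; lia.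
Qed.

Variables (a b p : 'I_n) (F : {set 'I_n}).
Hypotheses (n_gt : 48 < n) (ab : a != b) (ap : a != p) (bp : b != p).
Hypotheses (aF : a \notin F) (pF : p \notin F) (bF : b \in F).

Definition ordinary : {set 'I_n} := ~: [set a; b; p].

Definition valid_choice (S : {set 'I_n}) : bool :=
  [&& a \in S, b \in S, p \notin S & supermajority n #|S|].

(** The hubs appear in the last clause because they enter the new round while still gathering, and
    their events are what carries the others into it. *)
Definition round_start h (r : nat) : Prop :=
  [/\ fork_free h, 0 < r, forall q, round (h q) = r
    & forall q, creators_from r (h q) \subset [set q; a; b]].

(* [W] and [W'] are the witnesses of two consecutive rounds. *)
Definition round_facts (S : {set 'I_n}) (W W' : 'I_n -> event) : Prop :=
  [/\ forall i, i \in F -> i != b -> strong W (W' i) = S,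
      forall i, i \notin F -> i != a -> strong W (W' i) = ~: [set p],
      forall i, i \in F -> W p \notin ancestors (W' i)
    & forall i, i \notin F -> i != a -> W p \in ancestors (W' i)].

(** Serves fairness rather than the election: it makes old events known to everybody. The witness of
    [p] is only promised to [a], which hands it on in a later round. *)
Definition spread (W : 'I_n -> event) h : Prop :=
  (forall q j, j != p -> W j \in ancestors (h q)) /\ W p \in ancestors (h a).

Lemma ordinaryP i : reflect [/\ i != a, i != b & i != p] (i \in ordinary).
Proof. by rewrite !inE !negb_or -andbA; apply: and3P. Qed.

Lemma card_ordinary : #|ordinary| = n - 3.
Proof.
by rewrite cardsCs setCK card_ord setUC cardsU1 cards2 !inE !(eq_sym p) (negbTE ap) (negbTE bp) ab.
Qed.

Lemma supermajority_ordinary (A : {set 'I_n}) :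
  ordinary \subset A -> supermajority n #|A|.
Proof. by move=> /subset_leq_card; rewrite card_ordinary /supermajority; lia. Qed.

Lemma card_set4 (i j k l : 'I_n) : #|[set i; j; k; l]| <= 4.
Proof.
rewrite (leq_trans (leq_card_setU _ _)) // cards1 addn1 ltnS.
rewrite (leq_trans (leq_card_setU _ _)) // cards1 addn1 ltnS cards2.
by case: (_ == _).
Qed.

Lemma small4 (A : {set 'I_n}) i j k l :
  A \subset [set i; j; k; l] -> ~~ supermajority n #|A|.
Proof.
move=> /subset_leq_card h; have := leq_trans h (card_set4 i j k l).
by rewrite /supermajority; lia.
Qed.

Section Step.
(** Digits give the order of the phases. [B3] has the witnesses of [S]; its way out to the ordinary
    parties ([z4]) and back ([B5]) turns these parties into carriers, so that [B5] strongly sees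
    [S]. In the same way [A2], [z6] and [A7] treat all parties but [p]. The head of [p] enters only
    with [A7], too late for its witness to find enough carriers. *)
Variables (h0 h : 'I_n -> event) (r : nat) (S : {set 'I_n}).
Variables (B1 A2 B3 B5 A7 : event) (z4 z6 : 'I_n -> event).
Variables (W W' : 'I_n -> event).
Hypotheses (start : round_start h0 r) (SV : valid_choice S).
Hypothesis B1P : gathered b (h0 b) (fun m => m = h0 a) B1.
Hypothesis A2P : gathered a (h0 a)
  (fun m => m = B1 \/ exists2 i, i \in ordinary & m = h0 i) A2.
Hypothesis B3P : gathered b B1
  (fun m => exists2 i, i \in ordinary & i \in S /\ m = h0 i) B3.
Hypothesis z4P : forall i, i \in ordinary ->
  gathered i (h0 i) (fun m => m = B3) (z4 i).
Hypothesis B5P : gathered b B3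
  (fun m => exists2 i, i \in ordinary & m = z4 i) B5.
Hypothesis z6P : forall i, i \in ordinary ->
  gathered i (z4 i) (fun m => m = A2) (z6 i).
Hypothesis A7P : gathered a A2
  (fun m => m = h0 p \/ exists2 i, i \in ordinary & m = z6 i) A7.
Hypothesis hb : h b = B5.
Hypothesis ha : h a = A7.
Hypothesis hF : forall i, i \in ordinary -> i \in F -> joined i (z6 i) B5 (h i).
Hypothesis hL : forall i, i \in ordinary -> i \notin F -> joined i (z6 i) A7 (h i).
Hypothesis hp : joined p (h0 p) A7 (h p).
Hypothesis ffh : fork_free h.
Hypotheses (HW : witnesses h0 r W) (HW' : witnesses h r.+1 W').

Let ff0 : fork_free h0. Proof. by case: start. Qed.
Let r_gt0 : 0 < r. Proof. by case: start. Qed.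
Let cW j : creator (W j) = j. Proof. exact: witnesses_creator HW. Qed.
Let rW j : round (W j) = r. Proof. by case: (HW j). Qed.
Let aS : a \in S. Proof. by case/and4P: SV. Qed.
Let bS : b \in S. Proof. by case/and4P: SV. Qed.
Let pS : p \notin S. Proof. by case/and4P: SV. Qed.

Let W0 j : W j \in ancestors (h0 j).
Proof. by case: (HW j) => /chain_anc. Qed.

Let start_carriers i j : carriers (h0 i) (W j) \subset [set i; a; b].
Proof.
have [_ _ _ /(_ i) cf] := start; apply: subset_trans cf.
apply/subsetP => q /carriersP[z [zi zq wz]]; apply/creators_fromP.
by exists z; split=> //; rewrite -(rW j); apply: round_anc.
Qed.

Let start_unknown i j : j != i -> j != a -> j != b -> W j \notin ancestors (h0 i).
Proof.
move=> ji ja jb; apply/negP => wi; have [_ _ _ /(_ i)/subsetP/(_ j)] := start.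
rewrite !inE (negbTE ji) (negbTE ja) (negbTE jb); suff: j \in creators_from r (h0 i).
  by rewrite inE => -> /(_ isT).
by apply/creators_fromP; exists (W j); rewrite cW rW.
Qed.

Let start_sub i j (Q : {set 'I_n}) :
  (j = i -> i \in Q) -> a \in Q -> b \in Q -> j != a -> j != b ->
  carriers (h0 i) (W j) \subset Q.
Proof.
move=> jQ aQ bQ ja jb; have [e|ji] := eqVneq j i; last first.
  by rewrite carriers_unknown ?sub0set // start_unknown.
apply: subset_trans (start_carriers i j) _.
by apply/subsetP => q; rewrite !inE => /orP[/orP[]|] /eqP -> //; apply: jQ.
Qed.

Let B1_unknown j : j != a -> j != b -> W j \notin ancestors B1.
Proof.
move=> ja jb; apply: (gathered_unknown B1P); rewrite ?cW ?start_unknown //.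
by move=> _ ->; rewrite start_unknown.
Qed.

Let A2_carriers j : j != a -> j != b -> carriers A2 (W j) \subset [set j; a; b].
Proof.
move=> ja jb; apply: (gathered_carriers A2P); first by rewrite !inE eqxx !orbT.
  by apply: start_sub; rewrite ?inE ?eqxx ?orbT.
move=> m [->|[i _ ->]]; first by rewrite carriers_unknown ?sub0set ?B1_unknown.
by apply: start_sub; rewrite ?inE ?eqxx ?orbT // => ->; rewrite eqxx.
Qed.

Let A2_unknown : W p \notin ancestors A2.
Proof.
apply: (gathered_unknown A2P); rewrite ?cW 1?eq_sym // ?start_unknown 1?eq_sym //.
move=> m [->|[i /ordinaryP[_ _ ip] ->]]; first by rewrite B1_unknown 1?eq_sym.
by rewrite start_unknown 1?eq_sym.
Qed.

Let B3_carriers j : j != a -> j != b -> carriers B3 (W j) \subset [set j; a; b].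
Proof.
move=> ja jb; apply: (gathered_carriers B3P); first by rewrite !inE eqxx !orbT.
  by rewrite carriers_unknown ?sub0set ?B1_unknown.
move=> m [i _ [_ ->]].
by apply: start_sub; rewrite ?inE ?eqxx ?orbT // => ->; rewrite eqxx.
Qed.

Let B3_unknown j : j \notin S -> W j \notin ancestors B3.
Proof.
move=> jS; have ja : j != a by apply: contraNneq jS => ->.
have jb : j != b by apply: contraNneq jS => ->.
apply: (gathered_unknown B3P); rewrite ?cW ?B1_unknown //.
move=> m [i _ [iS ->]]; rewrite start_unknown //.
by apply: contraNneq jS => ->.
Qed.

Let z4_carriers i j : i \in ordinary -> j != a -> j != b ->
  carriers (z4 i) (W j) \subset [set j; a; b; i].
Proof.
move=> io ja jb; apply: (gathered_carriers (z4P io)); first by rewrite !inE eqxx !orbT.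
  by apply: start_sub; rewrite ?inE ?eqxx ?orbT.
move=> _ ->; apply: subset_trans (B3_carriers ja jb) _.
by apply/subsetP => q; rewrite !inE => ->.
Qed.

Let z4_unknown i j : i \in ordinary -> j \notin S -> j != i ->
  W j \notin ancestors (z4 i).
Proof.
move=> io jS ji; have ja : j != a by apply: contraNneq jS => ->.
have jb : j != b by apply: contraNneq jS => ->.
apply: (gathered_unknown (z4P io)); rewrite ?cW ?start_unknown //.
by move=> _ ->; apply: B3_unknown.
Qed.

Let z4_self_carriers j : j \in ordinary -> j \notin S ->
  carriers (z4 j) (W j) \subset [set j; a; b].
Proof.
move=> jo jS; have [ja jb _] := ordinaryP _ jo.
apply: (gathered_carriers (z4P jo)); first by rewrite !inE eqxx.
  by apply: start_sub; rewrite ?inE ?eqxx ?orbT.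
by move=> _ ->; rewrite carriers_unknown ?sub0set ?B3_unknown.
Qed.

(** Outside [S], the only head gathered by [b] that can have [W j] below it is that of [j] itself,
    and it contributes no carriers besides [j] and the hubs. *)
Let B5_carriers j : j \notin S -> carriers B5 (W j) \subset [set j; a; b].
Proof.
move=> jS; apply: (gathered_carriers B5P); first by rewrite !inE eqxx !orbT.
  by rewrite carriers_unknown ?sub0set ?B3_unknown.
move=> _ [i io ->]; have [ji|ji] := eqVneq j i; last first.
  by rewrite carriers_unknown ?sub0set ?z4_unknown.
by rewrite ji in jS *; apply: z4_self_carriers.
Qed.

Let B5_unknown : W p \notin ancestors B5.
Proof.
apply: (gathered_unknown B5P); rewrite ?cW ?B3_unknown 1?eq_sym //.
by move=> _ [i io ->]; rewrite z4_unknown //; case/ordinaryP: io => _ _; rewrite eq_sym.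
Qed.

Let z6_carriers i j : i \in ordinary -> j != a -> j != b ->
  carriers (z6 i) (W j) \subset [set j; a; b; i].
Proof.
move=> io ja jb; apply: (gathered_carriers (z6P io)); first by rewrite !inE eqxx !orbT.
  exact: z4_carriers.
move=> _ ->; apply: subset_trans (A2_carriers ja jb) _.
by apply/subsetP => q; rewrite !inE => ->.
Qed.

Let z6_unknown i : i \in ordinary -> W p \notin ancestors (z6 i).
Proof.
move=> io; have [_ _ ip] := ordinaryP _ io.
apply: (gathered_unknown (z6P io)); rewrite ?cW 1?eq_sym // ?z4_unknown // 1?eq_sym //.
by move=> _ ->; apply: A2_unknown.
Qed.

Let A7_carriers : carriers A7 (W p) \subset [set p; a; b].
Proof.
apply: (gathered_carriers A7P); first by rewrite !inE eqxx !orbT.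
  by rewrite carriers_unknown ?sub0set ?A2_unknown.
move=> _ [->|[i io ->]]; last by rewrite carriers_unknown ?sub0set ?z6_unknown.
exact: start_carriers.
Qed.

Let B1_known_a : W a \in ancestors B1.
Proof. by case: B1P => _ /(_ _ erefl) h1 _; apply: anc_trans h1 _. Qed.

Let B1_known_b : W b \in ancestors B1.
Proof. exact: anc_trans (gathered_anc B1P) _. Qed.

Let A2_known j : j != p -> W j \in ancestors A2.
Proof.
move=> jp; have [_ A2m _] := A2P.
have [->|ja] := eqVneq j a; first exact: anc_trans (gathered_anc A2P) _.
have [->|jb] := eqVneq j b.
  by apply: anc_trans B1_known_b; apply: A2m; left.
by apply: anc_trans (W0 j); apply: A2m; right; exists j => //; apply/ordinaryP.
Qed.

Let B3_known j : j \in S -> W j \in ancestors B3.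
Proof.
move=> jS; have [_ B3m _] := B3P.
have [->|ja] := eqVneq j a; first exact: anc_trans (gathered_anc B3P) _.
have [->|jb] := eqVneq j b; first exact: anc_trans (gathered_anc B3P) _.
apply: anc_trans (W0 j); apply: B3m; exists j => //.
by apply/ordinaryP; split=> //; apply: contraNneq pS => <-.
Qed.

Let z6_head i : i \in ordinary -> z6 i \in chain (h i).
Proof.
move=> io; have [iF|iF] := boolP (i \in F).
  by case: (hF io iF) => [[_ ->]|[d ->]]; rewrite ?inE chain_refl ?orbT.
by case: (hL io iF) => [[_ ->]|[d ->]]; rewrite ?inE chain_refl ?orbT.
Qed.

Let z4_creator i : i \in ordinary -> creator (z4 i) = i /\ creator (z6 i) = i.
Proof.
move=> io; have [hc wf _] := ffh; have z6h := z6_head io.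
rewrite (chain_creator (wf i) z6h) hc; split=> //.
have [z46 _ _] := z6P io.
by rewrite (chain_creator (wf i) (chain_trans z6h z46)) hc.
Qed.

Let B5_supports j : j \in S -> ordinary \subset carriers B5 (W j).
Proof.
move=> jS; apply/subsetP => i io; apply/carriersP; exists (z4 i).
have [_ B5m _] := B5P; have [_ z4m _] := z4P io.
split; first by apply: B5m; exists i.
  by case: (z4_creator io).
by apply: anc_trans (B3_known jS); apply: z4m.
Qed.

Let A7_supports j : j != p -> ordinary \subset carriers A7 (W j).
Proof.
move=> jp; apply/subsetP => i io; apply/carriersP; exists (z6 i).
have [_ A7m _] := A7P; have [_ z6m _] := z6P io.
split; first by apply: A7m; right; exists i.
  by case: (z4_creator io).
by apply: anc_trans (A2_known jp); apply: z6m.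
Qed.

Let head_chain i : h0 i \in chain (h i).
Proof.
have [e|ia] := eqVneq i a.
  rewrite e ha; have [A27 _ _] := A7P; have [h02 _ _] := A2P.
  exact: chain_trans A27 h02.
have [e|ib] := eqVneq i b.
  rewrite e hb; have [B35 _ _] := B5P; have [B13 _ _] := B3P.
  have [h01 _ _] := B1P.
  exact: chain_trans (chain_trans B35 B13) h01.
have [e|ip] := eqVneq i p.
  by rewrite e; case: hp => [[_ ->]|[d ->]]; rewrite ?inE chain_refl ?orbT.
have io : i \in ordinary by apply/ordinaryP.
have [z04 _ _] := z4P io; have [z46 _ _] := z6P io.
exact: chain_trans (chain_trans (z6_head io) z46) z04.
Qed.

Let HWh : witnesses h r W.
Proof.
by move=> j; case: (HW j) => Wc ? ?; split=> //; apply: chain_trans Wc.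
Qed.

Let n_gt2 : 2 < n. Proof. exact: ltn_trans n_gt. Qed.

(** Only the two hub witnesses can be strongly seen this early. The last sync of each ordinary party
    is thus the one that changes its round, and the event it creates is its new witness. *)
Let z6_round i : i \in ordinary -> round (z6 i) <= r.
Proof.
move=> io; have kz : known h (z6 i) by exists i; apply/chain_anc/z6_head.
rewrite leqNgt (round_gtE n_gt2 ffh HWh kz r_gt0); apply/negP => sm.
suff : strong W (z6 i) \subset [set a; b; a; b].
  by move/small4; rewrite sm.
apply/subsetP => j; rewrite [j \in strong _ _]inE => sj; rewrite !inE.
have [//|ja] := eqVneq j a; have [//|jb] := eqVneq j b.
by have /small4 := z6_carriers io ja jb; rewrite sj.
Qed.

Let ordinary_neq0 : exists i, i \in ordinary.
Proof. by apply/card_gt0P; rewrite card_ordinary subn_gt0 (ltn_trans _ n_gt). Qed.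

Let z4_round i : i \in ordinary -> round (z4 i) <= r.
Proof.
by move=> io; apply: leq_trans (z6_round io); apply/round_anc/gathered_anc/z6P.
Qed.

Let A2_round : round A2 <= r.
Proof.
have [i io] := ordinary_neq0; apply: leq_trans (z6_round io).
by apply: round_anc; case: (z6P io) => _ + _; apply.
Qed.

Let B3_round : round B3 <= r.
Proof.
have [i io] := ordinary_neq0; apply: leq_trans (z4_round io).
by apply: round_anc; case: (z4P io) => _ + _; apply.
Qed.

Let B5_new : creators_from r.+1 B5 \subset [set b].
Proof.
apply: (gathered_creators_from B5P); rewrite ?inE //.
  by rewrite creators_from_low ?sub0set.
by move=> _ [i io ->]; rewrite creators_from_low ?sub0set // ltnS z4_round.
Qed.

Let A7_new : creators_from r.+1 A7 \subset [set a].
Proof.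
apply: (gathered_creators_from A7P); rewrite ?inE //.
  by rewrite creators_from_low ?sub0set.
have [_ _ rh0 _] := start.
move=> _ [->|[i io ->]]; rewrite creators_from_low ?sub0set // ltnS ?rh0 //.
exact: z6_round.
Qed.

Let B5_round : r < round B5.
Proof.
have kB : known h B5 by exists b; rewrite hb ancestors_refl.
rewrite (round_gtE n_gt2 ffh HWh kB r_gt0).
case/and4P: SV => _ _ _; apply: supermajority_le; apply/subset_leq_card/subsetP => j jS.
by rewrite inE; apply/supermajority_ordinary/B5_supports.
Qed.

Let A7_round : r < round A7.
Proof.
have kA : known h A7 by exists a; rewrite ha ancestors_refl.
rewrite (round_gtE n_gt2 ffh HWh kA r_gt0).
apply: supermajority_ordinary; apply/subsetP => j /ordinaryP[_ _ jp].
by rewrite inE; apply/supermajority_ordinary/A7_supports.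
Qed.

Let hF_child i : i \in ordinary -> i \in F -> exists d, h i = Child i d (z6 i) B5.
Proof.
move=> io iF; case: (hF io iF) => // -[/round_anc rB _].
by have := leq_trans B5_round (leq_trans rB (z6_round io)); rewrite ltnn.
Qed.

Let hL_child i : i \in ordinary -> i \notin F -> exists d, h i = Child i d (z6 i) A7.
Proof.
move=> io iF; case: (hL io iF) => // -[/round_anc rA _].
by have := leq_trans A7_round (leq_trans rA (z6_round io)); rewrite ltnn.
Qed.

Let hp_child : exists d, h p = Child p d (h0 p) A7.
Proof.
have [_ _ rh0 _] := start.
case: hp => // -[/round_anc rA _].
by have := leq_trans A7_round rA; rewrite rh0 ltnn.
Qed.

Let source i := if i \in F then B5 else A7.

Let source_head i : source i \in ancestors (h i).
Proof.
rewrite /source; have [->|ia] := eqVneq i a; first by rewrite (negbTE aF) ha ancestors_refl.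
have [->|ib] := eqVneq i b; first by rewrite bF hb ancestors_refl.
have [->|ip] := eqVneq i p.
  rewrite (negbTE pF); have [d ->] := hp_child.
  by rewrite in_anc_child ancestors_refl !orbT.
have io : i \in ordinary by apply/ordinaryP.
have [iF|iF] := boolP (i \in F).
  by have [d ->] := hF_child io iF; rewrite in_anc_child ancestors_refl !orbT.
by have [d ->] := hL_child io iF; rewrite in_anc_child ancestors_refl !orbT.
Qed.

Let head_new i : creators_from r.+1 (h i) \subset [set i; a; b].
Proof.
have sA : creators_from r.+1 A7 \subset [set i; a; b].
  by apply: subset_trans A7_new _; apply/subsetP => q; rewrite !inE => /eqP ->; rewrite eqxx ?orbT.
have sB : creators_from r.+1 B5 \subset [set i; a; b].
  by apply: subset_trans B5_new _; apply/subsetP => q; rewrite !inE => /eqP ->; rewrite eqxx ?orbT.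
have [e|ia] := eqVneq i a; first by have -> : h i = A7 by rewrite e.
have [e|ib] := eqVneq i b; first by have -> : h i = B5 by rewrite e.
have ii : i \in [set i; a; b] by rewrite !inE eqxx.
have [e|ip] := eqVneq i p.
  have hi : joined i (h0 i) A7 (h i) by rewrite e.
  apply: (gathered_creators_from (joined_gathered hi)) => //.
    by have [_ _ rh0 _] := start; rewrite creators_from_low ?sub0set ?rh0.
  by move=> _ ->.
have io : i \in ordinary by apply/ordinaryP.
have lo : creators_from r.+1 (z6 i) \subset [set i; a; b].
  by rewrite creators_from_low ?sub0set // ltnS z6_round.
have [iF|iF] := boolP (i \in F).
  by apply: (gathered_creators_from (joined_gathered (hF io iF))) => // _ ->.
by apply: (gathered_creators_from (joined_gathered (hL io iF))) => // _ ->.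
Qed.

(** The head lies above [B5] or [A7], which gives the lower bound; and only [i] and the hubs have
    events beyond round [r] below [h i], too few for another step. *)
Let head_round i : round (h i) = r.+1.
Proof.
have lo : r < round (source i) by rewrite /source; case: ifP.
have hi : ~~ (r.+1 < round (h i)).
  apply/negP => lt; have sm := round_gt_creators (ltn0Sn r) lt.
  have : creators_from r.+1 (h i) \subset [set i; a; b; b].
    apply: subset_trans (head_new i) _; apply/subsetP => q.
    by rewrite !inE => ->.
  by move/small4; rewrite sm.
apply/eqP; rewrite eqn_leq leqNgt hi /=.
exact: leq_trans lo (round_anc (source_head i)).
Qed.

Lemma step_round_start : round_start h r.+1.
Proof. by split. Qed.

Let W'E i : witness (h i) -> W' i = h i.
Proof.
move=> wh; have [Wc ww rw] := HW' i.
by apply: (chain_witness_uniq Wc (chain_refl _) ww wh); rewrite rw head_round.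
Qed.

Let W'F i : i \in ordinary -> W' i = h i.
Proof.
move=> io; apply: W'E; have hr := head_round i; move: hr.
have [iF|iF] := boolP (i \in F).
  have [d ->] := hF_child io iF; rewrite /witness /= => ->.
  by rewrite ltnS z6_round.
have [d ->] := hL_child io iF; rewrite /witness /= => ->.
by rewrite ltnS z6_round.
Qed.

Let W'p : W' p = h p.
Proof.
apply: W'E; have := head_round p; have [d ->] := hp_child.
rewrite /witness /= => ->; by have [_ _ -> _] := start.
Qed.

(** Except for the hubs the new witness is the final head itself, so strong seeing is a count of
    carriers: all ordinary parties for a witness meant to be strongly seen, at most four parties for
    any other. *)
Lemma step_round_facts : round_facts S W W'.
Proof.
split.
- move=> i iF ib; have io : i \in ordinary.
    apply/ordinaryP; split=> //; first by apply: contraNneq aF => <-.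
    by apply: contraNneq pF => <-.
  rewrite W'F //; apply/setP => j; rewrite inE; apply/idP/idP => [|jS]; last first.
    apply: supermajority_ordinary; apply: subset_trans (B5_supports jS) _.
    by apply: carriers_sub; have := source_head i; rewrite /source iF.
  apply: contraTT => jS; have ja : j != a by apply: contraNneq jS => ->.
  have jb : j != b by apply: contraNneq jS => ->.
  apply: (@small4 _ j a b i).
  apply: (gathered_carriers (joined_gathered (hF io iF))); first by rewrite !inE eqxx !orbT.
    exact: z6_carriers.
  move=> _ ->; apply: subset_trans (B5_carriers jS) _.
  by apply/subsetP => q; rewrite !inE => ->.
- move=> i iF ia; have ib : i != b by apply: contraNneq iF => ->.
  have -> : W' i = h i.
    have [->|ip] := eqVneq i p; first exact: W'p.
    by apply: W'F; apply/ordinaryP.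
  apply/setP => j; rewrite !inE; have [->|jp] := eqVneq j p; last first.
    apply: supermajority_ordinary; apply: subset_trans (A7_supports jp) _.
    by apply: carriers_sub; have := source_head i; rewrite /source (negbTE iF).
  apply/negbTE; apply: (@small4 _ p a b i).
  have sA : carriers A7 (W p) \subset [set p; a; b; i].
    by apply: subset_trans A7_carriers _; apply/subsetP => q; rewrite !inE => ->.
  have [e|ip] := eqVneq i p.
    have hi : joined i (h0 i) A7 (h i) by rewrite e.
    apply: (gathered_carriers (joined_gathered hi)).
    - by rewrite !inE eqxx !orbT.
    - rewrite e; apply: subset_trans (start_carriers p p) _.
      by apply/subsetP => q; rewrite !inE => ->.
    - by move=> _ ->.
  have io : i \in ordinary by apply/ordinaryP.
  apply: (gathered_carriers (joined_gathered (hL io iF))).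
  - by rewrite !inE eqxx !orbT.
  - by apply: z6_carriers; rewrite // eq_sym.
  - by move=> _ ->.
- move=> i iF; have [->|ib] := eqVneq i b.
    apply: contraNN B5_unknown => h1; rewrite -hb; apply: anc_trans h1.
    by apply: chain_anc; case: (HW' b).
  have io : i \in ordinary.
    apply/ordinaryP; split=> //; first by apply: contraNneq aF => <-.
    by apply: contraNneq pF => <-.
  rewrite W'F //; apply: (gathered_unknown (joined_gathered (hF io iF))).
  - by rewrite cW; apply: contraNneq pF => ->.
  - exact: z6_unknown.
  - by move=> _ ->; apply: B5_unknown.
- move=> i iF ia; have ib : i != b by apply: contraNneq iF => ->.
  have -> : W' i = h i.
    have [->|ip] := eqVneq i p; first exact: W'p.
    by apply: W'F; apply/ordinaryP.
  have := source_head i; rewrite /source (negbTE iF) => Ai.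
  apply: (anc_trans Ai); case: A7P => _ /(_ (h0 p)) h1 _.
  by apply: anc_trans (W0 p); apply: h1; left.
Qed.

Let z4_anc_B5 i : i \in ordinary -> z4 i \in ancestors B5.
Proof. by move=> io; case: B5P => _ + _; apply; exists i. Qed.

Lemma step_spread : spread W h.
Proof.
split=> [q j jp|]; last first.
  rewrite ha; case: A7P => _ /(_ (h0 p)) h1 _.
  by apply: anc_trans (W0 p); apply: h1; left.
apply: anc_trans (source_head q) _; rewrite /source; case: ifP => _; last first.
  exact: anc_trans (gathered_anc A7P) (A2_known jp).
have [jS|jS] := boolP (j \in S); first exact: anc_trans (gathered_anc B5P) (B3_known jS).
(* [B5] does not strongly see the witnesses outside [S], but it still knows those of ordinary
   parties, through their heads [z4]. *)
have jo : j \in ordinary.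
  by apply/ordinaryP; split=> //; apply: contraNneq jS => ->.
exact: anc_trans (z4_anc_B5 jo) (anc_trans (gathered_anc (z4P jo)) (W0 j)).
Qed.

End Step.
End RoundStep.

(** * Sequences of syncs and the script of a round *)

Section Runs.
Local Open Scope nat_scope.
Variables (n : nat) (D : choiceType).
Local Notation event := (event n D).
Implicit Types (x y z e m : event) (h : 'I_n -> event).

Definition extends h h' : Prop := forall q, h q \in chain (h' q).

Lemma extends_refl h : extends h h.
Proof. by move=> q; apply: chain_refl. Qed.

Lemma extends_trans h2 h1 h3 : extends h1 h2 -> extends h2 h3 -> extends h1 h3.
Proof. by move=> h12 h23 q; apply: chain_trans (h23 q) (h12 q). Qed.

Lemma updE (T : Type) (f : 'I_n -> T) q v : upd f q v q = v.
Proof. by rewrite /upd eqxx. Qed.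

Lemma upd_neq (T : Type) (f : 'I_n -> T) q v i : i != q -> upd f q v i = f i.
Proof. by rewrite /upd => /negbTE ->. Qed.

(** Creating an event only for news is what preserves well-formedness: an [m] unknown to [q] cannot
    be an event of [q], since all known events of [q] lie below its head. *)
Definition absorbs (q : 'I_n) x m x' : Prop :=
  joined q x m x' /\ (m \in ancestors x -> x' = x).

Definition synced (s q : 'I_n) h h' : Prop :=
  exists2 x', h' = upd h q x' & absorbs q (h q) (h s) x'.

Lemma extends_upd h q m x' : joined q (h q) m x' -> extends h (upd h q x').
Proof.
move=> jo i; have [->|iq] := eqVneq i q; last by rewrite upd_neq ?chain_refl.
by rewrite updE; case: jo => [[_ ->]|[d ->]]; rewrite ?inE chain_refl ?orbT.
Qed.

Lemma fork_free_upd h q m x' :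
  fork_free h -> known h m -> absorbs q (h q) m x' -> fork_free (upd h q x').
Proof.
move=> ff km [jo x'E]; have [hc wf fc] := ff.
have [mq|mq] := boolP (m \in ancestors (h q)).
  have E i : upd h q x' i = h i.
    by rewrite (x'E mq) /upd; case: eqP => [->|].
  by split=> [i|i|i e]; [rewrite E|rewrite E|rewrite !E; apply: fc].
case: jo mq => [[-> //]|[d ->]] mq.
have cm : creator m != q.
  apply: contra mq => /eqP <-; case: km => s /fc /chain_anc; exact.
have wfm : well_formed m by case: km => s /well_formed_anc; apply.
split=> [i|i|i e].
- by rewrite /upd; case: eqP => [->|].
- by rewrite /upd; case: eqP => [_|//]; rewrite /= hc eqxx cm wf wfm.
have ce z : known h z -> z \in chain (upd h q (Child q d (h q) m) (creator z)).
  case=> s /fc zc; rewrite /upd; case: eqP => [E|//].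
  by rewrite inE -E zc orbT.
rewrite {1}/upd; case: eqP => [_|_]; last by move=> ei; apply: ce; exists i.
rewrite in_anc_child => /or3P[/eqP ->|eq|em].
- by rewrite /= updE inE eqxx.
- by apply: ce; exists q.
- by apply: ce; apply: known_anc em.
Qed.

Fixpoint runs (l : seq ('I_n * 'I_n)) h h' : Prop :=
  if l is (s, q) :: l' then exists2 h1, synced s q h h1 & runs l' h1 h'
  else h' = h.

Lemma runs_cat l1 l2 h h' :
  runs (l1 ++ l2) h h' <-> exists2 h1, runs l1 h h1 & runs l2 h1 h'.
Proof.
elim: l1 h => [|[s q] l1 IH] h /=.
  by split=> [r|[_ -> //]]; exists h.
split=> [[h1 s1 /IH[h2 r1 r2]]|[h2 [h1 s1 r1] r2]].
  by exists h2 => //; exists h1.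
by exists h1 => //; apply/IH; exists h2.
Qed.

Lemma runs_rcons l s q h h1 h' :
  runs l h h1 -> synced s q h1 h' -> runs (rcons l (s, q)) h h'.
Proof. by move=> r1 s1; rewrite -cats1; apply/runs_cat; exists h1 => //; exists h'. Qed.

Lemma runs_fork_free l h h' : runs l h h' -> fork_free h -> fork_free h'.
Proof.
elim: l h => [h -> //|[s q] l IH h /= [h1 [x' -> ab] /IH ih] ff].
by apply: ih; apply: fork_free_upd ab => //; apply: known_head.
Qed.

Lemma runs_extends l h h' : runs l h h' -> extends h h'.
Proof.
elim: l h => [h ->|[s q] l IH h /= [h1 [x' -> [jo _]] /IH ih]].
  exact: extends_refl.
by apply: extends_trans ih; apply: extends_upd jo.
Qed.

Lemma runs_gather q (X : seq 'I_n) h h' :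
  runs [seq (i, q) | i <- X] h h' ->
  (forall i, i != q -> h' i = h i) /\
  gathered q (h q) (fun m => exists2 i, i \in X & i != q /\ m = h i) (h' q).
Proof.
elim: X h => [|i X IH] h /=.
  move=> ->; split=> //; split=> [|m [i]|e ->] //; first exact: chain_refl.
  by constructor 1.
case=> h1 [x1 -> [jo _]] /IH[oth [c1 m1 u1]]; split=> [j jq|].
  by rewrite oth // upd_neq.
rewrite updE in c1 u1.
have [c0 m0 u0] := joined_gathered jo.
split.
- exact: chain_trans c1 c0.
- move=> m [j + [jq ->]]; rewrite inE => /orP[/eqP ->|jX].
    exact: anc_trans (chain_anc c1) (m0 _ erefl).
  by apply: m1; exists j => //; rewrite upd_neq.
- move=> e /u1[/u0[]|[m [j jX [jq]]]|->].
  + by move=> ?; constructor 1.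
  + case=> _ -> ei; have [E|iq] := eqVneq i q; first by constructor 1; rewrite -E.
    by constructor 2; exists (h i) => //; exists i; rewrite ?inE ?eqxx.
  + by constructor 3.
  + rewrite upd_neq // => -> ej; constructor 2; exists (h j) => //.
    by exists j => //; rewrite inE jX orbT.
  + by constructor 3.
Qed.

Lemma runs_scatter s (X : seq 'I_n) h h' :
  s \notin X -> uniq X -> runs [seq (s, i) | i <- X] h h' ->
  (forall i, i \notin X -> h' i = h i) /\
  (forall i, i \in X -> joined i (h i) (h s) (h' i)).
Proof.
elim: X h => [|i X IH] h /=; first by move=> _ _ ->.
rewrite inE negb_or => /andP[si sX] /andP[iX uX] [h1 [x1 -> [jo _]]].
case/(IH _ sX uX) => oth jn; split=> j; rewrite inE.
  by rewrite negb_or => /andP[ji jX]; rewrite oth // upd_neq.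
move=> /orP[/eqP ->|jX]; first by rewrite oth // updE.
have ji : j != i by apply: contraNneq iX => <-.
by have := jn j jX; rewrite !upd_neq.
Qed.

(* The witness of [j] in round [r], or the junk value [h j] if there is none. *)
Definition wit h (r : nat) (j : 'I_n) : event :=
  head (h j) [seq e <- chain (h j) | witness e && (round e == r)].

Lemma witnesses_extends h h' r W :
  extends h h' -> witnesses h r W -> witnesses h' r W.
Proof.
by move=> hh' hW j; case: (hW j) => Wc ? ?; split=> //; apply: chain_trans Wc.
Qed.

Lemma witE h r W j : witnesses h r W -> wit h r j = W j.
Proof.
move=> hW; have [Wc ww rw] := hW j; rewrite /wit.
set l := [seq _ <- _ | _].
have Wl : W j \in l by rewrite mem_filter ww rw eqxx.
have : head (h j) l \in l by case: l Wl => //= e l _; rewrite inE eqxx.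
rewrite mem_filter => /andP[/andP[we /eqP re] ec].
by apply: (chain_witness_uniq ec Wc we ww); rewrite rw.
Qed.

Lemma wit_extends h h' r j :
  extends h h' -> witnesses h r (wit h r) -> wit h' r j = wit h r j.
Proof. by move=> hh' /(witnesses_extends hh') /witE. Qed.

Lemma head_witnesses h r : (forall q, round (h q) = r) -> witnesses h r (wit h r).
Proof.
move=> rh j; have [w [wc ww rw]] := chain_witness (h j).
have : w \in [seq e <- chain (h j) | witness e && (round e == r)].
  by rewrite mem_filter ww rw rh eqxx.
rewrite /wit; set l := [seq _ <- _ | _] => wl.
have : head (h j) l \in l by case: l wl => //= e l _; rewrite inE eqxx.
by rewrite mem_filter => /andP[/andP[? /eqP ?] ?].
Qed.

Variables (a b p : 'I_n) (F : {set 'I_n}).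
Hypotheses (n_gt : 48 < n) (ab : a != b) (ap : a != p) (bp : b != p).
Hypotheses (aF : a \notin F) (pF : p \notin F) (bF : b \in F).

Local Notation ordinary := (ordinary a b p).
Local Notation valid_choice := (valid_choice a b p).
Local Notation round_start := (round_start a b).
Local Notation round_facts := (round_facts a b p F).
Local Notation spread := (spread a p).

(* This part of a round does not depend on the choice [S]: it makes the
   witnesses of the round, hence their coins, visible to the adversary. *)
Definition opening : seq ('I_n * 'I_n) :=
  (a, b) :: [seq (i, a) | i <- b :: enum ordinary].

(* A sync of [b] with itself has no effect, and keeps the length constant. *)
Definition round_script (S : {set 'I_n}) : seq ('I_n * 'I_n) :=
  opening ++
  [seq (i, b) | i <- [seq if s \in S then s else b | s <- enum ordinary]] ++
  [seq (b, i) | i <- enum ordinary] ++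
  [seq (i, b) | i <- enum ordinary] ++
  [seq (a, i) | i <- enum ordinary] ++
  [seq (i, a) | i <- p :: enum ordinary] ++
  [seq (b, i) | i <- [seq i <- enum ordinary | i \in F]] ++
  [seq (a, i) | i <- p :: [seq i <- enum ordinary | i \notin F]].

Lemma gathered_sub q x (ms ms' : event -> Prop) x' :
  (forall m, ms m <-> ms' m) -> gathered q x ms x' -> gathered q x ms' x'.
Proof.
move=> mE [c m u]; split=> // [e /mE /m //|e /u[?|[e' /mE ? ?]|?]].
- by constructor 1.
- by constructor 2; exists e'.
- by constructor 3.
Qed.

Lemma opening_gathered h0 h : runs opening h0 h ->
  [/\ gathered b (h0 b) (fun m => m = h0 a) (h b),
      gathered a (h0 a)
        (fun m => m = h b \/ exists2 i, i \in ordinary & m = h0 i) (h a)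
    & forall i, i != a -> i != b -> h i = h0 i].
Proof.
move=> /= [h1 [x1 -> [jo _]]] [h2 s2 r2].
have /(_ (b :: enum ordinary)) := @runs_gather a _ (upd h0 b x1) h.
move=> /(_ (ex_intro2 _ _ _ s2 r2))[oth g].
rewrite upd_neq // in g.
split.
- rewrite (oth b) 1?eq_sym // updE; exact: joined_gathered jo.
- apply: gathered_sub g => m; split.
    move=> [i + [ia ->]]; rewrite inE mem_enum => /orP[/eqP ->|io].
      by left; rewrite (oth b) 1?eq_sym.
    right; exists i => //; rewrite upd_neq //.
    by case/ordinaryP: io.
  case=> [->|[i io ->]].
    by exists b; rewrite ?inE ?eqxx // eq_sym; split=> //; rewrite oth // eq_sym.
  have [ia ib _] := ordinaryP _ _ _ _ io.
  by exists i; rewrite ?inE ?mem_enum ?io ?orbT // upd_neq.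
- by move=> i ia ib; rewrite oth // upd_neq.
Qed.

Lemma opening_known h0 h r W j : runs opening h0 h -> witnesses h0 r W ->
  j != p -> W j \in ancestors (h (if j == a then b else a)).
Proof.
move=> /opening_gathered[gb ga _] hW jp.
have W0 i : W i \in ancestors (h0 i) by case: (hW i) => /chain_anc.
have [->|ja] := eqVneq j a.
  by case: gb => _ /(_ _ erefl) h1 _; apply: anc_trans h1 _.
case: ga => _ mA _; have [->|jb] := eqVneq j b.
  have /mA h1 : h b = h b \/ exists2 i, i \in ordinary & h b = h0 i by left.
  by apply: anc_trans h1 (anc_trans (gathered_anc gb) (W0 b)).
have /mA h1 : h0 j = h b \/ exists2 i, i \in ordinary & h0 j = h0 i.
  by right; exists j => //; apply/ordinaryP.
exact: anc_trans h1 (W0 j).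
Qed.

(** The heads between the phases of the script are those of the one-round analysis: [h1 b], [h1 a],
    [h2 b], [h4 b], [h6 a] serve as [B1], [A2], [B3], [B5], [A7], and [h3], [h5] as [z4], [z6]. *)
Lemma script_round h0 h r S : round_start h0 r -> valid_choice S ->
  runs (round_script S) h0 h ->
  [/\ round_start h r.+1, round_facts S (wit h r) (wit h r.+1)
    & spread (wit h r) h].
Proof.
move=> start SV run; have [ff0 r0 rh0 _] := start.
have ffh := runs_fork_free run ff0.
have ext := runs_extends run.
have HW0 := head_witnesses rh0.
have bo : b \notin ordinary by rewrite !inE eqxx orbT.
have ao : a \notin ordinary by rewrite !inE eqxx.
have po : p \notin ordinary by rewrite !inE eqxx orbT.
have bE : b \notin enum ordinary by rewrite mem_enum.
have aE : a \notin enum ordinary by rewrite mem_enum.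
have bE' : b \notin [seq i <- enum ordinary | i \in F].
  by rewrite mem_filter (negbTE bE) andbF.
have aE' : a \notin p :: [seq i <- enum ordinary | i \notin F].
  by rewrite inE mem_filter (negbTE aE) andbF orbF.
have uE : uniq (enum ordinary) := enum_uniq _.
have uE' : uniq [seq i <- enum ordinary | i \in F] by rewrite filter_uniq.
have uE2 : uniq (p :: [seq i <- enum ordinary | i \notin F]).
  by rewrite /= filter_uniq // mem_filter mem_enum (negbTE po) andbF.
move: run; rewrite /round_script.
case/runs_cat=> h1 /opening_gathered[g1 g2 o2].
case/runs_cat=> h2 /runs_gather[o3 g3].
case/runs_cat=> h3 /(runs_scatter bE uE)[o4 g4].
case/runs_cat=> h4 /runs_gather[o5 g5].
case/runs_cat=> h5 /(runs_scatter aE uE)[o6 g6].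
case/runs_cat=> h6 /runs_gather[o7 g7].
case/runs_cat=> h7 /(runs_scatter bE' uE')[o8 g8].
move=> /(runs_scatter aE' uE2)[o9 g9].
have ba : b != a by rewrite eq_sym.
have pa : p != a by rewrite eq_sym.
have pb : p != b by rewrite eq_sym.
have e3 i : i \in ordinary -> h2 i = h0 i.
  by case/ordinaryP=> ia ib _; rewrite o3 // o2.
have e3a : h2 a = h1 a by rewrite o3.
have e4a : h3 a = h2 a by rewrite o4 // mem_enum.
have e4b : h3 b = h2 b by rewrite o4 // mem_enum.
have e4p : h3 p = h0 p by rewrite o4 ?mem_enum // o3 // o2.
have e5 i : i \in ordinary -> h4 i = h3 i by case/ordinaryP=> ia ib _; rewrite o5.
have e5a : h4 a = h1 a by rewrite o5 // e4a e3a.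
have e6a : h5 a = h1 a by rewrite o6 ?mem_enum.
have e6b : h5 b = h4 b by rewrite o6 ?mem_enum.
have e6p : h5 p = h0 p by rewrite o6 ?mem_enum // o5.
have e7 i : i \in ordinary -> h6 i = h5 i by case/ordinaryP=> ia ib _; rewrite o7.
have e7b : h6 b = h4 b by rewrite o7 // e6b.
have e7p : h6 p = h0 p by rewrite o7.
have e8a : h7 a = h6 a by rewrite o8 // mem_filter mem_enum (negbTE ao) andbF.
have e8b : h7 b = h4 b by rewrite o8 // mem_filter mem_enum (negbTE bo) andbF.
have e8p : h7 p = h0 p by rewrite o8 // mem_filter mem_enum (negbTE po) andbF.
have e9a : h a = h6 a.
  by rewrite o9 // inE mem_filter mem_enum (negbTE ap) (negbTE ao) andbF.
have e9b : h b = h4 b.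
  by rewrite o9 // inE mem_filter mem_enum (negbTE bp) (negbTE bo) andbF.
have G3 : gathered b (h1 b)
    (fun m => exists2 i, i \in ordinary & i \in S /\ m = h0 i) (h2 b).
  apply: gathered_sub g3 => m; split.
    case=> i /mapP[j]; rewrite mem_enum => jo -> []; case: ifP => [jS jb ->|_].
      exists j => //; split=> //; rewrite o2 //; by case/ordinaryP: jo.
    by rewrite eqxx.
  case=> i io [iS ->]; have [ia ib _] := ordinaryP _ _ _ _ io.
  exists i; last by rewrite o2.
  by apply/mapP; exists i; rewrite ?mem_enum ?iS.
have G4 i : i \in ordinary -> gathered i (h0 i) (fun m => m = h2 b) (h3 i).
  move=> io; rewrite -(e3 i io); apply: joined_gathered.
  by apply: g4; rewrite mem_enum.
have G5 : gathered b (h2 b)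
    (fun m => exists2 i, i \in ordinary & m = h3 i) (h4 b).
  rewrite -e4b; apply: gathered_sub g5 => m; split.
    by case=> i; rewrite mem_enum => io [_ ->]; exists i.
  case=> i io ->; exists i; rewrite ?mem_enum //; split=> //.
  by case/ordinaryP: io.
have G6 i : i \in ordinary -> gathered i (h3 i) (fun m => m = h1 a) (h5 i).
  move=> io; rewrite -(e5 i io) -e5a; apply: joined_gathered.
  by apply: g6; rewrite mem_enum.
have G7 : gathered a (h1 a)
    (fun m => m = h0 p \/ exists2 i, i \in ordinary & m = h5 i) (h6 a).
  rewrite -e6a; apply: gathered_sub g7 => m; split.
    case=> i; rewrite inE mem_enum => /orP[/eqP -> [_ ->]|io [_ ->]].
      by left.
    by right; exists i.
  case=> [->|[i io ->]]; first by exists p; rewrite ?inE ?eqxx ?e6p.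
  exists i; rewrite ?inE ?mem_enum ?io ?orbT //; split=> //.
  by case/ordinaryP: io.
have G8 i : i \in ordinary -> i \in F -> joined i (h5 i) (h4 b) (h i).
  move=> io iF; have [ia ib ip] := ordinaryP _ _ _ _ io.
  rewrite -(e7 i io) -e7b o9; last by rewrite inE mem_filter iF (negbTE ip).
  by apply: g8; rewrite mem_filter iF mem_enum.
have G9 i : i \in ordinary -> i \notin F -> joined i (h5 i) (h6 a) (h i).
  move=> io iF; rewrite -(e7 i io) -e8a -(o8 i); last by rewrite mem_filter (negbTE iF).
  by apply: g9; rewrite inE mem_filter iF mem_enum io orbT.
have G9p : joined p (h0 p) (h6 a) (h p).
  by rewrite -e8p -e8a; apply: g9; rewrite inE eqxx.
have start' : round_start h r.+1.
  exact: (@step_round_start _ _ a b p F n_gt ab ap bp aF pF bF h0 h r S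
    (h1 b) (h1 a) (h2 b) (h4 b) (h6 a) h3 h5 (wit h0 r)).
have HW' : witnesses h r.+1 (wit h r.+1).
  by apply: head_witnesses => q; case: start'.
have HW : witnesses h0 r (wit h r).
  by move=> j; rewrite (wit_extends _ ext HW0); apply: HW0.
split=> //.
  exact: (@step_round_facts _ _ a b p F n_gt ab ap bp aF pF bF h0 h r S
    (h1 b) (h1 a) (h2 b) (h4 b) (h6 a) h3 h5).
exact: (@step_spread _ _ a b p F n_gt ab ap bp aF pF bF h0 h r S
    (h1 b) (h1 a) (h2 b) (h4 b) (h6 a) h3 h5).
Qed.

End Runs.

(** * Elections *)

Section Sizes.
Local Open Scope nat_scope.

Lemma set_between (T : finType) (A B : {set T}) k :
  A \subset B -> #|A| <= k <= #|B| ->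
  exists2 S : {set T}, A \subset S & S \subset B /\ #|S| = k.
Proof.
move=> AB /andP[]; elim: k => [|k IH] Ak kB.
  by exists A => //; split=> //; apply/eqP; rewrite -leqn0.
have [lt|ge] := ltnP k #|A|.
  by exists A => //; split=> //; apply/eqP; rewrite eqn_leq Ak.
have [S AS [SB cS]] := IH ge (ltnW kB).
have /properP[_ [x xB xS]] : S \proper B.
  by rewrite properEneq SB andbT; apply: contraTneq kB => <-; rewrite cS ltnn.
exists (x |: S); first by apply: subset_trans AS (subsetUr _ _).
by rewrite subUset sub1set xB SB cardsU1 xS cS.
Qed.

Lemma few_not_supermajority (n m m' : nat) : m <= m' -> 8 * m' <= 5 * n -> ~~ supermajority n m.
Proof. by rewrite /supermajority; lia. Qed.

Variable n : nat.
Hypothesis n_gt : 48 < n.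
Local Notation k := ((2 * n) %/ 3 + 1).

(** [k] is the least supermajority; the 2 leaves room for the hubs next to a minority of size
    [m]. *)
Lemma two_thirds_room m : 2 * m < n -> m + 2 <= k <= n.-1.
Proof. by have := divn_eq (2 * n) 3; have := ltn_pmod (2 * n) (isT : 0 < 3); lia. Qed.

Lemma two_thirds_supermajority : supermajority n k.
Proof.
rewrite /supermajority.
by have := divn_eq (2 * n) 3; have := ltn_pmod (2 * n) (isT : 0 < 3); lia.
Qed.

(** Here 3/8 > 1/3 is used: twice the minority is at least 3n/4 - 2, while [k] is at most 2n/3 + 1,
    so that n > 36 suffices. *)
Lemma two_thirds_half m s : 3 * n <= 8 * m + 8 -> m <= s -> k - s < s.
Proof. by have := divn_eq (2 * n) 3; have := ltn_pmod (2 * n) (isT : 0 < 3); lia. Qed.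

End Sizes.

(** * Keeping the votes of every round split *)

Section Elections.
Local Open Scope nat_scope.
Variables (n : nat) (D : choiceType).
Local Notation event := (event n D).
Implicit Types (x y z e m : event) (h : 'I_n -> event).
Variables (a b p : 'I_n) (F : {set 'I_n}).
Hypotheses (n_gt : 48 < n) (ab : a != b) (ap : a != p) (bp : b != p).
Hypotheses (aF : a \notin F) (pF : p \notin F) (bF : b \in F).
Hypothesis cF : #|F| = n./2.

Local Notation valid_choice := (valid_choice a b p).
Local Notation round_start := (round_start a b).
Local Notation round_facts := (round_facts a b p F).
Local Notation spread := (spread a p).

(** This is [majority] on the level of parties, with [T] as electorate and [Y] as yes voters; a tie
    again means yes. *)
Definition majority_in (Y T : {set 'I_n}) : bool := #|T :\: Y| <= #|T :&: Y|.

Definition divergent (Y S : {set 'I_n}) : bool :=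
  valid_choice S && (majority_in Y S != majority_in Y (~: [set p])).

(** The default is itself a valid choice, because the script has to go on in rounds where no
    divergent set is found. *)
Definition split_choice (Y : {set 'I_n}) : {set 'I_n} :=
  odflt (~: [set p]) [pick S | divergent Y S].

Definition balanced (A : {set 'I_n}) : bool :=
  (3 * n <= 8 * #|A|) && (8 * #|A| <= 5 * n).

Lemma split_choice_valid Y : valid_choice (split_choice Y).
Proof.
rewrite /split_choice; case: pickP => [S /andP[] //|_] /=.
rewrite /valid_choice !inE ap bp eqxx cardsCs setCK cards1 card_ord.
by rewrite /supermajority; move: n_gt; clear; lia.
Qed.

(** Let [M] be the losing side among the parties other than [p]. In a set of the least supermajority
    size that avoids [p] and contains [M] and both hubs, [M] is the winning side. *)
Lemma split_choiceP (Y : {set 'I_n}) : balanced Y ->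
  majority_in (Y :\ p) (split_choice (Y :\ p))
    != majority_in (Y :\ p) (~: [set p]).
Proof.
move=> /andP[Yge Yle]; set Y' := Y :\ p.
suff [S dS] : exists S, divergent Y' S.
  rewrite /split_choice; case: pickP => [S' /andP[] //|/(_ S)].
  by rewrite dS.
set B := ~: [set p].
have cB : #|B| = n.-1 by rewrite cardsCs setCK cards1 card_ord subn1.
have Y'B : Y' \subset B by apply/subsetP => i; rewrite !inE => /andP[].
have BI : B :&: Y' = Y' by apply/setIidPr.
have cY' : #|Y'| <= #|Y| <= #|Y'| + 1.
  rewrite (cardsD1 p Y) -/Y'.
  by case: (p \in Y); rewrite ?add0n ?leqnn ?leq_addr // addnC leqnn leq_addr.
have cBD : #|B :\: Y'| = n.-1 - #|Y'| by rewrite cardsD BI cB.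
pose M := if majority_in Y' B then B :\: Y' else Y'.
have MB : M \subset B by rewrite /M; case: ifP => // _; apply: subsetDl.
have cM : 3 * n <= 8 * #|M| + 8 /\ 2 * #|M| < n.
  rewrite /M; case: ifPn; rewrite /majority_in BI => mB; rewrite ?cBD;
    rewrite cBD in mB; clear - n_gt Yge Yle cY' mB;
    move: (#|Y'|) (#|Y|) cY' Yge Yle mB => u v; clear - n_gt; lia.
pose k := (2 * n) %/ 3 + 1.
have abB : [set a; b] \subset B.
  by apply/subsetP => i; rewrite !inE => /orP[] /eqP ->.
have [||S abS [SB cS]] := @set_between _ ([set a; b] :|: M) B k.
- by rewrite subUset abB.
- have c2 : #|[set a; b] :|: M| <= #|M| + 2.
    by rewrite (leq_trans (leq_card_setU _ _)) // cards2 ab addnC.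
  have [_ /(two_thirds_room n_gt)/andP[h1 h2]] := cM.
  by rewrite cB /k h2 (leq_trans c2 h1).
move: abS; rewrite subUset => /andP[abS MS].
exists S; apply/andP; split.
  rewrite /valid_choice (subsetP abS) ?inE ?eqxx // (subsetP abS) ?inE ?eqxx ?orbT //.
  rewrite /= cS /supermajority; apply/andP; split.
    by apply/negP => pS; have := subsetP SB _ pS; rewrite !inE eqxx.
  exact: two_thirds_supermajority.
move: cM MS; rewrite /M; case: ifP => mB cM MS.
  have -> : majority_in Y' S = false; last by [].
  apply/negbTE; rewrite /majority_in -ltnNge.
  have -> : #|S :&: Y'| = k - #|S :\: Y'|.
    by rewrite cardsD -cS subKn // subset_leq_card // subsetIl.
  have : #|B :\: Y'| <= #|S :\: Y'|.
    apply/subset_leq_card/subsetP => i iBY.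
    by rewrite inE (subsetP MS _ iBY) andbT; case/setDP: iBY.
  by case: cM => + _ => /(two_thirds_half n_gt); apply.
have -> : majority_in Y' S; last by [].
rewrite /majority_in cardsD cS (setIidPr MS) ltnW //.
by case: cM => + _ => /(two_thirds_half n_gt); apply.
Qed.

Lemma strong_perm h r W y : fork_free h -> witnesses h r W -> known h y ->
  round y = r.+1 ->
  perm_eq (voters y) [seq W j | j <- enum (strong W y)].
Proof.
move=> ff hW ky ry; have cW := witnesses_creator _ ff hW.
apply: uniq_perm; first exact: undup_uniq.
  by rewrite map_inj_uniq ?enum_uniq // => i j /(congr1 (@creator _ _)); rewrite !cW.
move=> z; rewrite mem_undup mem_filter ry /=.
apply/andP/mapP => [[/and3P[wz /eqP rz sz] zy]|[j]].
  have kz := known_anc ky zy.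
  exists (creator z); last exact: (witnesses_uniq ff hW kz wz rz).
  rewrite mem_enum inE -(witnesses_uniq ff hW kz wz rz).
  by rewrite -(strongly_sees_carriers _ ff ky).
rewrite mem_enum inE -(strongly_sees_carriers _ ff ky) => sj ->.
have [_ wj rj] := hW j; rewrite wj rj eqxx sj; split=> //.
exact: strongly_sees_anc sj.
Qed.

Lemma count_voters h r W y f : fork_free h -> witnesses h r W -> known h y ->
  round y = r.+1 ->
  count f (voters y) = #|[set j in strong W y | f (W j)]|.
Proof.
move=> ff hW ky ry; have /permP -> := strong_perm ff hW ky ry.
rewrite count_map -sum1_count big_enum_cond /= sum1dep_card.
by [].
Qed.

Lemma majority_size_balanced h r W y f : fork_free h -> witnesses h r W ->
  known h y -> round y = r.+1 -> balanced [set j | f (W j)] ->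
  ~~ supermajority n (majority_size f (voters y)).
Proof.
move=> ff hW ky ry; pose A : {set 'I_n} := [set j | f (W j)].
rewrite -/A => /andP[lo hi].
have cC : #|~: A| = n - #|A| by rewrite cardsCs setCK card_ord.
have hi' : 8 * #|~: A| <= 5 * n by rewrite cC; move: lo; clear; lia.
rewrite /majority_size; case: (majority f (voters y)).
  have -> : count (fun z => f z == true) (voters y) = count f (voters y).
    by apply: eq_count => z /=; rewrite eqb_id.
  rewrite (count_voters f ff hW ky ry); apply: few_not_supermajority hi.
  by apply/subset_leq_card/subsetP => j; rewrite !inE => /andP[].
have -> : count (fun z => f z == false) (voters y) = count (fun z => ~~ f z) (voters y).
  by apply: eq_count => z /=; rewrite eqbF_neg.
rewrite (count_voters (fun z => ~~ f z) ff hW ky ry).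
apply: few_not_supermajority hi'.
by apply/subset_leq_card/subsetP => j; rewrite !inE => /andP[].
Qed.

Lemma majority_strong h r W y f T : fork_free h -> witnesses h r W ->
  known h y -> round y = r.+1 -> strong W y = T -> p \notin T ->
  majority f (voters y) = majority_in ([set j | f (W j)] :\ p) T.
Proof.
move=> ff hW ky ry <- pT; rewrite /majority /majority_in.
rewrite (count_voters f ff hW ky ry) (count_voters (fun z => ~~ f z) ff hW ky ry).
congr (_ <= _); apply: eq_card => j; rewrite !inE.
  have [->|jp] := eqVneq j p; last by rewrite andbC.
  by move: pT; rewrite inE => /negbTE ->.
have [->|jp] := eqVneq j p; last by [].
by move: pT; rewrite inE => /negbTE ->.
Qed.

Variables (c r0 : nat) (coin : event -> bool).
Hypotheses (c_gt1 : 1 < c) (r0_gt0 : 0 < r0).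

Definition votes (coin : event -> bool) h (d : nat) : {set 'I_n} :=
  [set j | vote coin c (wit h r0 p) d (wit h (r0 + d) j)].

(** [p] is dropped because its witness may still be unpublished when the choice is made. Up to round
    [r0] the difference [r - r0] is 0, where [vote] is constantly false, so these choices involve no
    coin. *)
Definition chosen_set (coin : event -> bool) h (r : nat) : {set 'I_n} :=
  split_choice (votes coin h (r - r0) :\ p).

Definition history h (R : nat) : Prop :=
  [/\ fork_free h, forall r, 0 < r <= R -> witnesses h r (wit h r),
      forall r, 0 < r < R ->
        round_facts (chosen_set coin h r) (wit h r) (wit h r.+1)
    & forall r, 0 < r < R -> spread (wit h r) h].

Lemma known_wit h r j : witnesses h r (wit h r) -> known h (wit h r j).
Proof. by move=> hW; exists j; case: (hW j) => /chain_anc. Qed.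

(** [G] is the half meant to vote yes, while [i] and [j] stand for hubs, whose votes are not
    controlled; each shifts the count by at most one. *)
Lemma balanced_half (V : {set 'I_n}) (G : {set 'I_n}) (i j : 'I_n) :
  n./2 <= #|G| <= n - n./2 -> G :\ i \subset V -> V \subset j |: G -> balanced V.
Proof.
move=> cG /subset_leq_card lo /subset_leq_card hi.
have h1 : #|G| <= #|G :\ i|.+1 by rewrite (cardsD1 i G); case: (i \in G).
have h2 : #|j |: G| <= #|G|.+1 by rewrite cardsU1; case: (j \in G).
have lo' : #|G| <= #|V|.+1 := leq_trans h1 (lo : (_ < _.+1)).
have hi' : #|V| <= #|G|.+1 := leq_trans hi h2.
rewrite /balanced; move: (#|G|) (#|V|) cG lo' hi' => g v; clear - n_gt; lia.
Qed.

Lemma votes_first h R : history h R -> r0 + 1 <= R -> balanced (votes coin h 1).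
Proof.
case=> ff hW /(_ r0) hf _ rR.
have /hf[_ _ noF yesL] : 0 < r0 < R by lia.
have HW := hW (r0 + 1); rewrite addn1 in HW; have {}HW : witnesses h r0.+1 (wit h r0.+1).
  by apply: HW; lia.
apply: (@balanced_half _ (~: F) a a).
- by rewrite cardsCs setCK card_ord cF; clear; lia.
- apply/subsetP => i; rewrite !inE addn1 => /andP[ia iF] /=.
  by rewrite (sees_anc _ ff (known_wit i HW)) yesL.
- apply/subsetP => i; rewrite !inE addn1 /= (sees_anc _ ff (known_wit i HW)).
  by have [//|ia] := eqVneq i a; apply: contraTN => iF; apply: noF.
Qed.

Lemma votes_next h R d : history h R -> 0 < d -> r0 + d.+1 <= R ->
  balanced (votes coin h d) ->
  (c %| d.+1 -> balanced [set j | coin (wit h (r0 + d.+1) j)]) ->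
  balanced (votes coin h d.+1).
Proof.
case=> ff hW /(_ (r0 + d)) hf _ d0 rR bal balc.
have HW : witnesses h (r0 + d) (wit h (r0 + d)).
  by apply: hW; move: r0_gt0 rR; clear; lia.
have HW' : witnesses h (r0 + d.+1) (wit h (r0 + d.+1)).
  by apply: hW; move: r0_gt0 rR; clear; lia.
have /hf[factF factL _ _] : 0 < r0 + d < R by move: r0_gt0 rR; clear; lia.
set f := vote coin c (wit h r0 p) d in bal *.
have nosm j : ~~ supermajority n (majority_size f (voters (wit h (r0 + d.+1) j))).
  apply: (majority_size_balanced ff HW (known_wit j HW')) => //.
  by have [_ _ ->] := HW' j; rewrite addnS.
have vE j : vote coin c (wit h r0 p) d.+1 (wit h (r0 + d.+1) j) =
    if c %| d.+1 then coin (wit h (r0 + d.+1) j)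
    else majority f (voters (wit h (r0 + d.+1) j)).
  have -> : vote coin c (wit h r0 p) d.+1 (wit h (r0 + d.+1) j) =
    if (c %| d.+1) && ~~ supermajority n (majority_size f (voters (wit h (r0 + d.+1) j)))
    then coin (wit h (r0 + d.+1) j)
    else majority f (voters (wit h (r0 + d.+1) j)).
    by rewrite /f; case: (d) d0.
  by rewrite nosm andbT.
have [cd|cd] := boolP (c %| d.+1).
  rewrite (_ : votes _ _ _ = [set j | coin (wit h (r0 + d.+1) j)]); first exact: balc.
  by apply/setP => j; rewrite !inE vE cd.
have := split_choiceP bal.
set Y := votes coin h d :\ p; set S := split_choice Y => dS.
have ch : chosen_set coin h (r0 + d) = S by rewrite /chosen_set addKn.
have vF i : i \in F -> i != b -> (i \in votes coin h d.+1) = majority_in Y S.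
  move=> iF ib; rewrite inE vE (negbTE cd).
  rewrite (majority_strong (W := wit h (r0 + d)) (T := S) f ff HW (known_wit i HW')) //.
  - by have [_ _ ->] := HW' i; rewrite addnS.
  - by rewrite addnS -ch; apply: factF.
  - by have /and4P[] := split_choice_valid Y.
have vL i : i \notin F -> i != a -> (i \in votes coin h d.+1) = majority_in Y (~: [set p]).
  move=> iF ia; rewrite inE vE (negbTE cd).
  rewrite (majority_strong (W := wit h (r0 + d)) (T := ~: [set p]) f ff HW (known_wit i HW')) //.
  - by have [_ _ ->] := HW' i; rewrite addnS.
  - by rewrite addnS; apply: factL.
  - by rewrite !inE eqxx.
move: dS vF vL; case: (majority_in Y S); case: (majority_in Y _) => // _ vF vL.
- apply: (@balanced_half _ F b a); first by rewrite cF; clear; lia.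
    by apply/subsetP => i; rewrite in_setD1 => /andP[ib iF]; rewrite vF.
  apply/subsetP => i iV; rewrite in_setU1; have [//|ia] := eqVneq i a.
  by apply: contraTT iV => iF; rewrite vL.
- apply: (@balanced_half _ (~: F) a b); first by rewrite cardsCs setCK card_ord cF; clear; lia.
    by apply/subsetP => i; rewrite in_setD1 in_setC => /andP[ib iF]; rewrite vL.
  apply/subsetP => i iV; rewrite in_setU1 in_setC; have [//|ib] := eqVneq i b.
  by apply: contraTN iV => iF; rewrite vF.
Qed.

Definition good_coins h (R : nat) : Prop :=
  forall d, 1 < d -> c %| d -> r0 + d <= R ->
    balanced [set j | coin (wit h (r0 + d) j)].

Lemma votes_balanced h R d : history h R -> good_coins h R ->
  0 < d -> r0 + d <= R -> balanced (votes coin h d).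
Proof.
move=> hh gc; elim: d => // -[|d] IH _ rR; first exact: votes_first hh rR.
by apply: (votes_next hh) => //; [apply: IH; lia|move=> cd; apply: gc].
Qed.

(** Round [R.+1] is still covered because a deciding witness counts the votes of the round before
    its own. *)
Lemma undecided h R x y : history h R -> good_coins h R ->
  known h x -> creator x = p -> witness x -> round x = r0 ->
  known h y -> round y <= R.+1 -> ~~ decides coin c x y.
Proof.
move=> hh gc kx cx wx rx ky ry; have [ff hW _ _] := hh; apply/negP => /and4P[_].
rewrite rx; case Ed : (round y - r0) => [|[|d]] // _ cd; rewrite [d.+2.-1]/=.
have Wr : witnesses h r0 (wit h r0).
  by apply: hW; move: Ed ry r0_gt0; clear; lia.
have -> : x = wit h r0 p by rewrite (witnesses_uniq ff Wr kx wx rx) cx.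
apply/negP.
have dR : r0 + d.+1 <= R by move: Ed ry; clear; lia.
have HW : witnesses h (r0 + d.+1) (wit h (r0 + d.+1)).
  by apply: hW; rewrite dR addnS.
apply: (majority_size_balanced ff HW ky); first by move: Ed; clear; lia.
exact: (@votes_balanced h R d.+1 hh gc isT dR).
Qed.

End Elections.

Section Locality.
Variables (n : nat) (D : choiceType).
Local Notation event := (event n D).

(** Coins act only on descendants. This lets the choice be computed from published events, and
    separates the coins of a round from the making of its witnesses. *)
Lemma vote_local (c1 c2 : event -> bool) c x d y :
  (forall e, e \in ancestors y -> c1 e = c2 e) ->
  vote c1 c x d y = vote c2 c x d y.
Proof.
elim: d y => // -[//|d] IH y E.
have Ef z : z \in voters y -> vote c1 c x d.+1 z = vote c2 c x d.+1 z.
  rewrite mem_undup mem_filter => /andP[_ zy]; apply: IH => e ez.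
  by apply: E; apply: anc_trans ez.
have Em : majority (vote c1 c x d.+1) (voters y) = majority (vote c2 c x d.+1) (voters y).
  rewrite /majority; congr (_ <= _); apply: eq_in_count => z /Ef ->; by [].
have Es : majority_size (vote c1 c x d.+1) (voters y) = majority_size (vote c2 c x d.+1) (voters y).
  by rewrite /majority_size Em; apply: eq_in_count => z /Ef ->.
rewrite [LHS]/= [RHS]/= -/(vote c1 c x d.+1) -/(vote c2 c x d.+1).
by rewrite -[X in majority X]/(vote c1 c x d.+1) Em Es E ?ancestors_refl.
Qed.

End Locality.

(** * The strategy *)

Section Receive.
Local Open Scope nat_scope.
Variables (n : nat) (D : choiceType).
Local Notation event := (event n D).
Implicit Types (x y z e m : event) (h : 'I_n -> event) (l : seq event).

(** All lists held or sent in these runs have this form. Nothing is ever buffered, and the last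
    entry is both the self-parent of the holder's next event and the event that a sync offers as
    other-parent. *)
Definition snapshot l x : Prop := (exists l0, l = rcons l0 x) /\ l =i ancestors x.

Lemma hashgraph_closed l :
  (forall e z, e \in l -> z \in ancestors e -> z \in l) -> hashgraph_of l = l.
Proof.
move=> cl; apply/all_filterP/allP => e el; apply/allP => z; exact: cl el.
Qed.

Lemma hashgraph_snapshot l x : snapshot l x -> hashgraph_of l = l.
Proof.
case=> _ lE; apply: hashgraph_closed => e z; rewrite !lE; exact: anc_trans.
Qed.

Lemma receive_known q d l l' : {subset l' <= l} -> receive q d l l' = l.
Proof.
move=> sub; rewrite /receive.
have -> : [seq e <- undup l' | well_formed e && (e \notin l)] = [::].
  apply/eqP; rewrite -[_ == _]negbK -has_filter; apply/hasPn => e.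
  by rewrite mem_undup => /sub ->; rewrite andbF.
by rewrite cats0; case: allP => // -[].
Qed.

Lemma receive_new q d h l l' m : fork_free h -> known h m ->
  snapshot l (h q) -> snapshot l' m -> m \notin ancestors (h q) ->
  snapshot (receive q d l l') (Child q d (h q) m) /\
  (exists l1, receive q d l l' = l ++ l1).
Proof.
move=> ff km sl sl' mq; have [hc wf fc] := ff.
have [[l0 lE] lA] := sl; have [[l0' l'E] l'A] := sl'.
set new := [seq e <- undup l' | well_formed e && (e \notin l)].
have cm : creator m != q.
  by apply: contra mq => /eqP <-; case: km => s /fc /chain_anc.
have wfm : well_formed m by case: km => s /well_formed_anc; apply.
have HE z : (z \in l ++ new) = (z \in ancestors (h q)) || (z \in ancestors m).
  rewrite mem_cat mem_filter mem_undup l'A lA.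
  case: (boolP (z \in ancestors (h q))) => //= zq.
  rewrite andbT andbC; case: (boolP (z \in ancestors m)) => //= zm.
  exact: well_formed_anc zm wfm.
have HG : hashgraph_of (l ++ new) = l ++ new.
  apply: hashgraph_closed => e z; rewrite !HE => /orP[] h1 h2.
    by rewrite (anc_trans h1 h2).
  by rewrite (anc_trans h1 h2) orbT.
have notq : [seq e <- new | creator e == q] = [::].
  apply/eqP; rewrite -[_ == _]negbK -has_filter; apply/hasPn => e.
  rewrite mem_filter mem_undup l'A lA => /andP[/andP[_ eq] em].
  apply: contra eq => /eqP <-; case: (known_anc km em) => s /fc /chain_anc; exact.
have -> : receive q d l l' = rcons (l ++ new) (Child q d (h q) m).
  rewrite /receive -/new HG (hashgraph_snapshot sl).
  case: ifP => [/allP/(_ m)|_].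
    by rewrite HE ancestors_refl orbT lA (negbTE mq) => /(_ isT).
  have -> : latest (fun e => creator e == q) (l ++ new) = Some (h q).
    by rewrite /latest filter_cat notq cats0 lE filter_rcons hc eqxx rev_rcons.
  have -> : latest (fun e => (creator e != q) && (e \in l ++ new)) l' = Some m.
    by rewrite /latest l'E filter_rcons cm HE ancestors_refl orbT rev_rcons.
  by [].
split; last by exists (rcons new (Child q d (h q) m)); rewrite rcons_cat.
split; first by exists (l ++ new).
by move=> z; rewrite mem_rcons inE HE in_anc_child.
Qed.

End Receive.

Section Strategy.
Local Open Scope nat_scope.
Variables (n : nat) (D : choiceType).
Local Notation event := (event n D).
Local Notation config := (config n D).
Implicit Types (x y z e m : event) (h : 'I_n -> event) (l : seq event).
Implicit Types (C : config).
Variables (a b p : 'I_n) (F : {set 'I_n}) (c r0 : nat).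

Definition heads e C : 'I_n -> event := fun q => last e (recv C q).

Definition is_deliver (t : action n D) : bool := if t is Deliver _ then true else false.

(* The strategy alternates fairness moves and script moves; the number of
   script syncs already performed can be read off the log. *)
Definition counter (lg : seq (action n D)) : nat :=
  count (fun k => odd k && is_deliver (nth (Deliver n D 0) lg k)) (iota 0 (size lg)).

Definition script_length : nat := size (round_script a b p F set0).

Definition current_round C : nat := (counter (log C) %/ script_length).+1.

Definition next_sync e C (cv : event -> bool) : 'I_n * 'I_n :=
  nth (a, a) (round_script a b p F (chosen_set a b p c r0 cv (heads e C) (current_round C)))
    (counter (log C) %% script_length).

(** Partners are random, so a sync from [s] to [q] cannot be ordered. Instead [s] gossips until a
    message to [q] with its present hashgraph exists, which is then delivered. A sync of a party
    with itself becomes the delivery of a nonexistent message: no effect, but counted. *)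
Definition script_move C (sq : 'I_n * 'I_n) : action n D :=
  let i := find (fun m : message n D => (m.1.2 == sq.2) && (m.2 == hashgraph C sq.1))
                (msgs C) in
  if sq.1 == sq.2 then Deliver n D (size (msgs C))
  else if i < size (msgs C) then Deliver n D i else Gossip D sq.1.

Definition stale C (i : nat) : bool :=
  if onth (msgs C) i is Some (_, q, l) then all (fun e => e \in recv C q) l else true.

(** The exponent of 2 takes every value infinitely often, so every party and every message index has
    its turn again and again. A message that would bring news is held back: a nonexistent one is
    delivered instead. *)
Definition fair_move C (k : nat) : action n D :=
  let u := logn 2 k in
  if insub u is Some q then Gossip D q
  else if stale C (u - n) then Deliver n D (u - n)
  else Deliver n D (size (msgs C)).

(** The strategy is fixed before [env], so it takes the first event of [p] from the configuration,
    to serve as the default value in [heads]. *)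
Definition delaying_strategy C (cv : event -> bool) : action n D :=
  if recv C p is e :: _ then
    if odd (size (log C)) then script_move C (next_sync e C cv)
    else fair_move C (size (log C))./2
  else Gossip D p.

Definition delaying_adversary : adversary n D := Adversary set0 delaying_strategy.

Lemma counter_rcons (lg : seq (action n D)) t :
  counter (rcons lg t) = counter lg + (odd (size lg) && is_deliver t).
Proof.
rewrite /counter size_rcons -addn1 iotaD count_cat /= add0n addn0 nth_rcons ltnn eqxx.
congr (_ + _); apply: eq_in_count => k; rewrite mem_iota add0n /= => kl.
by rewrite nth_rcons kl.
Qed.

Lemma size_script S : size (round_script a b p F S) = script_length.
Proof. by rewrite /script_length /round_script !size_cat !size_map. Qed.

Lemma script_length_gt0 : 0 < script_length.
Proof. by []. Qed.

Lemma script_opening S S' k : k < size (opening a b p) ->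
  nth (a, a) (round_script a b p F S) k = nth (a, a) (round_script a b p F S') k.
Proof. by move=> lt; rewrite /round_script !nth_cat lt. Qed.

Hypotheses (n_gt : 48 < n) (ab : a != b) (ap : a != p) (bp : b != p).
Hypotheses (aF : a \notin F) (pF : p \notin F) (bF : b \in F).
Hypothesis cF : #|F| = n./2.
Hypotheses (c_gt1 : 1 < c) (r0_gt0 : 0 < r0).

Local Notation script := (round_script a b p F).
Local Notation choice := (chosen_set a b p c r0).
Local Notation history := (history a b p F c r0).

Lemma choice_local (c1 c2 : event -> bool) h r :
  (forall j, j != p -> forall e, e \in ancestors (wit h r j) -> c1 e = c2 e) ->
  choice c1 h r = choice c2 h r.
Proof.
move=> E; rewrite /chosen_set; congr split_choice.
apply/setP => j; rewrite !in_setD1 !inE; have [//|jp] := eqVneq j p.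
have [le|lt] := leqP r r0; first by move: le; rewrite -subn_eq0 => /eqP ->.
apply: vote_local => e; rewrite subnKC 1?ltnW //; exact: E.
Qed.

Lemma choice_extends coin h h' r : extends h h' ->
  (forall r', 0 < r' <= r -> witnesses h r' (wit h r')) ->
  choice coin h' r = choice coin h r.
Proof.
move=> ext hW; rewrite /chosen_set; congr split_choice.
apply/setP => j; rewrite !in_setD1 !inE; have [//|jp] := eqVneq j p.
have [le|lt] := leqP r r0; first by move: le; rewrite -subn_eq0 => /eqP ->.
rewrite subnKC 1?ltnW // !(wit_extends _ ext) //; apply: hW;
  by rewrite ?r0_gt0 ?leqnn ?(ltnW lt) // (leq_ltn_trans _ lt).
Qed.

Lemma history_extends coin h h' R : extends h h' -> fork_free h' ->
  history coin h R -> history coin h' R.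
Proof.
move=> ext ff' [ff hW hf hs].
have wE r j : 0 < r <= R -> wit h' r j = wit h r j.
  by move=> rR; apply: wit_extends ext _; apply: hW.
split=> //.
- move=> r rR; have := witnesses_extends ext (hW r rR) => h1 j.
  by rewrite wE //; apply: h1.
- move=> r rR; have [f1 f2 f3 f4] := hf r rR.
  have -> : choice coin h' r = choice coin h r.
    by apply: choice_extends ext _ => r' r'r; apply: hW; lia.
  have r1 : 0 < r <= R by lia.
  have r2 : 0 < r.+1 <= R by lia.
  have sE x : strong (wit h' r) x = strong (wit h r) x.
    by apply/setP => j; rewrite !inE wE.
  by split=> i; rewrite ?wE // ?sE; auto.
- move=> r rR; have [s1 s2] := hs r rR; have r1 : 0 < r <= R by lia.
  split=> [q j jp|]; rewrite wE //.
    exact: anc_trans (chain_anc (ext q)) (s1 q j jp).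
  exact: anc_trans (chain_anc (ext a)) s2.
Qed.

Lemma history_le coin h R R' : R' <= R -> history coin h R -> history coin h R'.
Proof.
by move=> le [ff hW hf hs]; split=> // r rR; [apply: hW|apply: hf|apply: hs]; lia.
Qed.

Lemma runs_exist (d : D) (ops : seq ('I_n * 'I_n)) h : exists h', runs ops h h'.
Proof.
elim: ops h => [|[s q] ops IH] h; first by exists h.
pose x' := if h s \in ancestors (h q) then h q else Child q d (h q) (h s).
have [h' r'] := IH (upd h q x'); exists h' => /=; exists (upd h q x') => //.
exists x' => //; rewrite /x'; split; last by move=> ->.
by case: ifP => [?|_]; [left|right; exists d].
Qed.

(** * Invariants of the execution under the strategy *)

Section Run.
Variables (env : 'I_n -> nat -> D) (coin : event -> bool).
Variable partner : 'I_n * nat -> 'I_n.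

Let first_event := Genesis p (env p 0).
Local Notation hd := (heads first_event).
Local Notation adv := delaying_adversary.
Local Notation effect := (effect env adv partner).
Local Notation step := (step env adv coin partner).
Local Notation exec := (exec env adv coin partner).
Local Notation init := (init env adv).

(** The fourth clause holds because another party's event can only have come through a message; it
    makes the coin of that event readable by the adversary. *)
Definition consistent C : Prop :=
  [/\ fork_free (hd C),
      forall q, snapshot (recv C q) (hd C q),
      forall s q l, (s, q, l) \in msgs C ->
        exists2 x, snapshot l x & x \in chain (hd C s),
      forall q e, e \in ancestors (hd C q) -> creator e != q -> e \in visible C
    & [/\ forall s, s \in corrupted adv = false, signed C = [::]
        & exists l, recv C p = first_event :: l]].

Lemma hd_snapshot C q x : snapshot (recv C q) x -> hd C q = x.
Proof. by case=> [[l0 lE] _]; rewrite /heads lE last_rcons. Qed.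

Lemma visibleE C e : consistent C ->
  (e \in visible C) = has (fun m : message n D => e \in m.2) (msgs C).
Proof.
move=> [_ _ _ _ [_ sC _]]; rewrite /visible sC cats0.
by apply/flattenP/hasP => [[l /mapP[m mC ->] el]|[m mC em]];
  [exists m|exists m.2 => //; apply: map_f].
Qed.

Lemma visible_anc C e z : consistent C ->
  e \in visible C -> z \in ancestors e -> z \in visible C.
Proof.
move=> cC; rewrite !visibleE // => /hasP[[[s q] l] mC /= el] ze.
apply/hasP; exists (s, q, l) => //=; case: cC => _ _ /(_ _ _ _ mC)[x [_ lx] _] _ _.
by rewrite !lx in el *; apply: anc_trans ze.
Qed.

Lemma init_consistent : consistent init.
Proof.
have hE q : hd init q = Genesis q (env q 0) by rewrite /heads /= inE.
have rE q : recv init q = [:: Genesis q (env q 0)] by rewrite /= inE.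
split.
- split=> [q|q|q e]; rewrite hE //.
  by rewrite inE => /eqP ->; rewrite /= hE chain_refl.
- by move=> q; rewrite rE hE; split=> //; exists [::].
- move=> s q l /mapP[[s' q'] _ [-> _ ->]]; exists (Genesis s' (env s' 0)).
    by split=> //; exists [::].
  by rewrite hE chain_refl.
- by move=> q e; rewrite hE inE => /eqP ->; rewrite eqxx.
- by split=> // [s|]; [rewrite inE|exists [::]; rewrite rE].
Qed.

Definition with_log C lg := Config (recv C) (msgs C) (signed C) (gossips C) lg.

Lemma consistent_log C lg : consistent C -> consistent (with_log C lg).
Proof. by []. Qed.

Lemma consistent_gossip C q : consistent C -> consistent (effect C (Gossip D q)).
Proof.
move=> cC; have [ff sn ms vi [co sC ne]] := cC; rewrite /= co.
split=> //.
- move=> s q' l; rewrite mem_rcons inE => /orP[/eqP[-> _ ->]|]; last exact: ms.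
  exists (hd C q); last exact: chain_refl.
  by rewrite /hashgraph (hashgraph_snapshot (sn q)).
- move=> q' e eq' ce; have := vi q' e eq' ce; rewrite /visible /= map_rcons -cats1.
  by rewrite flatten_cat !mem_cat => /orP[] ->; rewrite ?orbT.
Qed.

Lemma deliver_spec C i s q l : consistent C ->
  onth (msgs C) i = Some (s, q, l) ->
  exists2 m, snapshot l m & exists x',
  [/\ hd (effect C (Deliver n D i)) = upd (hd C) q x',
      absorbs q (hd C q) m x', known (hd C) m
    & consistent (effect C (Deliver n D i))].
Proof.
move=> cC oi; have [ff sn ms vi [co sC [l1 ne]]] := cC.
have mC : (s, q, l) \in msgs C by apply/onthP; exists i.
have [m sm mc] := ms _ _ _ mC; exists m => //.
have km : known (hd C) m by exists s; apply: chain_anc.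
rewrite /= oi co.
set d := env q _; set l2 := receive q d (recv C q) l.
have hE x' : snapshot l2 x' ->
    heads first_event (Config (upd (recv C) q l2) (msgs C) (signed C) (gossips C) (log C))
      = upd (hd C) q x'.
  move=> s2; apply: boolp.funext => j; rewrite /heads /= /upd.
  by case: eqP => // _; case: s2 => [[l0 ->] _]; rewrite last_rcons.
have [x' [s2 xab [l3 l3E]]] : exists x', [/\ snapshot l2 x', absorbs q (hd C q) m x'
    & exists l3, l2 = recv C q ++ l3].
  have [mq|mq] := boolP (m \in ancestors (hd C q)).
    exists (hd C q); have -> : l2 = recv C q.
      apply: receive_known => e; case: sm => _ ->; case: (sn q) => _ -> em.
      exact: anc_trans em.
    by split=> //; [split=> //; left|exists [::]; rewrite cats0].
  have [s2 ex] := receive_new d ff km (sn q) sm mq.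
  exists (Child q d (hd C q) m); split=> //; split; first by right; exists d.
  by rewrite (negbTE mq).
exists x'; split=> //; first exact: hE.
have ext : extends (hd C) (upd (hd C) q x') by apply: extends_upd xab.1.
split; rewrite ?(hE _ s2) //.
- exact: fork_free_upd xab.
- move=> j; rewrite /= /upd; case: eqP => [_|_] //.
- move=> s' q' l' /ms[x sx xc]; exists x => //; exact: chain_trans (ext _) xc.
- move=> j e ej ce; change (e \in visible C); move: ej.
  rewrite /upd; case: eqP => [E|_]; last by move/vi; apply.
  subst j; have em : e \in ancestors m -> e \in visible C.
    rewrite visibleE // => em; apply/hasP; exists (s, q, l) => //=.
    by case: sm => _ ->.
  case: xab.1 => [[_ ->]|[d' ->]]; first by move/vi; apply.
  by rewrite in_anc_child => /or3P[/eqP E|/vi|/em //]; [rewrite E eqxx in ce|apply].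
- split=> //; rewrite /= /upd; case: eqP => [E|_]; last by exists l1.
  by exists (l1 ++ l3); rewrite l3E -E ne.
Qed.

Lemma effect_recv_eq C t : consistent C ->
  recv (effect C t) = recv C -> hd (effect C t) = hd C.
Proof. by move=> _ E; apply: boolp.funext => q; rewrite /heads E. Qed.

Lemma effect_spec C t : consistent C ->
  [/\ consistent (effect C t), extends (hd C) (hd (effect C t)),
      exists l : seq (message n D), msgs (effect C t) = msgs C ++ l
    & forall q, gossips C q <= gossips (effect C t) q].
Proof.
move=> cC; have [_ _ _ _ [co _ _]] := cC.
have same : [/\ consistent C, extends (hd C) (hd C),
    exists l : seq (message n D), msgs C = msgs C ++ l & forall q, gossips C q <= gossips C q].
  by split=> //; [apply: extends_refl|exists [::]; rewrite cats0].
case: t => [q|i|e|s q l].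
- have cG := consistent_gossip q cC; split=> //.
  + by rewrite effect_recv_eq //=; [apply: extends_refl|rewrite co].
  + by rewrite /= co /=; exists [:: (q, partner (q, gossips C q), hashgraph C q)]; rewrite cats1.
  + by move=> j; rewrite /= co /= /upd; case: eqP => [->|_].
- case E : (onth (msgs C) i) => [[[s q] l]|]; last by rewrite /= E.
  have [m _ [x' [hE [jo _] _ cD]]] := deliver_spec cC E.
  split=> //; first by rewrite hE; apply: extends_upd jo.
    by rewrite /= E co; exists [::]; rewrite cats0.
  by move=> j; rewrite /= E co.
- by rewrite /= co.
- by rewrite /= co.
Qed.

Definition visible_coin C : event -> bool := fun e => (e \in visible C) && coin e.

Lemma moveE C : consistent C ->
  move adv coin C = if odd (size (log C))
    then script_move C (next_sync first_event C (visible_coin C))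
    else fair_move C (size (log C))./2.
Proof. by case=> _ _ _ _ [_ _ [l ne]]; rewrite /move /= /delaying_strategy ne. Qed.

Lemma stepE C : step C = with_log (effect C (move adv coin C)) (rcons (log C) (move adv coin C)).
Proof. by []. Qed.

Lemma step_consistent C : consistent C -> consistent (step C).
Proof.
move=> cC; rewrite stepE; apply: consistent_log.
by case: (effect_spec (move adv coin C) cC).
Qed.

Lemma fair_move_recv C k : consistent C -> recv (effect C (fair_move C k)) = recv C.
Proof.
case=> _ _ _ _ [co _ _]; rewrite /fair_move.
have none : recv (effect C (Deliver n D (size (msgs C)))) = recv C.
  by rewrite /= onth_default.
case: insubP => [q _ _|_]; first by rewrite /= co.
case: ifP => // st; move: st; rewrite /= /stale.
case: (onth _ _) => [[[s q] l]|//]; rewrite co => /allP st /=.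
by apply: boolp.funext => j; rewrite /upd; case: eqP => // ->; rewrite receive_known.
Qed.

(** [choice] is evaluated at the current heads, not at [h0]; it stays the same throughout a round
    because existing witnesses do not change ([choice_extends]). *)
Definition scripted C : Prop :=
  let R := current_round C in
  history coin (hd C) R /\
  exists2 h0, round_start a b h0 R &
    runs (take (counter (log C) %% script_length) (script (choice coin (hd C) R)))
      h0 (hd C).

(** During the opening the script does not depend on the choice. Afterwards every witness but that
    of [p] is known to a hub other than its creator, hence it has been sent and its whole past is
    visible. *)
Lemma next_sync_visible C : consistent C -> scripted C ->
  next_sync first_event C (visible_coin C) = next_sync first_event C coin.
Proof.
move=> cC [hh [h0 [ff0 r_gt0 rh0 _] run]]; rewrite /next_sync.
set pos := _ %% _; have [lt|ge] := ltnP pos (size (opening a b p)).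
  exact: script_opening.
suff -> : choice (visible_coin C) (hd C) (current_round C) =
    choice coin (hd C) (current_round C) by [].
apply: choice_local => j jp e ej.
rewrite /visible_coin; suff -> : e \in visible C by [].
have [_ _ _ vi _] := cC; apply: visible_anc cC _ ej.
have := subnKC ge; rewrite -/pos in run *; move: (pos - _) => k Ek.
have Et T (u v : seq T) : take (size u + k) (u ++ v) = u ++ take k v.
  by rewrite take_cat ltnNge leq_addr addKn.
move: run; rewrite -Ek /round_script Et => /runs_cat[h1 r1 r2].
have ext := extends_trans (runs_extends r1) (runs_extends r2).
have HW := head_witnesses rh0.
have wE : wit (hd C) (current_round C) j = wit h0 (current_round C) j.
  exact: wit_extends ext HW.
have := opening_known ab r1 HW jp; rewrite -wE => wk.

have HWC : witnesses (hd C) (current_round C) (wit (hd C) (current_round C)).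
  by case: hh => _ hW _ _; apply: hW; rewrite leqnn r_gt0.
have [ffC _ _ _] := hh.
apply: vi (anc_trans (chain_anc (runs_extends r2 _)) wk) _.
rewrite (witnesses_creator j ffC HWC).
by case: (eqVneq j a) => [->|].
Qed.

Lemma script_step C : consistent C -> scripted C -> odd (size (log C)) ->
  let: (s, q) := next_sync first_event C coin in
  [/\ s != q, move adv coin C = Gossip D s, recv (step C) = recv C,
      counter (log (step C)) = counter (log C)
    & ~~ has (fun m : message n D => (m.1.2 == q) && (m.2 == recv C s)) (msgs C)]
  \/ [/\ counter (log (step C)) = (counter (log C)).+1
       & synced s q (hd C) (hd (step C))].
Proof.
move=> cC sC od; have actE := moveE cC; rewrite od next_sync_visible // in actE.
rewrite stepE; case: (next_sync _ _ _) actE => s q; set act := move _ _ _ => actE.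
have [_ sn ms _ [co _ _]] := cC.
suff [[sq aE nohas]|[dl sy]] :
    [/\ s != q, act = Gossip D s
      & ~~ has (fun m : message n D => (m.1.2 == q) && (m.2 == recv C s)) (msgs C)]
    \/ is_deliver act /\ synced s q (hd C) (hd (effect C act)).
- left; split=> //; first by rewrite aE /= co.
  by rewrite /= counter_rcons aE /= andbF addn0.
- by right; split=> //; rewrite /= counter_rcons od dl addn1.
rewrite actE /script_move /= /hashgraph (hashgraph_snapshot (sn s)).
case: ifP => [/eqP <-|/negbT sq].
  right; split=> //.
  have -> : hd (effect C (Deliver n D (size (msgs C)))) = hd C.
    by apply: effect_recv_eq; rewrite //= onth_default.
  exists (hd C s).
    by apply: boolp.funext => j; rewrite /upd; case: eqP => [->|].
  by split=> //; left; rewrite ancestors_refl.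
rewrite -has_find; case: ifP => [hP|/negbT hP]; last by left.
right; split=> //.
set P := (fun m : message n D => _) in hP *.
case E : (onth (msgs C) (find P (msgs C))) => [[[s' q'] l]|]; last first.
  by move: hP; rewrite has_find -onthTE E.
pose msg : message n D := (s', q', l).
have : P (nth msg (msgs C) (find P (msgs C))) by apply: nth_find.
have -> : nth msg (msgs C) (find P (msgs C)) = msg by apply: onth_nth E.
rewrite /P /= => /andP[/eqP q'E /eqP lE].
subst q' l; have [m sm [x' [hE ab' _ _]]] := deliver_spec cC E.
exists x'; first exact: hE.
suff <- : m = hd C s by [].
by rewrite (hd_snapshot sm).
Qed.

Lemma heads_log C lg : hd (with_log C lg) = hd C. Proof. by []. Qed.

Lemma extends_step C : consistent C -> extends (hd C) (hd (step C)).
Proof. by move=> cC; rewrite stepE heads_log; case: (effect_spec (move adv coin C) cC). Qed.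

Lemma scripted_same C C' : scripted C -> hd C' = hd C ->
  counter (log C') = counter (log C) -> scripted C'.
Proof. by rewrite /scripted /current_round => sC -> ->. Qed.

Lemma fair_step C : consistent C -> ~~ odd (size (log C)) ->
  recv (step C) = recv C /\ counter (log (step C)) = counter (log C).
Proof.
move=> cC ev; rewrite stepE moveE // (negbTE ev) /with_log /=; split.
  exact: fair_move_recv.
by rewrite counter_rcons (negbTE ev) addn0.
Qed.

Lemma scripted_step C : consistent C -> scripted C -> scripted (step C).
Proof.
move=> cC sC; have cC' := step_consistent cC; have ext := extends_step cC.
have [od|ev] := boolP (odd (size (log C))); last first.
  have [rE cE] := fair_step cC ev; apply: scripted_same sC _ cE.
  by apply: boolp.funext => q; rewrite /heads rE.
have := script_step cC sC od; rewrite /next_sync.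
set R := current_round C; set m := counter (log C); set S := choice _ _ _.
case E : (nth _ _ _) => [s q].
case=> [[_ _ rE cE _]|[cE sy]].
  by apply: scripted_same sC _ cE; apply: boolp.funext => j; rewrite /heads rE.
have [hh [h0 st run]] := sC; have [ff' _ _ _ _] := cC'.
have hh' := history_extends ext ff' hh.
have [_ hW _ _] := hh.
have chE : choice coin (hd (step C)) R = S by apply: choice_extends ext hW.
have lt : m %% script_length < script_length by rewrite ltn_mod.
have run' : runs (take (m %% script_length).+1 (script S)) h0 (hd (step C)).
  rewrite (take_nth (a, a)) ?size_script // E; exact: runs_rcons run sy.
rewrite /scripted /current_round cE -/m divnS // modnS.
have [dv|ndv] := boolP (script_length %| m.+1); last first.
  by rewrite add0n -/(current_round C) -/R chE; split=> //; exists h0.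
have posE : (m %% script_length).+1 = script_length.
  apply/eqP; rewrite eqn_leq lt dvdn_leq //.
  by move: dv; rewrite {1}(divn_eq m script_length) -addnS dvdn_addr ?dvdn_mull.
rewrite posE -(size_script S) take_size in run'.
rewrite add1n -/(current_round C) -/R.
have [st' rf sp] := script_round n_gt ab ap bp aF pF bF st
  (split_choice_valid n_gt ap bp _) run'.
split; last first.
  by exists (hd (step C)) => //; rewrite take0.
have [ff _ rE' _] := st'; have [_ hW' hf hs] := hh'.
have HWR := head_witnesses rE'.
split=> // r.
- case/andP=> r_gt0; rewrite leq_eqVlt => /orP[/eqP ->|le]; first exact: HWR.
  by apply: hW'; rewrite r_gt0.
- case/andP=> r_gt0; rewrite ltnS leq_eqVlt => /orP[/eqP ->|le]; first by rewrite chE.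
  by apply: hf; rewrite r_gt0.
- case/andP=> r_gt0; rewrite ltnS leq_eqVlt => /orP[/eqP ->|le]; first by [].
  by apply: hs; rewrite r_gt0.
Qed.

Lemma init_scripted : scripted init.
Proof.
have [ff _ _ _ _] := init_consistent.
have hE q : hd init q = Genesis q (env q 0) by rewrite /heads /= inE.
have rE q : round (hd init q) = 1 by rewrite hE.
have HW := head_witnesses rE.
have cR : current_round init = 1 by rewrite /current_round /counter /= div0n.
rewrite /scripted cR mod0n take0; split.
  split=> // r; try lia.
  by move=> r1; have -> : r = 1 by lia.
exists (hd init) => //; split=> // q.
apply/subsetP => j /creators_fromP[z []]; rewrite hE inE => /eqP -> /= <- _.
by rewrite !inE eqxx.
Qed.

Lemma exec_invariants k :
  [/\ consistent (exec k), scripted (exec k) & size (log (exec k)) = k].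
Proof.
elim: k => [|k [c1 c2 c3]].
  by split; [exact: init_consistent|exact: init_scripted|].
have -> : exec k.+1 = step (exec k) by [].
split; [exact: step_consistent|exact: scripted_step|].
by rewrite stepE /= size_rcons c3.
Qed.

Lemma execS k : exec k.+1 = step (exec k). Proof. by []. Qed.

Lemma exec_consistent k : consistent (exec k).
Proof. by case: (exec_invariants k). Qed.

Lemma exec_scripted k : scripted (exec k).
Proof. by case: (exec_invariants k). Qed.

Lemma size_log_exec k : size (log (exec k)) = k.
Proof. by case: (exec_invariants k). Qed.

Lemma exec_extends k k' : k <= k' -> extends (hd (exec k)) (hd (exec k')).
Proof.
move/subnKC <-; elim: (k' - k) => [|i IH]; first by rewrite addn0; apply: extends_refl.
rewrite addnS execS; apply: extends_trans IH _.
exact: extends_step (exec_consistent _).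
Qed.

Lemma exec_msgs k k' : k <= k' ->
  exists l : seq (message n D), msgs (exec k') = msgs (exec k) ++ l.
Proof.
move/subnKC <-; elim: (k' - k) => [|i [l IH]]; first by exists [::]; rewrite addn0 cats0.
rewrite addnS execS stepE.
have [_ _ [l' E] _] := effect_spec (move adv coin (exec (k + i))) (exec_consistent (k + i)).
by exists (l ++ l'); rewrite /with_log; rewrite [LHS]E IH catA.
Qed.

Lemma counter_exec k k' : k <= k' -> counter (log (exec k)) <= counter (log (exec k')).
Proof.
move/subnKC <-; elim: (k' - k) => [|i IH]; first by rewrite addn0.
by apply: leq_trans IH _; rewrite addnS execS [log (step _)]/= counter_rcons leq_addr.
Qed.

Lemma exec_history k : history coin (hd (exec k)) (current_round (exec k)).
Proof. by case: (exec_scripted k). Qed.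

(** In the middle of a round the script is completed by fictitious syncs ([runs_exist]); the
    resulting heads lie above the present ones and have exactly the next round. *)
Lemma round_bound k e : known (hd (exec k)) e -> round e <= (current_round (exec k)).+1.
Proof.
case=> q eq; have [hh [h0 st run]] := exec_scripted k.
set R := current_round _ in hh st run *; set pos := _ %% _ in run.
set S := choice coin _ R in run.
have [h' run'] := runs_exist (env p 0) (drop pos (script S)) (hd (exec k)).
have full : runs (script S) h0 h'.
  by rewrite -(cat_take_drop pos (script S)); apply/runs_cat; exists (hd (exec k)).
have [[_ _ rh' _] _ _] := script_round n_gt ab ap bp aF pF bF st
  (split_choice_valid n_gt ap bp _) full.
rewrite -(rh' q); apply: round_anc; apply: anc_trans eq.
exact/chain_anc/(runs_extends run').
Qed.

(** The one property of the partners on which liveness rests; it holds almost surely, and the rest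
    of the argument for fairness is deterministic. *)
Definition hitting : Prop :=
  forall s q, s != q -> forall g, exists2 i, g <= i & partner (s, i) = q.

Lemma gossip_step C s : gossips (step C) s != gossips C s ->
  gossips (step C) s = (gossips C s).+1 /\
  msgs (step C) = rcons (msgs C) (s, partner (s, gossips C s), hashgraph C s).
Proof.
rewrite stepE; case: (move adv coin C) => [q|i|e|s' q' l'] /=.
- case: ifP => _ /=; first by rewrite eqxx.
  by rewrite /upd; have [->|_] := eqVneq s q; [split|rewrite eqxx].
- by case: onth => [[[s' q] l]|] /=; rewrite ?eqxx //; case: ifP => _ /=; rewrite eqxx.
- by case: ifP => _ /=; rewrite eqxx.
- by case: ifP => _ /=; rewrite eqxx.
Qed.

Lemma progress k : hitting -> exists k', counter (log (exec k)) < counter (log (exec k')).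
Proof.
move=> hit; apply: boolp.contrapT => stuck.
have cE k' : k <= k' -> counter (log (exec k')) = counter (log (exec k)).
  move=> kk'; apply/eqP; rewrite eqn_leq (counter_exec kk') andbT leqNgt.
  by apply/negP => lt; apply: stuck; exists k'.
have blocked k' : k <= k' -> odd k' ->
  let: (s, q) := next_sync first_event (exec k') coin in
  [/\ s != q, move adv coin (exec k') = Gossip D s, recv (exec k'.+1) = recv (exec k')
    & ~~ has (fun m : message n D => (m.1.2 == q) && (m.2 == recv (exec k') s))
         (msgs (exec k'))].
  move=> kk' od; have := script_step (exec_consistent k') (exec_scripted k').
  rewrite size_log_exec => /(_ od); case: (next_sync _ _ _) => s q.
  case=> [[? ? ? _ ?]|[]]; first by [].
  by rewrite -execS !cE ?leqW // => /eqP; rewrite -[_ == _]negbK neq_ltn ltnSn.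
have rE k' : k <= k' -> recv (exec k') = recv (exec k).
  move/subnKC <-; elim: (k' - k) => [|i IH]; first by rewrite addn0.
  rewrite addnS; have [od|ev] := boolP (odd (k + i)).
    by have := blocked _ (leq_addr i k) od; case: next_sync => s q [_ _ -> _].
  rewrite execS; have [|-> _ //] := @fair_step (exec (k + i)) (exec_consistent _).
  by rewrite size_log_exec.
have hE k' : k <= k' -> hd (exec k') = hd (exec k).
  by move=> /rE rk; apply: boolp.funext => q; rewrite /heads rk.
have nE k' : k <= k' ->
    next_sync first_event (exec k') coin = next_sync first_event (exec k) coin.
  by move=> kk'; rewrite /next_sync /current_round cE // hE.
case E : (next_sync first_event (exec k) coin) => [s q].
have {}blocked k' : k <= k' -> odd k' ->
  [/\ s != q, move adv coin (exec k') = Gossip D s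
    & ~~ has (fun m : message n D => (m.1.2 == q) && (m.2 == recv (exec k) s))
         (msgs (exec k'))].
  move=> kk' od; have := blocked _ kk' od; rewrite (nE k' kk') E => -[sq mE _ nh].
  by rewrite (rE k' kk') in nh.
have odd_after j : k <= j -> exists2 k', odd k' & k <= k' /\ j <= k'.
  move=> kj; have [od|ev] := boolP (odd j); first by exists j.
  by exists j.+1; [rewrite /= ev|split; [exact: leqW|]].
have sq : s != q.
  by have [k' od [kk' _]] := odd_after k (leqnn k); have [] := blocked k' kk' od.
have [i gi pi] := hit s q sq (gossips (exec k) s).
have grow (v : nat) : exists2 j, k <= j & v <= gossips (exec j) s.
  elim: v => [|v [j kj xj]]; first by exists k.
  have [k' od [kk' jk']] := odd_after j kj.
  exists k'.+1; first exact: leqW.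
  have [_ mE _] := blocked _ kk' od.
  have co t : t \in corrupted adv = false by rewrite inE.
  rewrite execS stepE mE /= co /= /upd eqxx ltnS.
  apply: leq_trans xj _; move/subnKC: jk' => <-.
  elim: (k' - j) => [|u IH]; first by rewrite addn0.
  rewrite addnS execS stepE; apply: leq_trans IH _.
  by case: (effect_spec (move adv coin (exec (j + u))) (exec_consistent (j + u))).
(* Gossip counts grow one at a time, so the first step that lifts the count above [i] is the very
   step that uses draw [i]; it may be a script move or a fairness move. *)
have ex : exists j, i < gossips (exec (k + j)) s.
  by have [j kj ij] := grow i.+1; exists (j - k); rewrite subnKC.
case: (ex_minnP ex) => -[|j] ij minj; first by rewrite addn0 ltnNge gi in ij.
have ji : gossips (exec (k + j)) s <= i.
  by rewrite leqNgt; apply/negP => /minj; rewrite ltnn.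
rewrite addnS execS in ij.
have /gossip_step[gE mE] : gossips (step (exec (k + j))) s != gossips (exec (k + j)) s.
  by rewrite neq_ltn (leq_ltn_trans ji ij) orbT.
have gi' : gossips (exec (k + j)) s = i.
  by apply/eqP; rewrite eqn_leq ji -ltnS -gE.
rewrite gi' pi -execS in mE.
have [k' od [kk' jk']] := odd_after (k + j).+1 (leqW (leq_addr _ _)).
have [_ _ /negP] := blocked _ kk' od; apply.
have [l ->] := exec_msgs jk'; rewrite has_cat; apply/orP; left.
apply/hasP; exists (s, q, hashgraph (exec (k + j)) s); first by rewrite mE mem_rcons inE eqxx.
rewrite /= eqxx /hashgraph rE ?leq_addr //.
have [_ sn _ _ _] := exec_consistent k.
by rewrite (hashgraph_snapshot (sn s)) /= eqxx.
Qed.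

Lemma counter_unbounded (m : nat) : hitting -> exists k, m <= counter (log (exec k)).
Proof.
move=> hit; elim: m => [|m [k mk]]; first by exists 0.
by have [k' kk'] := progress k hit; exists k'; apply: leq_ltn_trans kk'.
Qed.

Lemma rounds_unbounded R k : hitting ->
  exists2 k', k <= k' & R <= current_round (exec k').
Proof.
move=> hit; have [k' mk] := counter_unbounded (R * script_length) hit.
exists (maxn k k'); first exact: leq_maxl.
rewrite /current_round leqW // leq_divRL //.
exact: leq_trans mk (counter_exec (leq_maxr _ _)).
Qed.

Lemma has_witness : hitting ->
  exists x, is_round_witness_of env adv coin partner p r0 x.
Proof.
move=> hit; have [k _ rk] := rounds_unbounded r0 0 hit.
have [ff hW _ _] := exec_history k.
have HW : witnesses (hd (exec k)) r0 (wit (hd (exec k)) r0).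
  by apply: hW; rewrite r0_gt0.
exists (wit (hd (exec k)) r0 p); have [Wc ww rw] := HW p.
split=> //; last exact: witnesses_creator HW.
exists k; have [_ sn _ _ _] := exec_consistent k; have [_ ->] := sn p.
exact: chain_anc.
Qed.

Lemma covered k k' s r : k <= k' -> round (hd (exec k) s) < r ->
  r <= current_round (exec k') ->
  hd (exec k) s \in ancestors (wit (hd (exec k')) r s).
Proof.
move=> kk' rs rk; have [_ hW _ _] := exec_history k'.
have r_gt0 : 0 < r by apply: leq_ltn_trans rs.
have [|Wc _ rw] := hW r _ s; first by rewrite r_gt0.
apply/chain_anc/(chain_round_lt _ Wc); first exact: exec_extends.
by rewrite rw.
Qed.

(** With [R] the current round, the head has round at most [R.+1]. It therefore lies below the
    witness of [s] in round [R.+2], which [spread] brings to everybody by the end of that round. *)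
Lemma head_spread_but_p k s : hitting -> s != p ->
  exists k', forall q, hd (exec k) s \in ancestors (hd (exec k') q).
Proof.
move=> hit sp; have rs := round_bound (known_head (hd (exec k)) s).
have [k' kk' rk'] := rounds_unbounded (current_round (exec k)).+3 k hit.
exists k' => q; have [_ _ _ hs] := exec_history k'.
have [|spr _] := hs (current_round (exec k)).+2; first by rewrite rk'.
apply: anc_trans (spr q s sp) _; apply: covered => //; exact: ltnW.
Qed.

(** For [p] a detour is made: its witness is spread to [a], and then the head of [a] to
    everybody. *)
Lemma head_spread k s : hitting ->
  exists k', forall q, hd (exec k) s \in ancestors (hd (exec k') q).
Proof.
move=> hit; have [->|sp] := eqVneq s p; last exact: head_spread_but_p.
have rs := round_bound (known_head (hd (exec k)) p).
have [k1 kk1 rk1] := rounds_unbounded (current_round (exec k)).+3 k hit.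
have [_ _ _ hs] := exec_history k1.
have [|_ spr] := hs (current_round (exec k)).+2; first by rewrite rk1.
have [k' spr'] := head_spread_but_p k1 hit ap; exists k' => q.
apply: anc_trans (spr' q) (anc_trans spr _); apply: covered => //; exact: ltnW.
Qed.

Lemma fair_times u k : exists2 j, k <= j & ~~ odd j /\ logn 2 j./2 = u.
Proof.
(* Half of this is [2 ^ u] times an odd number; the factor depending on [k] makes the time late
   enough. *)
exists (2 ^ u * k.*2.+1).*2; last first.
  rewrite odd_double doubleK; split=> //.
  rewrite lognM ?expn_gt0 // pfactorK // lognE /= dvdn2 /= odd_double /=.
  by rewrite addn0.
have h1 : 0 < 2 ^ u by rewrite expn_gt0.
by rewrite -addnn -addnn; nia.
Qed.

Lemma run_fair : hitting -> fair_run env adv coin partner.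
Proof.
move=> hit; split.
  move=> q _ k; have [j kj [ev lg]] := fair_times q k; exists j => //.
  rewrite (moveE (exec_consistent j)) size_log_exec (negbTE ev) /fair_move lg.
  by rewrite insubT //= => lt; congr Gossip; apply: val_inj.
move=> k i lt; case E : (onth (msgs (exec k)) i) => [[[s q] l]|]; last first.
  by move: lt; rewrite -onthTE E.
have [_ _ ms _ _] := exec_consistent k.
have [|x sx xc] := ms s q l; first by apply/onthP; exists i.
have [k' spr] := head_spread k s hit.
have [j kj [ev lg]] := fair_times (n + i) (maxn k k').
move: kj; rewrite geq_max => /andP[kj k'j]; exists j => //.
rewrite (moveE (exec_consistent j)) size_log_exec (negbTE ev) /fair_move lg.
rewrite insubF; last by rewrite ltnNge leq_addr.
rewrite addKn; suff -> : stale (exec j) i by [].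
have [l' mE] := exec_msgs kj.
rewrite /stale mE onth_cat lt E; apply/allP => e el.
have [_ sn _ _ _] := exec_consistent j; have [_ ->] := sn q.
apply: anc_trans (chain_anc (exec_extends k'j q)) (anc_trans (spr q) _).
by apply: anc_trans (chain_anc xc) _; case: sx => _ <-.
Qed.

Definition unbalanced_round (r k : nat) : Prop :=
  r <= current_round (exec k) /\ ~~ balanced [set j | coin (wit (hd (exec k)) r j)].

(** The conclusion is about all late steps because the cover by cylinders is made for one step at a
    time; a bound uniform in the step then passes to the limit inferior. *)
Lemma decision_unbalanced x d T :
  is_round_witness_of env adv coin partner p r0 x ->
  decided_after env adv coin partner c x d -> d < T ->
  exists k, forall k', k <= k' -> exists2 e, e < T & unbalanced_round (r0 + e) k'.
Proof.
case=> [[k1 xk1] cx wx rx] [k2 [q [y [_ _ yk2 dec dE]]]] dT.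
exists (maxn k1 k2) => k; rewrite geq_max => /andP[k1k k2k].
apply: boolp.contrapT => nu; have hh := exec_history k.
have kx : known (hd (exec k)) x.
  exists p; have [_ sn _ _ _] := exec_consistent k1; have [_ E] := sn p.
  by rewrite E in xk1; apply: anc_trans (chain_anc (exec_extends k1k p)) xk1.
have ky : known (hd (exec k)) y.
  exists q; have [_ sn _ _ _] := exec_consistent k2; have [_ E] := sn q.
  rewrite /hashgraph (hashgraph_snapshot (sn q)) E in yk2.
  exact: anc_trans (chain_anc (exec_extends k2k q)) yk2.
have ry := round_bound ky.
have d_gt1 : 1 < d by move: dec; rewrite /decides /= dE => /and4P[].
rewrite rx in dE.
have dR : r0 + d.-1 <= current_round (exec k) by move: dE d_gt1 ry; clear; lia.
suff : ~~ decides coin c x y by rewrite dec.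
apply: (@undecided _ _ a b p F n_gt ab ap bp aF pF bF cF c r0 coin c_gt1 r0_gt0
  (hd (exec k)) (r0 + d.-1)) => //.
- exact: history_le hh.
- move=> e e_gt1 ce ed; apply: boolp.contrapT => ub; apply: nu.
  exists e; first by move: ed dT d_gt1; clear; lia.
  by split; [exact: leq_trans dR|apply/negP].
- by move: dE d_gt1; clear; lia.
Qed.

End Run.

(** * What the witnesses of a round depend on *)

Section Agreement.
Variable env : 'I_n -> nat -> D.
Local Notation adv := delaying_adversary.
Local Notation exec := (exec env adv).
Let first_event := Genesis p (env p 0).
Local Notation hd := (heads first_event).

(* A finite set containing all events of the first [k] steps of all runs. *)
Fixpoint possible (k : nat) : seq event :=
  if k is k'.+1 then
    possible k' ++
    [seq Child qs.1 (env qs.1 k) qs.2 o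
       | qs <- [seq (q, s) | q <- enum 'I_n, s <- possible k'], o <- possible k']
  else [seq Genesis q (env q 0) | q <- enum 'I_n].

Lemma latest_mem (P : pred event) l s : latest P l = Some s -> s \in l.
Proof.
rewrite /latest => E; have : s \in rev [seq e <- l | P e].
  by case: (rev _) E => //= e l' [->]; rewrite inE eqxx.
by rewrite mem_rev mem_filter => /andP[].
Qed.

Lemma receive_mem q d l l' e : e \in receive q d l l' ->
  [\/ e \in l, e \in l'
    | exists s o, [/\ s \in l ++ l', o \in l' & e = Child q d s o]].
Proof.
rewrite /receive; set new := [seq _ <- _ | _].
have sub z : z \in l ++ new -> z \in l ++ l'.
  by rewrite !mem_cat mem_filter mem_undup => /orP[->//|/andP[_ ->]]; rewrite orbT.
have old : e \in l ++ new -> [\/ e \in l, e \in l'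
    | exists s o, [/\ s \in l ++ l', o \in l' & e = Child q d s o]].
  by move/sub; rewrite mem_cat => /orP[?|?]; [constructor 1|constructor 2].
case: ifP => _ //; case E1 : (latest _ _) => [s|] //; case E2 : (latest _ _) => [o|] //.
rewrite mem_rcons inE => /orP[/eqP ->|]; last exact: old.
constructor 3; exists s, o; split=> //; first exact: sub (latest_mem E1).
exact: latest_mem E2.
Qed.

Variables (coin : event -> bool) (partner : 'I_n * nat -> 'I_n).

Lemma possible_exec k :
  (forall q, {subset recv (exec coin partner k) q <= possible k}) /\
  (forall m : message n D, m \in msgs (exec coin partner k) -> {subset m.2 <= possible k}).
Proof.
elim: k => [|k [IHr IHm]].
  have gp q : Genesis q (env q 0) \in possible 0 by apply: map_f; rewrite mem_enum.
  split=> [q e|m /mapP[[s q] _ ->] e] /=; last by rewrite inE => /eqP ->; apply: gp.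
  by rewrite in_set0 inE => /eqP ->; apply: gp.
have szl := size_log_exec env coin partner k.
have [_ _ _ _ [co _ _]] :=
  exec_consistent env coin partner k.
have old : {subset possible k <= possible k.+1}.
  by move=> e ek; rewrite /= mem_cat ek.
rewrite execS stepE; set C := exec coin partner k in IHr IHm szl *.
have same : (forall q, {subset recv C q <= possible k.+1}) /\
    (forall m : message n D, m \in msgs C -> {subset m.2 <= possible k.+1}).
  by split=> [q e /IHr /old //|m /IHm mk e /mk /old].
case: (move adv coin C) => [q|i|e|s' q' l'] /=.
- rewrite co /=; split; first by case: same.
  move=> m; rewrite mem_rcons inE => /orP[/eqP -> e|]; last by case: same => _; apply.
  by rewrite /= /hashgraph mem_filter => /andP[_]; case: same => h _; apply: h.
- case E : (onth _ _) => [[[s q] l]|] //; rewrite co /=; split; last by case: same.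
  move=> j e; rewrite /upd; case: eqP => [_|_]; last by case: same => h _; apply: h.
  have lk : {subset l <= possible k} by apply: (IHm (s, q, l)); apply/onthP; exists i.
  case/receive_mem=> [/IHr/old //|/lk/old //|[s1 [o1 [s1m o1m ->]]]].
  rewrite szl -/(possible k.+1) /= mem_cat; apply/orP; right.
  apply/allpairsP; exists ((q, s1), o1); split=> //=; last exact: lk.
  apply/allpairsP; exists (q, s1); split; rewrite ?mem_enum //=.
  by move: s1m; rewrite mem_cat => /orP[/IHr|/lk].
- by rewrite co.
- by rewrite co.
Qed.

Lemma possible_visible k : {subset visible (exec coin partner k) <= possible k}.
Proof.
move=> e; rewrite (visibleE _ (exec_consistent env coin partner k)) => /hasP[m mC em].
by have [_ /(_ m mC)] := possible_exec k; apply.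
Qed.

Lemma possible_le k k' : k <= k' -> {subset possible k <= possible k'}.
Proof.
move/subnKC <-; elim: (k' - k) => [|i IH] e ek; first by rewrite addn0.
by rewrite addnS /= mem_cat IH.
Qed.

Lemma gossips_le k q : gossips (exec coin partner k) q <= k.
Proof.
elim: k => [//|k IH].
have [->|/eqP ne] := (gossips (exec coin partner k.+1) q =P gossips (exec coin partner k) q).
  exact: leqW.
by have [] := gossip_step ne => -> _.
Qed.

Variables (coin' : event -> bool) (partner' : 'I_n * nat -> 'I_n) (r k : nat).
Hypothesis coinE : forall e, e \in possible k -> round e < r -> coin e = coin' e.
Hypothesis partnerE : forall q i, i < k -> partner (q, i) = partner' (q, i).

(** Until the script of round [r] starts, which is when the counter reaches [r.-1 * script_length],
    the strategy uses only coins below witnesses of rounds less than [r]; and within [k] steps only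
    partners of index below [k] are drawn. *)
Lemma exec_agree k0 : k0 <= k ->
  (forall j, j < k0 -> counter (log (exec coin partner j)) < r.-1 * script_length) ->
  exec coin partner k0 = exec coin' partner' k0.
Proof.
elim: k0 => [//|k0 IH] le lt; have {}IH := IH (ltnW le) (fun j jk => lt j (leqW jk)).
have cC := exec_consistent env coin partner k0.
have [_ hW _ _] := exec_history env coin partner k0.
rewrite !execS -IH !stepE; set C := exec coin partner k0 in cC hW *.
have Rr : current_round C < r.
  have := lt k0 (ltnSn _); rewrite -/C -(ltn_divLR _ _ script_length_gt0).
  by rewrite /current_round; case: (r).
have mE : move adv coin C = move adv coin' C.
  rewrite (@moveE env coin C cC) (@moveE env coin' C cC).
  suff E : choice (visible_coin coin C) (hd C) (current_round C) =
      choice (visible_coin coin' C) (hd C) (current_round C).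
    by rewrite [next_sync _ _ (visible_coin coin C)]/next_sync E.
  apply: choice_local => j _ e ej; rewrite /visible_coin.
  have [ev /=|//] := boolP (e \in visible C); apply: coinE.
    exact: possible_le (ltnW le) _ (possible_visible ev).
  have [|_ _ rw] := hW (current_round C) _ j; first by rewrite leqnn.
  by apply: leq_ltn_trans (round_anc ej) _; rewrite rw.
rewrite -mE; suff -> : effect env adv partner C (move adv coin C) =
  effect env adv partner' C (move adv coin C) by [].
have gC q : gossips C q < k := leq_ltn_trans (gossips_le k0 q) le.
move: (move adv coin C) => t; clear - partnerE gC.
by case: t => [q|i|e|s q l] //=; rewrite (partnerE _ (gC q)).
Qed.

(** The round-[r] witnesses all exist as soon as the script of round [r] starts. Up to the first
    such step the two runs coincide; afterwards they may diverge, but witnesses never change. *)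
Lemma wit_agree : 0 < r -> r <= current_round (exec coin partner k) ->
  [/\ r <= current_round (exec coin' partner' k),
      witnesses (hd (exec coin partner k)) r (wit (hd (exec coin partner k)) r)
    & wit (hd (exec coin partner k)) r =1 wit (hd (exec coin' partner' k)) r].
Proof.
move=> r_gt0 rk; set M := script_length.
have ex : exists k0, r.-1 * M <= counter (log (exec coin partner k0)).
  by exists k; rewrite -(leq_divRL _ _ script_length_gt0) -ltnS (prednK r_gt0).
case: (ex_minnP ex) => k0 rk0 mink0.
have le : k0 <= k by apply: mink0; rewrite -(leq_divRL _ _ script_length_gt0) -ltnS (prednK r_gt0).
have E : exec coin partner k0 = exec coin' partner' k0.
  by apply: exec_agree => // j jk; rewrite ltnNge; apply/negP => /mink0; rewrite leqNgt jk.
have hist c1 p1 k1 :=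
  exec_history env c1 p1 k1.
have ext c1 p1 := exec_extends env c1 p1 le.
have HW : witnesses (hd (exec coin partner k0)) r (wit (hd (exec coin partner k0)) r).
  have [_ hW _ _] := hist coin partner k0; apply: hW.
  by rewrite r_gt0 /current_round -(prednK r_gt0) ltnS (leq_divRL _ _ script_length_gt0).
split.
- rewrite /current_round -(prednK r_gt0) ltnS (leq_divRL _ _ script_length_gt0).
  by apply: leq_trans rk0 _; rewrite E; apply: counter_exec.
- by have [_ hW _ _] := hist coin partner k; apply: hW; rewrite r_gt0.
- move=> j; transitivity (wit (hd (exec coin partner k0)) r j).
    exact: wit_extends (ext coin partner) HW.
  move: HW; rewrite E => HW; symmetry; exact: wit_extends (ext coin' partner') HW.
Qed.

End Agreement.
End Strategy.

(** * Probability of an early decision *)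

Section Counting.
Local Open Scope nat_scope.

(** This fixes the rate 1/32: there are at most 3^n / 2^(5n/8) small sets, and 3 times 2^(1/32) is
    at most 2^(52/32) = 2^(1 + 5/8). *)
Lemma three_two_power : 3 ^ 32 * 2 <= 2 ^ 52.
Proof. by lia. Qed.

Variable n : nat.

Lemma sum_sets_by_card (g : nat -> nat) :
  \sum_(A : {set 'I_n}) g #|A| = \sum_(k < n.+1) 'C(n, k) * g k.
Proof.
have lt (A : {set 'I_n}) : #|A| < n.+1 by rewrite ltnS -[X in _ <= X]card_ord max_card.
rewrite (partition_big (fun A : {set 'I_n} => Ordinal (lt A)) xpredT) //=.
apply: eq_bigr => k _; rewrite (eq_bigr (fun=> g k)); last first.
  by move=> A /eqP <-.
rewrite sum_nat_const; congr (_ * _).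
rewrite -[X in 'C(X, _)](card_ord n) -card_draws; apply: eq_card => A.
by rewrite !inE unfold_in.
Qed.

Lemma sum_sets_pow2 : \sum_(A : {set 'I_n}) 2 ^ (n - #|A|) = 3 ^ n.
Proof.
rewrite (sum_sets_by_card (fun k => 2 ^ (n - k))) -[3]/(2 + 1) expnDn.
by apply: eq_bigr => k _; rewrite exp1n muln1.
Qed.

(** A Chernoff bound with weight 2^(n - |A|): the weights of all sets sum to 3^n, and each small set
    has weight at least 2^(n - h). *)
Lemma few_small_sets :
  #|[pred A : {set 'I_n} | 8 * #|A| < 3 * n]| * 2 ^ (n %/ 32) <= 2 ^ n.
Proof.
set low := #|_|; pose h := (3 * n) %/ 8.
have hn : h <= n by rewrite /h; lia.
have lowE : low * 2 ^ (n - h) <= 3 ^ n.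
  rewrite -sum_sets_pow2 -sum_nat_const.
  apply: leq_trans (_ : _ <= \sum_(A | 8 * #|A : {set 'I_n}| < 3 * n) 2 ^ (n - #|A|)) _.
    apply: leq_sum => A lowA; rewrite leq_exp2l // leq_sub2l // /h leq_divRL //.
    by rewrite mulnC ltnW.
  by rewrite [leqRHS](bigID (fun A : {set 'I_n} => 8 * #|A| < 3 * n)) leq_addr.
have mono x y m : x <= y -> x ^ m <= y ^ m.
  by case: m => // m; rewrite leq_exp2r.
have three : 3 ^ n * 2 ^ (n %/ 32) <= 2 ^ (n + (n - h)).
  rewrite -(@leq_exp2r _ _ 32) // expnMn -!expnM.
  apply: leq_trans (_ : (3 ^ 32 * 2) ^ n <= _).
    by rewrite expnMn -expnM [32 * n]mulnC leq_mul2l leq_exp2l // leq_trunc_div orbT.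
  apply: leq_trans (_ : (2 ^ 52) ^ n <= _).
    exact: mono three_two_power.
  by rewrite -expnM leq_exp2l // /h; lia.
rewrite -(@leq_pmul2r (2 ^ (n - h))) ?expn_gt0 // -expnD.
apply: leq_trans three; rewrite mulnAC; exact: leq_mul.
Qed.

(** Complementation exchanges the two ways of being unbalanced, at the cost of a factor 2. *)
Lemma few_unbalanced :
  #|[pred A : {set 'I_n} | ~~ balanced A]| * 2 ^ (n %/ 32) <= 2 ^ n.+1.
Proof.
set low := #|[pred A : {set 'I_n} | 8 * #|A| < 3 * n]|.
suff : #|[pred A : {set 'I_n} | ~~ balanced A]| <= low + low.
  move=> le; apply: leq_trans (leq_mul le (leqnn _)) _.
  by rewrite addnn -mul2n expnS -mulnA leq_mul2l few_small_sets.
have -> : low + low = low + #|[pred A : {set 'I_n} | 8 * #|~: A| < 3 * n]|.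
  congr (_ + _); rewrite /low -!sum1_card (reindex_inj (@setC_inj _)) /=.
  by apply: eq_bigl => A; rewrite !inE.
rewrite /low -cardUI; apply: leq_trans (leq_addr _ _).
apply/subset_leq_card/subsetP => A.
rewrite !inE /balanced negb_and -!ltnNge => /orP[->//|lt]; apply/orP; right.
rewrite cardsCs setCK card_ord.
have : #|A| <= n by rewrite -[X in _ <= X]card_ord max_card.
by move: (#|A|) lt => x; clear; lia.
Qed.

End Counting.

From mathcomp Require Import all_classical all_reals all_analysis.
From mathcomp Require Import ring.
Import Order.TTheory GRing.Theory Num.Theory numFieldNormedType.Exports.

(** * Bounds for measures and integrals *)

Section Measure.
Local Open Scope classical_set_scope.
Local Open Scope ring_scope.
Local Open Scope ereal_scope.
Context {R : realType} {d : measure_display} {T : measurableType d}.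
Variable P : probability T R.

(** Valid for arbitrary nonnegative [f]: the integral is a supremum over the simple functions below
    [f], hence monotone in any case. The number of rounds to a decision can thus be integrated
    without a proof that it is measurable. *)
Lemma integral_ge_cst (f : T -> \bar R) (A : set T) (x : R) :
  measurable A -> (0 <= x)%R -> (forall w, 0 <= f w) ->
  (forall w, A w -> x%:E <= f w) -> x%:E * P A <= \int[P]_w f w.
Proof.
move=> mA x0 f0 fA; rewrite -(@integral_cst _ _ _ P A mA x%:E) integral_mkcond.
have g0 w : 0 <= (cst x%:E \_ A) w.
  by rewrite patchE; case: ifP => // _; rewrite lee_fin.
rewrite !ge0_integralTE //; apply: le_ereal_sup => _ [h hg <-]; exists h => //= w.
apply: le_trans (hg w) _; rewrite patchE; case: ifPn => // /set_mem; exact: fA.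
Qed.

Lemma measure_bigsetU_le (I : eqType) (s : seq I) (X : I -> set T) (x : R) :
  (forall i, measurable (X i)) -> (forall i, i \in s -> P (X i) <= x%:E) ->
  P (\big[setU/set0]_(i <- s) X i) <= (x *+ size s)%:E.
Proof.
move=> mX; elim: s => [|i s IH] Xx; first by rewrite big_nil measure0.
rewrite big_cons (le_trans (measureU2 _ _ _)) //; first exact: bigsetU_measurable.
rewrite /= mulrS EFinD leeD //; first by apply: Xx; rewrite inE eqxx.
by apply: IH => j js; apply: Xx; rewrite inE js orbT.
Qed.

Lemma measure_liminf_le (Z : nat -> set T) (x : R) :
  (forall k, measurable (Z k)) -> (forall k, P (Z k) <= x%:E) ->
  measurable (\bigcup_k \bigcap_(j in [set j | (k <= j)%N]) Z j) /\
  P (\bigcup_k \bigcap_(j in [set j | (k <= j)%N]) Z j) <= x%:E.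
Proof.
move=> mZ Zx; set Y := fun k => \bigcap_(j in [set j | (k <= j)%N]) Z j.
have mY k : measurable (Y k) by apply: bigcap_measurable => //; exists k => /=.
have mU : measurable (\bigcup_k Y k) by apply: bigcup_measurable.
split=> //; have ndY : nondecreasing_seq Y.
  move=> i j ij; apply/subsetPset => w Yw l /= jl; apply: Yw.
  exact: leq_trans jl.
have cY := nondecreasing_cvg_mu (mu := P) mY mU ndY.
rewrite -(cvg_lim _ cY) //; apply: lime_le; first by apply/cvg_ex; eexists; exact: cY.
apply: nearW => k; apply: le_trans (Zx k); apply: le_measure; rewrite ?inE //.
by move=> w Yw; apply: Yw => /=.
Qed.

End Measure.

(** * Events given by finitely many coins and partner draws *)

Section Cylinders.
Local Open Scope classical_set_scope.
Local Open Scope ring_scope.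
Local Open Scope ereal_scope.
Context {R : realType} {d : measure_display} {T : measurableType d}.
Variables (P : probability T R) (n : nat) (D : choiceType).
Local Notation event := (event n D).
Variables (coin : event -> T -> bool) (partner : 'I_n * nat -> T -> 'I_n).
Hypothesis iid : iid_uniform P coin partner.
Hypothesis n_gt2 : (2 < n)%N.

Definition cylinder (E : seq event) (b : event -> bool) (I : seq ('I_n * nat))
    (q : 'I_n * nat -> 'I_n) : set T :=
  [set w | (forall e, e \in E -> coin e w = b e) /\
           (forall i, i \in I -> partner i w = q i)].

Lemma cylinder_measurable E b I q : measurable (cylinder E b I q).
Proof.
have [mc mp _] := iid.
have -> : cylinder E b I q =
    (\big[setI/setT]_(e <- E) [set w | coin e w = b e]) `&`
    (\big[setI/setT]_(i <- I) [set w | partner i w = q i]).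
  apply/seteqP; split => w /=.
    move=> [cE pI]; split.
      by rewrite -bigcap_seq => e /= /cE.
    by rewrite -bigcap_seq => e /= /pI.
  by rewrite -!bigcap_seq => -[h1 h2]; split=> i; [exact: h1|exact: h2].
apply: measurableI; apply: bigsetI_measurable => i _; last exact: mp.
case: (b i); first exact: mc.
rewrite (_ : mkset _ = ~` [set w | coin i w]); first exact/measurableC/mc.
by apply/seteqP; split=> w /=; [move=> ->|move/negP/negbTE].
Qed.

(** [iid_uniform] fixes only the probabilities of the [n.-1] other parties, but these already sum to
    one. *)
Lemma partner_neq_null i : P [set w | partner i w = i.1] = 0.
Proof.
have [mc mp iidE] := iid.
have PE q : q != i.1 -> P [set w | partner i w = q] = ((n.-1%:R)^-1)%:E.
  move=> qi; have := iidE [::] [:: i] (fun=> true) (fun=> q) isT isT.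
  rewrite expr0 mul1r expr1 => <-.
    congr (P _); apply/seteqP; split=> w /=.
      by move=> pq; split=> // j; rewrite inE => /eqP ->.
    by case=> _; apply; rewrite inE.
  by move=> j; rewrite inE => /eqP ->.
have tr : trivIset [set: 'I_n] (fun q => [set w | partner i w = q]).
  by apply/trivIsetP => q q' _ _ qq'; apply/seteqP; split=> // w [/= ->] /eqP; rewrite (negbTE qq').
have := measure_bigsetU_ord P (fun q => q != i.1) (fun q => mp i q) tr.
rewrite (eq_bigr (fun=> ((n.-1%:R)^-1)%:E)) //.
rewrite sumEFin sumr_const.
have -> : #|[pred q : 'I_n | q != i.1]| = n.-1.
  by rewrite cardC1 card_ord.
have n1 : (n.-1%:R != 0 :> R)%R by rewrite pnatr_eq0; case: (n) n_gt2 => [|[]].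
have -> : ((n.-1%:R)^-1 *+ n.-1 = 1 :> R)%R by rewrite -[LHS]mulr_natr mulVf.
move=> E1.
have -> : [set w | partner i w = i.1] =
    ~` (\big[setU/set0]_(q < n | q != i.1) [set w | partner i w = q]).
  rewrite -bigcup_seq_cond; apply/seteqP; split=> w /=.
    by move=> pw [q /= /andP[_ qi] pq]; move: qi; rewrite -pq pw eqxx.
  move=> nw; apply: contrapT => pw; apply: nw; exists (partner i w) => //=.
  by rewrite mem_index_enum; apply/eqP.
rewrite probability_setC; first by rewrite [X in 1 - X]E1 subee.
by apply: bigsetU_measurable => q _; apply: mp.
Qed.

(** A union bound over cylinders of equal probability. The list of fixed coins varies with the
    index, as random witnesses require. Draws in which a party picks itself fall outside the product
    formula and are put into a null set. *)
Lemma cylinder_cover (J : choiceType) (s : seq J) (E : J -> seq event)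
    (b : J -> event -> bool) (I : seq ('I_n * nat)) (q : J -> 'I_n * nat -> 'I_n) m :
  uniq I ->
  (forall j, j \in s ->
     [/\ uniq (E j), size (E j) = m & {in I, forall i, q j i != i.1}]) ->
  exists Z : set T,
  [/\ measurable Z,
      P Z <= (((2%:R^-1) ^+ m * (n.-1%:R^-1) ^+ size I) *+ size s)%:E
    & forall w, (exists2 i, i \in I & partner i w = i.1) \/
        (exists2 j, j \in s & cylinder (E j) (b j) I (q j) w) -> Z w].
Proof.
move=> uI sP; have [mc mp iidE] := iid.
pose X j := cylinder (E j) (b j) I (q j).
pose Z1 := \big[setU/set0]_(i <- I) [set w | partner i w = i.1].
pose Z2 := \big[setU/set0]_(j <- s) X j.
have mZ1 : measurable Z1 by apply: bigsetU_measurable => i _; apply: mp.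
have mZ2 : measurable Z2 by apply: bigsetU_measurable => i _; apply: cylinder_measurable.
exists (Z1 `|` Z2); split.
- exact: measurableU.
- apply: le_trans (measureU2 _ mZ1 mZ2) _.
  rewrite -[leRHS]add0e; apply: leeD.
    have := @measure_bigsetU_le _ _ _ P _ I (fun i => [set w | partner i w = i.1]) 0%R.
    by rewrite mul0rn; apply=> [i|i _]; [apply: mp|rewrite partner_neq_null].
  apply: (@measure_bigsetU_le _ _ _ P _ s X) => [j|j js].
    exact: cylinder_measurable.
  by have [uE <- qI] := sP j js; rewrite /X /cylinder iidE.
- move=> w [[i iI wi]|[j js wj]]; [left|right].
    by rewrite /Z1 -bigcup_seq; exists i.
  by rewrite /Z2 -bigcup_seq; exists j.
Qed.

(** For every [m], the first [m] draws from [g] on avoid [q] and, up to a null set, [s]: these are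
    (n-2)^m patterns of probability (n-1)^(-m) each. *)
Lemma missed_partner_null s q g : s != q ->
  P.-negligible [set w | forall i, (g <= i)%N -> partner (s, i) w <> q].
Proof.
move=> sq; have [mc mp iidE] := iid; set H := [set w | _].
have mH : measurable H.
  rewrite (_ : H = \bigcap_(i in [set i | (g <= i)%N]) ~` [set w | partner (s, i) w = q]).
    by apply: bigcap_measurable => [|i _]; [exists g => /=|apply/measurableC/mp].
  by apply/seteqP; split=> w.
suff P0 : P H <= 0.
  by apply/negligibleP => //; apply/eqP; rewrite eq_le measure_ge0 andbT.
pose x : R := (n.-2%:R / n.-1%:R)%R.
have Hx m : P H <= (x ^+ m)%:E.
  pose I := [seq (s, (g + i)%N) | i <- iota 0 m].
  have uI : uniq I.
    by rewrite map_inj_uniq ?iota_uniq // => i j [/addnI].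
  pose A : pred 'I_n := [pred y | (y != s) && (y != q)].
  pose qf (f : {ffun 'I_m -> 'I_n}) (i : 'I_n * nat) : 'I_n :=
    if insub (i.2 - g)%N is Some j then f j else q.
  have [|Z [mZ PZ HZ]] := @cylinder_cover {ffun 'I_m -> 'I_n} (enum (ffun_on A))
      (fun=> [::]) (fun=> xpredT) I qf 0 uI.
    move=> f; rewrite mem_enum => /ffun_onP fA; split=> // _ /mapP[i im ->] /=.
    rewrite /qf /= addKn; case: insubP => [j _ _|_]; last by rewrite eq_sym.
    by have /andP[] := fA j.
  have HZ' : H `<=` Z.
    move=> w Hw; apply: HZ.
    have [[i iI wi]|no] := pselect (exists2 i, i \in I & partner i w = i.1).
      by left; exists i.
    right; exists [ffun i : 'I_m => partner (s, (g + i)%N) w].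
      rewrite mem_enum; apply/ffun_onP => i; rewrite ffunE inE; apply/andP; split.
        apply/eqP => E; apply: no; exists (s, (g + i)%N) => //.
        by apply/mapP; exists (val i); rewrite // mem_iota add0n /=.
      by apply/eqP; apply: Hw; rewrite leq_addr.
    split=> // _ /mapP[i im ->]; rewrite /qf /= addKn.
    move: im; rewrite mem_iota add0n => /andP[_ im].
    by rewrite insubT ffunE.
  apply: le_trans (le_measure _ _ _ HZ') _; rewrite ?inE //.
  apply: le_trans PZ _; rewrite lee_fin expr0 mul1r -cardE card_ffun_on card_ord.
  rewrite size_map size_iota.
  have -> : #|A| = n.-2.
    have h : (2 + #|A| = n)%N.
      rewrite -[RHS]card_ord -(cardC [set s; q]%SET) cards2 sq; congr (_ + _)%N.
      by apply: eq_card => y; rewrite !inE negb_or.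
    by move: (#|A|) h => v <-.
  by rewrite /x expr_div_n -mulr_natl natrX exprVn.
have x01 : (`|x| < 1)%R.
  have n1 : (0 < n.-1%:R :> R)%R by rewrite ltr0n; case: (n) n_gt2 => [|[]].
  rewrite ger0_norm ?divr_ge0 ?ler0n // ltr_pdivrMr // mul1r ltr_nat.
  by case: (n) n_gt2 => [|[]].
have Pf : P H \is a fin_num by apply: fin_num_measure.
have PE : P H = (fine (P H))%:E by rewrite fineK.
rewrite PE lee_fin.
have := cvg_expr x01 => cx.
rewrite -(cvg_lim _ cx) //; apply: limr_ge; first by apply/cvg_ex; eexists; exact: cx.
by apply: nearW => m; rewrite -lee_fin -PE.
Qed.

Lemma partners_hit : {ae P, forall w, forall s q : 'I_n, s != q ->
  forall g, exists2 i, (g <= i)%N & partner (s, i) w = q}.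
Proof.
pose F (k : nat) : set T :=
  if unpickle k is Some (s, q, g) then
    if s != q :> 'I_n then [set w | forall i, (g <= i)%N -> partner (s, i) w <> q]
    else set0
  else set0.
have nF : P.-negligible (\bigcup_k F k).
  apply: negligible_bigcup => k; rewrite /F.
  case: (unpickle k) => [[[s q] g]|]; last exact: negligible_set0.
  by case: ifP => [sq|_]; [exact: missed_partner_null|exact: negligible_set0].
apply: negligibleS nF => w /= /existsNP[s /existsNP[q /not_implyP[sq /existsNP[g nh]]]].
exists (pickle (s, q, g)) => //; rewrite /F pickleK sq /= => i gi pi.
by apply: nh; exists i.
Qed.

End Cylinders.

(** * Union bound over the rounds and the expected delay *)

Section Delay.
Local Open Scope classical_set_scope.
Local Open Scope ring_scope.
Local Open Scope ereal_scope.
Context {R : realType} {d : measure_display} {T : measurableType d}.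
Variables (P : probability T R) (n : nat) (D : choiceType).
Local Notation event := (event n D).
Variables (coin : event -> T -> bool) (partner : 'I_n * nat -> T -> 'I_n).
Hypothesis iid : iid_uniform P coin partner.
Variables (a b p : 'I_n) (F : {set 'I_n}) (c r0 : nat).
Hypotheses (n_gt : (48 < n)%N) (ab : a != b) (ap : a != p) (bp : b != p).
Hypotheses (aF : a \notin F) (pF : p \notin F) (bF : b \in F).
Hypothesis cF : #|F| = n./2.
Hypotheses (c_gt1 : (1 < c)%N) (r0_gt0 : (0 < r0)%N).
Variable env : 'I_n -> nat -> D.

Let adv : adversary n D := delaying_adversary D a b p F c r0.
Let hd := heads (Genesis p (env p 0)).
Let n_gt2 : (2 < n)%N := ltn_trans (isT : (2 < 48)%N) n_gt.

Local Notation unbalanced := [pred A : {set 'I_n} | ~~ balanced A].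

Section Cover.
Variables (r k : nat).
Hypothesis r_gt0 : (0 < r)%N.

Let E : seq event := undup [seq e <- possible env k | (round e < r)%N].
Let I : seq ('I_n * nat) := [seq (q, i) | q <- enum 'I_n, i <- iota 0 k].
Let bits := {ffun 'I_(size E) -> bool}.
Let draws := {ffun 'I_n * 'I_k -> 'I_n}.

Let bits_coin (u : bits) (e : event) : bool :=
  if insub (index e E) is Some i then u i else false.
Let draws_partner (v : draws) (si : 'I_n * nat) : 'I_n :=
  if insub si.2 is Some i then v (si.1, i) else si.1.
Let config_of (j : bits * draws) :=
  exec env adv (bits_coin j.1) (draws_partner j.2) k.
Let W (j : bits * draws) := wit (hd (config_of j)) r.

Let W_witnesses j : (r <= current_round a b p F (config_of j))%N ->
  witnesses (hd (config_of j)) r (W j) /\ forall i, creator (W j i) = i.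
Proof.
move=> rk; have [ff hW _ _] := exec_history n_gt ab ap bp aF pF bF cF c_gt1 r0_gt0
  env (bits_coin j.1) (draws_partner j.2) k.
have HW : witnesses (hd (config_of j)) r (W j) by apply: hW; rewrite r_gt0.
by split=> // i; apply: witnesses_creator HW.
Qed.

Let proper : pred draws := [pred v : draws | [forall x, v x != x.1]].

Let card_proper : #|proper| = (n.-1 ^ (n * k))%N.
Proof.
rewrite (eq_card (_ : _ =i family (fun x : 'I_n * 'I_k => [pred y | y != x.1]))).
  rewrite card_family foldrE big_image /=.
  rewrite (eq_bigr (fun=> n.-1)) ?prod_nat_const ?card_prod ?card_ord // => x _.
  by rewrite cardC1 card_ord.
by move=> v; apply/forallP/familyP => h x; have := h x.
Qed.

(** The condition on [current_round] guarantees that [W] consists of actual witnesses rather than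
    junk values. *)
Let index_set : pred (bits * draws * {set 'I_n}) :=
  [pred j | [&& proper j.1.2, unbalanced j.2
    & (r <= current_round a b p F (config_of j.1))%N]].

Let card_index_set :
  (#|index_set| <= 2 ^ size E * n.-1 ^ (n * k) * #|unbalanced|)%N.
Proof.
have -> : (2 ^ size E = #|{: bits}|)%N by rewrite card_ffun card_bool card_ord.
rewrite -card_proper -!cardX; apply/subset_leq_card/fintype.subsetP => -[[u v] A].
by move=> /and3P[pv ub _]; apply/andP; split=> //; apply/andP; split.
Qed.

(** One cylinder is used for each triple of values of the coins in [E], values of the draws, and
    unbalanced coin pattern on the witnesses that these determine. Witnesses of round [r] are not in
    [E], so each cylinder fixes [size E + n] distinct coins; summing over the first two components
    leaves 2^(-n) for each unbalanced pattern. *)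
Lemma unbalanced_cover : exists Z : set T,
  [/\ measurable Z, P Z <= ((2%:R^-1 ^+ n) *+ #|unbalanced|)%:E
    & forall w, unbalanced_round a b p F c r0 env (coin_at coin w)
        (partner_at partner w) r k -> Z w].
Proof.
have uI : uniq I.
  apply: allpairs_uniq; rewrite ?enum_uniq ?iota_uniq //.
  by move=> [? ?] [? ?] _ _ [-> ->].
have sI : size I = (n * k)%N by rewrite size_allpairs size_enum_ord size_iota.
pose bj (j : bits * draws * {set 'I_n}) e :=
  if e \in E then bits_coin j.1.1 e else creator e \in j.2.
have [|Z [mZ PZ HZ]] := @cylinder_cover _ _ _ P n D coin partner iid n_gt2 _
    (enum index_set) (fun j => E ++ [seq W j.1 i | i <- enum 'I_n])
    bj I (fun j => draws_partner j.1.2) (size E + n)%N uI.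
  move=> j; rewrite mem_enum => /and3P[/forallP pj _ /W_witnesses[HW cW]]; split.
  - rewrite cat_uniq undup_uniq /=; apply/andP; split.
      apply/hasPn => _ /mapP[i _ ->]; rewrite mem_undup mem_filter.
      by have [_ _ ->] := HW i; rewrite ltnn.
    by rewrite map_inj_uniq ?enum_uniq // => i i' /(congr1 (@creator _ _)); rewrite !cW.
  - by rewrite size_cat size_map size_enum_ord.
  - move=> _ /allpairsP[[q i] [_ ik ->]] /=; rewrite /draws_partner /=.
    move: ik; rewrite mem_iota add0n => /andP[_ ik].
    by rewrite insubT; have := pj (q, Ordinal ik).
exists Z; split=> //.
  apply: le_trans PZ _; rewrite lee_fin sI -cardE exprD.
  have n1 : (0 < n.-1%:R :> R)%R by rewrite ltr0n; case: (n) n_gt2 => [|[]].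
  rewrite -mulr_natr -[leRHS]mulr_natr.
  have le : (#|index_set|%:R <= (2 ^ size E * n.-1 ^ (n * k) * #|unbalanced|)%:R :> R)%R.
    by rewrite ler_nat.
  apply: le_trans (ler_wpM2l _ le) _.
    by rewrite !mulr_ge0 ?exprn_ge0 ?invr_ge0 ?ler0n.
  rewrite !natrM !natrX !exprVn.
  have h2 : ((2%:R : R) ^+ size E != 0)%R by rewrite expf_neq0 // pnatr_eq0.
  have h1 : ((n.-1%:R : R) ^+ (n * k) != 0)%R by rewrite expf_neq0 // gt_eqF.
  have h3 : ((2%:R : R) ^+ n != 0)%R by rewrite expf_neq0 // pnatr_eq0.
  rewrite le_eqVlt; apply/orP; left; apply/eqP; field.
  by rewrite h1 h2 h3.
move=> w [rk nb]; apply: HZ.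
have [[i iI wi]|no] := pselect (exists2 i, i \in I & partner i w = i.1).
  by left; exists i.
right.
pose u : bits := [ffun i => coin (tnth (in_tuple E) i) w].
pose v : draws := [ffun si => partner (si.1, val si.2) w].
have uE e : e \in E -> coin_at coin w e = bits_coin u e.
  move=> eE; rewrite /bits_coin insubT ?index_mem // => lt.
  by rewrite ffunE (tnth_nth e) /= nth_index.
have vE q i : (i < k)%N -> partner_at partner w (q, i) = draws_partner v (q, i).
  by move=> ik; rewrite /draws_partner /= insubT ffunE.
have coinE e : e \in possible env k -> (round e < r)%N ->
    coin_at coin w e = bits_coin u e.
  by move=> ek er; apply: uE; rewrite mem_undup mem_filter er.
(* The actual run and the run replayed from the recorded values may differ in the coins of round [r]
   and later, but have the same round-[r] witnesses. *)
have [rk' HW' wE] := wit_agree n_gt ab ap bp aF pF bF cF c_gt1 r0_gt0 coinE vE r_gt0 rk.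
have [HW cW] := @W_witnesses (u, v) rk'.
pose A : {set 'I_n} := [set i | coin_at coin w (W (u, v) i)]%SET.
exists (u, v, A).
  rewrite mem_enum; apply/and3P; split; [| |exact: rk'].
    apply/forallP => -[q i]; rewrite [v _]ffunE; apply/eqP => wi; apply: no.
    exists (q, val i); last exact: wi.
    apply/allpairsP; exists (q, val i).
    by rewrite mem_enum mem_iota add0n; split=> //; apply: ltn_ord.
  by move: nb; rewrite (funext wE).
split=> [e|[q i]].
  rewrite mem_cat /bj; case: ifP => [eE _|_ /mapP[i _ ->]]; first exact: uE.
  by rewrite cW inE.
move=> /allpairsP[[q' i'] [_ ik [-> ->]]]; apply: vE.
by move: ik; rewrite mem_iota add0n.
Qed.

End Cover.

(** With [u = n %/ 32], a round is unbalanced with probability at most 2^(1-u). Over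
    [m = 2 ^ (u - 2)] rounds this sums to at most 1/2, so with probability at least 1/2 no decision
    comes before [m] rounds, and the expectation is at least m/2. *)
Lemma expected_delay : (7 < n %/ 32)%N ->
  (2%:R ^+ (n %/ 32 - 3))%:E
    <= expected_rounds_to_decision P coin partner env adv c p r0.
Proof.
set u := (n %/ 32)%N => u_gt; pose m := (2 ^ (u - 2))%N.
pose beta : R := ((2%:R^-1 ^+ n) *+ #|unbalanced|)%R.
have cover (x : nat * nat) : exists Z : set T, [/\ measurable Z, P Z <= beta%:E
    & forall w, unbalanced_round a b p F c r0 env (coin_at coin w)
        (partner_at partner w) (r0 + x.1) x.2 -> Z w].
  by apply: unbalanced_cover; rewrite addn_gt0 r0_gt0.
have [Z ZP] := choice cover.
pose Y k := \big[setU/set0]_(e <- iota 0 m) Z (e, k).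
have mY k : measurable (Y k).
  by apply: bigsetU_measurable => e _; case: (ZP (e, k)).
have PY k : P (Y k) <= (beta *+ m)%:E.
  have := @measure_bigsetU_le _ _ _ P _ (iota 0 m) (fun e => Z (e, k)) beta.
  by rewrite size_iota; apply=> [e|e _]; case: (ZP (e, k)).
have [mB PB] := measure_liminf_le mY PY.
set B := \bigcup_k _ in mB PB.
have late w x e : ~ B w -> is_round_witness_of env adv (coin_at coin w)
    (partner_at partner w) p r0 x ->
    decided_after env adv (coin_at coin w) (partner_at partner w) c x e -> (m <= e)%N.
  move=> nB xw de; rewrite leqNgt; apply/negP => em; apply: nB.
  have [k kP] := decision_unbalanced n_gt ab ap bp aF pF bF cF c_gt1 r0_gt0 xw de em.
  exists k => // k' /= kk'; have [e' e'm ub] := kP k' kk'.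
  rewrite /Y -bigcup_seq; exists e'; first by rewrite /= mem_iota add0n.
  by have [_ _] := ZP (e', k'); apply.
have betam : (beta *+ m <= 2%:R^-1)%R.
  have -> : (beta *+ m = (#|unbalanced| * m)%:R / 2%:R ^+ n)%R.
    by rewrite /beta -mulrnA -[LHS]mulr_natl exprVn.
  rewrite ler_pdivrMr ?exprn_gt0 ?ltr0n // -(@ler_pM2l _ 2%:R) ?ltr0n //.
  rewrite mulVKf ?pnatr_eq0 // -natrM -natrX ler_nat.
  rewrite -(@leq_pmul2l 2) // -expnS; apply: leq_trans (few_unbalanced n).
  have -> : (2 ^ (n %/ 32) = 4 * m)%N.
    by rewrite /m -[4%N]/(2 ^ 2)%N -expnD subnKC // (leq_trans _ u_gt).
  by rewrite [leqRHS]mulnCA [leqLHS]mulnA.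
have mA : measurable (~` B) by apply: measurableC.
have PA : (2%:R^-1)%:E <= P (~` B).
  rewrite probability_setC // -[X in X <= _](_ : (1 - 2%:R^-1)%:E = _); last first.
    by congr (_%:E); field.
  rewrite EFinB leeB // (le_trans PB) // lee_fin //.
have f0 w : 0 <= rounds_to_decision R coin partner env adv c p r0 w.
  by apply: le_ereal_inf_tmp => _ [e _ <-]; rewrite lee_fin ler0n.
have fA w : (~` B) w -> m%:R%:E <= rounds_to_decision R coin partner env adv c p r0 w.
  move=> nB; apply: le_ereal_inf_tmp => _ [e [x xw de] <-].
  by rewrite lee_fin ler_nat; apply: late nB xw de.
apply: le_trans (@integral_ge_cst _ _ _ P _ _ _ mA (ler0n R m) f0 fA).
have m0 : 0 <= m%:R%:E :> \bar R by rewrite lee_fin ler0n.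
apply: le_trans (lee_wpmul2l m0 PA); rewrite -EFinM lee_fin /m natrX.
rewrite (_ : u - 2 = (u - 3).+1)%N; last by rewrite -subSn ?subSS // (leq_trans _ u_gt).
by rewrite exprS mulrAC divff ?mul1r // pnatr_eq0.
Qed.

Lemma delay_fair : almost_surely_fair P coin partner env adv.
Proof.
apply: filterS (partners_hit iid n_gt2) => w hit.
exact: (run_fair n_gt ab ap bp aF pF bF cF c_gt1 r0_gt0).
Qed.

Lemma delay_has_witness : almost_surely_has_witness P coin partner env adv p r0.
Proof.
apply: filterS (partners_hit iid n_gt2) => w hit.
exact: (has_witness n_gt ab ap bp aF pF bF cF c_gt1 r0_gt0).
Qed.

End Delay.

Lemma parties_exist (n : nat) (p : 'I_n) : (48 < n)%N ->
  exists (a b : 'I_n) (F : {set 'I_n}),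
    [/\ a != b, a != p & b != p] /\
    [/\ a \notin F, p \notin F, b \in F & #|F| = n./2].
Proof.
move=> n_gt.
have other (A : {set 'I_n}) : (#|A| < n)%N -> exists x, x \notin A.
  move=> An; have : (0 < #|~: A|)%N by rewrite cardsCs finset.setCK card_ord subn_gt0.
  by case/card_gt0P => x; rewrite inE => xA; exists x.
have [a aA] : exists a, a \notin [set p]%SET by apply: other; rewrite cards1; lia.
have [b bA] : exists b, b \notin [set a; p]%SET.
  by apply: other; rewrite cards2; case: (_ != _); lia.
move: aA bA; rewrite !inE negb_or => ap /andP[ba bp].
have [||F bF [FS cF]] := @set_between _ [set b]%SET (~: [set a; p])%SET n./2.
- by rewrite finset.sub1set !inE negb_or ba.
- by rewrite cards1 cardsCs finset.setCK card_ord cards2 ap; lia.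
exists a, b, F; split; first by rewrite eq_sym.
split=> //; last by rewrite -finset.sub1set.
  by apply/negP => /(fintype.subsetP FS); rewrite !inE eqxx.
by apply/negP => /(fintype.subsetP FS); rewrite !inE eqxx orbT.
Qed.

Lemma expR_ln2_le (R : realType) (n m : nat) : (n <= 64 * m)%N ->
  (expR (ln 2%:R / 64%:R * n%:R) <= 2%:R ^+ m :> R)%R.
Proof.
move=> nm; have two : (0 < 2%:R :> R)%R by rewrite ltr0n.
have ln2 : (0 <= ln 2%:R :> R)%R by rewrite ln_ge0 // ler1n.
rewrite -[X in (_ <= X ^+ _)%R]lnK ?posrE // -expRM_natl ler_expR.
rewrite -mulrA [leRHS]mulrC ler_wpM2l // mulrC ler_pdivrMr ?ltr0n //.
by rewrite mulrC -natrM ler_nat.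
Qed.

Local Open Scope ring_scope.

Theorem theorem9 (R : realType) :
  exists alpha : R, 0 < alpha /\ exists N : nat,
  forall n t c r : nat,
  (N <= n)%N -> (3 * t < n)%N -> (1 < c)%N -> (1 <= r)%N ->
  forall (p : 'I_n) (D : choiceType),
  exists A : adversary n D,
    [/\ (#|corrupted A| <= t)%N,
        p \notin corrupted A
      & forall (env : 'I_n -> nat -> D)
               (disp : measure_display) (Omega : measurableType disp)
               (P : probability Omega R)
               (coin : event n D -> Omega -> bool)
               (partner : 'I_n * nat -> Omega -> 'I_n),
        iid_uniform P coin partner ->
        [/\ almost_surely_fair P coin partner env A,
            almost_surely_has_witness P coin partner env A p r
          & ((expR (alpha * n%:R))%:E
              <= expected_rounds_to_decision P coin partner env A c p r)%E]].
Proof.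
(* The exponent [n %/ 32 - 3] is at least n/64 once [n] reaches 256, which absorbs both the rounding
   and the 3. *)
exists (ln 2%:R / 64%:R); split.
  by rewrite divr_gt0 ?ltr0n // ln_gt0 // ltr1n.
exists 256%N => n t c r n_ge _ c_gt1 r_gt0 p D.
have n_gt : (48 < n)%N by lia.
have [a [b [F [[ab ap bp] [aF pF bF cF]]]]] := parties_exist p n_gt.
exists (delaying_adversary D a b p F c r); split.
- by rewrite /= cards0.
- by rewrite /= inE.
move=> env disp Omega P coin partner iid; split.
- exact: (delay_fair iid).
- exact: (delay_has_witness iid).
apply: le_trans (@expected_delay _ _ _ P n D coin partner iid a b p F c r
  n_gt ab ap bp aF pF bF cF c_gt1 r_gt0 env _); last by lia.
by rewrite lee_fin; apply: expR_ln2_le; lia.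
Qed.
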